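(* Let $\mathbf{A}\in\mathbb{R}^{n\times d}$ have nonzero rows $a_1,\dots,a_n$, let $b\in\mathbb{R}^n$, suppose $\mu=\lambda_d(\mathbf{A}^\top\mathbf{A})>0$, and suppose $\kappa\le d^2$. Then there is a randomized algorithm that, given an initial point $x_0\in\mathbb{R}^d$, computes an $\epsilon$-approximate solution to the regression problem in running time $$O\left(\left(\mathrm{nnz}(\mathbf{A})+\sqrt{\kappa}\sum_{i=1}^n\frac{\|a_i\|_2^2}{\mu}\sqrt{s_i}\right)\log\left(\frac{1}{\epsilon}\right)\right).$$
   Context: $\mathrm{nnz}(\mathbf{A})$ is the number of nonzero entries of $\mathbf{A}$; $s_i=\|a_i\|_1^2/\|a_i\|_2^2$ is the numerical sparsity of row $a_i$; $\lambda_d(\mathbf{A}^\top\mathbf{A})$ is the smallest eigenvalue of $\mathbf{A}^\top\mathbf{A}$; $\kappa=\|\mathbf{A}\|_F^2/\mu$. The regression problem is to find $x^*=\arg\min_{x\in\mathbb{R}^d}\|\mathbf{A}x-b\|_2^2$; given $x_0$, a point $x$ is an $\epsilon$-approximate solution if $\|x-x^*\|_{\mathbf{A}^\top\mathbf{A}}\le\epsilon\|x_0-x^*\|_{\mathbf{A}^\top\mathbf{A}}$, where $\|y\|_{\mathbf{M}}^2=y^\top\mathbf{M}y$. *)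

(* Defs.v *)
From HB Require Import structures.
From mathcomp Require Import all_boot all_order all_algebra.
From mathcomp Require Import boolp reals exp.

Set Implicit Arguments.
Unset Strict Implicit.
Unset Printing Implicit Defensive.

Import Order.TTheory GRing.Theory Num.Theory.
Local Open Scope ring_scope.

Section Regression.
Variable R : realType.

Definition l1norm m n (A : 'M[R]_(m, n)) : R := \sum_i \sum_j `|A i j|.

(* The Frobenius norm; on row and column vectors it is the Euclidean norm. *)
Definition l2norm m n (A : 'M[R]_(m, n)) : R :=
  Num.sqrt (\sum_i \sum_j A i j ^+ 2).

Definition nnz m n (A : 'M[R]_(m, n)) : nat :=
  #|[set ij : 'I_m * 'I_n | A ij.1 ij.2 != 0]|.

Definition numerical_sparsity n d (A : 'M[R]_(n, d)) (i : 'I_n) : R :=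
  l1norm (row i A) ^+ 2 / l2norm (row i A) ^+ 2.

(* For d = 0 there is no eigenvalue, so the predicate is then unsatisfiable. *)
Definition is_smallest_eigenvalue d (M : 'M[R]_d) (mu : R) : Prop :=
  eigenvalue M mu /\ forall nu, eigenvalue M nu -> mu <= nu.

Definition kappa n d (A : 'M[R]_(n, d)) (mu : R) : R := l2norm A ^+ 2 / mu.

Definition mnorm d (M : 'M[R]_d) (y : 'cV[R]_d) : R :=
  Num.sqrt ((y^T *m M *m y) 0 0).

Definition regression_solution n d (A : 'M[R]_(n, d)) (b : 'cV[R]_n)
    (xs : 'cV[R]_d) : Prop :=
  forall x : 'cV[R]_d, l2norm (A *m xs - b) ^+ 2 <= l2norm (A *m x - b) ^+ 2.

Definition approx_solution n d (A : 'M[R]_(n, d)) (b : 'cV[R]_n)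
    (x0 : 'cV[R]_d) (eps : R) (x : 'cV[R]_d) : Prop :=
  exists2 xs, regression_solution A b xs &
    mnorm (A^T *m A) (x - xs) <= eps * mnorm (A^T *m A) (x0 - xs).

End Regression.

(* A randomized real RAM at unit cost per instruction.  A program is a finite *)
(* list of instructions; it contains no real constant, so it cannot hard-wire *)
(* any information about a particular instance.                               *)
(*   The memory consists of natural-number registers, real registers, and     *)
(* unbounded arrays of naturals and of reals.  Register and array names are   *)
(* literals of the program (so that a program uses finitely many of them);    *)
(* array cells are addressed indirectly, through a natural register.  There   *)
(* is no conversion from reals to naturals.                                   *)
(*   Naming: r, s, t are natural registers, x, y, z real registers, a is an   *)
(* array, l is a program address; the target comes first.                     *)
Inductive instr : Type :=
| NConst of nat & nat          (* r := k *)
| NAdd of nat & nat & nat      (* r := s + t *)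
| NSub of nat & nat & nat      (* r := s - t, truncated *)
| NLoad of nat & nat & nat     (* r := a[s] *)
| NStore of nat & nat & nat    (* a[s] := t *)
| RCast of nat & nat           (* x := s *)
| RAdd of nat & nat & nat      (* x := y + z *)
| RSub of nat & nat & nat      (* x := y - z *)
| RMul of nat & nat & nat      (* x := y * z *)
| RDiv of nat & nat & nat      (* x := y / z, with y / 0 = 0 *)
| RLoad of nat & nat & nat     (* x := a[s] *)
| RStore of nat & nat & nat    (* a[s] := x *)
| Jump of nat                  (* goto l *)
| NJumpLt of nat & nat & nat   (* if s < t goto l *)
| RJumpLt of nat & nat & nat   (* if x < y goto l *)
| NRand of nat & nat           (* r := uniform in {0, .., s - 1}; 0 if s = 0 *)
| JumpRand of nat & nat.       (* goto l with probability min 1 (max 0 x) *)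

Definition program := seq instr.

Definition upd T (f : nat -> T) (i : nat) (v : T) : nat -> T :=
  fun j => if j == i then v else f j.

Section Machine.
Variable R : realType.

Record state := State {
  pc : nat;
  nreg : nat -> nat;
  rreg : nat -> R;
  narr : nat -> nat -> nat;
  rarr : nat -> nat -> R
}.

Definition goto l (c : state) :=
  State l (nreg c) (rreg c) (narr c) (rarr c).
Definition set_nreg r v (c : state) :=
  State (pc c).+1 (upd (nreg c) r v) (rreg c) (narr c) (rarr c).
Definition set_rreg x v (c : state) :=
  State (pc c).+1 (nreg c) (upd (rreg c) x v) (narr c) (rarr c).
Definition set_narr a i v (c : state) :=
  State (pc c).+1 (nreg c) (rreg c) (upd (narr c) a (upd (narr c a) i v))
    (rarr c).
Definition set_rarr a i v (c : state) :=
  State (pc c).+1 (nreg c) (rreg c) (narr c)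
    (upd (rarr c) a (upd (rarr c a) i v)).

(* The distribution of the next state, as a list of weighted outcomes. *)
Definition exec (I : instr) (c : state) : seq (R * state) :=
  let N := nreg c in let X := rreg c in
  match I with
  | NConst r k => [:: (1, set_nreg r k c)]
  | NAdd r s t => [:: (1, set_nreg r (N s + N t)%N c)]
  | NSub r s t => [:: (1, set_nreg r (N s - N t)%N c)]
  | NLoad r a s => [:: (1, set_nreg r (narr c a (N s)) c)]
  | NStore a s t => [:: (1, set_narr a (N s) (N t) c)]
  | RCast x s => [:: (1, set_rreg x (N s)%:R c)]
  | RAdd x y z => [:: (1, set_rreg x (X y + X z) c)]
  | RSub x y z => [:: (1, set_rreg x (X y - X z) c)]
  | RMul x y z => [:: (1, set_rreg x (X y * X z) c)]
  | RDiv x y z => [:: (1, set_rreg x (X y / X z) c)]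
  | RLoad x a s => [:: (1, set_rreg x (rarr c a (N s)) c)]
  | RStore a s x => [:: (1, set_rarr a (N s) (X x) c)]
  | Jump l => [:: (1, goto l c)]
  | NJumpLt s t l =>
      [:: (1, goto (if (N s < N t)%N then l else (pc c).+1) c)]
  | RJumpLt x y l => [:: (1, goto (if X x < X y then l else (pc c).+1) c)]
  | NRand r s =>
      if N s is 0 then [:: (1, set_nreg r 0%N c)]
      else [seq ((N s)%:R^-1, set_nreg r k c) | k <- iota 0 (N s)]
  | JumpRand x l =>
      let p := Num.min 1 (Num.max 0 (X x)) in
      [:: (p, goto l c); (1 - p, goto (pc c).+1 c)]
  end.

Definition halted (P : program) (c : state) : bool := (size P <= pc c)%N.

Definition step (P : program) (c : state) : seq (R * state) :=
  exec (nth (Jump 0) P (pc c)) c.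

(* The probability that P, started in c, executes at most t instructions,     *)
(* halts, and does so in a state satisfying E.                                *)
Fixpoint halt_prob (P : program) (E : state -> Prop) (t : nat) (c : state) : R :=
  if halted P c then (`[< E c >])%:R
  else if t is t'.+1 then
    \sum_(pc' <- step P c) pc'.1 * halt_prob P E t' pc'.2
  else 0.

(* The matrix is presented in compressed sparse row format: the nonzero       *)
(* entries of row i, by increasing column, are those at positions             *)
(* csr_ptr i <= k < csr_ptr i.+1 of csr_col and csr_val.                      *)
Definition row_nz n d (A : 'M[R]_(n, d)) (i : 'I_n) : seq 'I_d :=
  [seq j <- enum 'I_d | A i j != 0].
Definition csr_ptr n d (A : 'M[R]_(n, d)) (k : nat) : nat :=
  (\sum_(i < n | (i < k)%N) size (row_nz A i))%N.
Definition csr_col n d (A : 'M[R]_(n, d)) : seq nat :=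
  flatten [seq [seq val j | j <- row_nz A i] | i <- enum 'I_n].
Definition csr_val n d (A : 'M[R]_(n, d)) : seq R :=
  flatten [seq [seq A i j | j <- row_nz A i] | i <- enum 'I_n].

Definition vec_cells n (v : 'cV[R]_n) (k : nat) : R :=
  if insub k is Some i then v i 0 else 0.

(* Natural registers 0, 1 hold n, d and real registers 0, 1 hold eps, mu;     *)
(* natural arrays 0, 1 and real arrays 0, 1, 2 hold csr_ptr, csr_col and      *)
(* csr_val, b, x0.  Everything else is 0.                                     *)
Definition input_state n d (A : 'M[R]_(n, d)) (b : 'cV[R]_n) (x0 : 'cV[R]_d)
    (mu eps : R) : state :=
  State 0
    (nth 0%N [:: n; d])
    (nth 0 [:: eps; mu])
    (nth (fun=> 0%N) [:: csr_ptr A; nth 0%N (csr_col A)])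
    (nth (fun=> 0) [:: nth 0 (csr_val A); vec_cells b; vec_cells x0]).

(* The output is read from the first d cells of real array 3. *)
Definition output d (c : state) : 'cV[R]_d := \col_(j < d) rarr c 3 j.

End Machine.

(* Main.v *)
Require Import Defs.
From HB Require Import structures.
From mathcomp Require Import all_boot all_order all_algebra.
From mathcomp Require Import boolp reals exp.
From mathcomp Require Import zify ring lra.
From mathcomp Require sesquilinear spectral complex.

Set Implicit Arguments.
Unset Strict Implicit.
Unset Printing Implicit Defensive.

Import Order.TTheory GRing.Theory Num.Theory.
Local Open Scope ring_scope.

(** The program is variance-reduced gradient descent.  With
    [F = ||A||_F^2], [kappa = F / mu] and step [eta = 1 / (300 F)], an epoch
    computes the full gradient [g = A^T (A z - b)] and then, a geometric number
    of times (mean [2400 kappa]), replaces the displacement [v] by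
    [v - eta g - (eta / p_i) beta a], where row [i] is drawn with probability
    [p_i] between [||a_i||^2 / (2 F)] and [||a_i||^2 / F], and [beta], [a] are
    independent unbiased estimates of [a_i . v] and [a_i].  The multiple of [g]
    is kept as a scalar, so a step touches only the sampled coordinates.

    Both estimates are stratified.  An entry [a_ij] of a row with [N] nonzero
    entries gets the next [ceil (N |a_ij| / ||a_i||_1)] slots; the slots are cut
    into blocks of [B] consecutive ones, where [B] is about
    [N ||a_i||_2 / (||a_i||_1 sqrt kappa)], and one slot is drawn from each
    block.  A block inside the run of one entry has no variance, so each entry
    contributes only through the slots within [B] of the ends of its run.  This
    gives [Var beta <= 2 ||a_i||^2 |v|^2 / kappa] and, as [d <= kappa],
    [Var a <= 2 ||a_i||^2], with at most [5 sqrt (s_i kappa)] draws.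

    Hence [E |e'|^2 <= |e|^2 - eta |A e|^2 + 36 eta^2 F |A e_0|^2] for the error
    [e] of the iterate, [e_0] being its value at the start of the epoch; stopping
    at a geometric time turns this into [E |A e|^2 <= |A e_0|^2 / 2] per epoch.
    Time and error are bounded together by one potential, in which halting with
    a bad output costs as much as exhausting the time budget. *)

(** The square root in the time bound comes from stratification. With [m] independent draws the
    variance decays like [1/m]; with one draw from each of [m] blocks it is of order
    [||a_i||_1^2 |c|^2 / m^2], since only the two ends of a run contribute and a slot is worth at
    most [||a_i||_1 / N]. A variance of order [||a_i||_2^2 |c|^2 / kappa] is thus reached with about
    [sqrt (s_i kappa)] draws. The machine shapes the rest. It cannot turn a real into a natural, so
    slots are handed out by counting up to a real; it has neither square root nor logarithm, so
    block sizes are searched among squares and the epochs are controlled by doubling a real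
    register. A non-uniform row distribution is a uniform draw of a slot followed by a coin flip.
    Halting probabilities are given only for a finite number of steps, so the running time is never
    treated as a random variable: a bound is carried backwards through the code, and Markov's
    inequality, for time and for error, enters only through the charge [T] of a failed run. *)

Section HaltProb.
Variable R : realType.
Variable P : program.
Implicit Types (s c : state R) (E : state R -> Prop).

Lemma step_ge0 c : all (fun x => 0 <= x.1) (step P c).
Proof.
rewrite /step; case: (nth _ _ _) => /=; intros; rewrite ?ler01 //.
  case: (nreg c _) => [|k]; first by rewrite /= ler01.
  by rewrite all_map; apply/allP => i _ /=; rewrite invr_ge0.
rewrite subr_ge0 ge_min lexx /= andbT.
by rewrite le_min ler01 le_max lexx.
Qed.

Lemma weighted_sum_le (l : seq (R * state R)) (g h : state R -> R) :
  all (fun x => 0 <= x.1) l -> (forall c, g c <= h c) ->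
  \sum_(x <- l) x.1 * g x.2 <= \sum_(x <- l) x.1 * h x.2.
Proof.
move=> l0 gh; elim: l l0 => [|x l IHl]; rewrite ?big_nil // !big_cons /=.
by move=> /andP[x0 /IHl ?]; apply: lerD => //; apply: ler_wpM2l.
Qed.

Lemma halt_prob_ge0 E t c : 0 <= halt_prob P E t c.
Proof.
elim: t c => [|t IH] c /=; case: ifP => _ //; rewrite ?ler0n //.
have := weighted_sum_le (step_ge0 c) IH.
by rewrite big1 // => x _; rewrite mulr0.
Qed.

Lemma halt_prob_mono E E' t c : (forall s, E s -> E' s) ->
  halt_prob P E t c <= halt_prob P E' t c.
Proof.
move=> EE; elim: t c => [|t IH] c /=; case: ifP => _ //.
- by rewrite ler_nat; do 2 case: asboolP => //; auto.
- by rewrite ler_nat; do 2 case: asboolP => //; auto.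
exact: weighted_sum_le (step_ge0 c) IH.
Qed.

(* Only finitely many states are reachable in [t] steps, so approximation to  *)
(* every positive tolerance gives exactness: needed if [x0] is optimal.       *)
Lemma halt_prob_gap (f : state R -> R) t c : exists2 rho, 0 < rho &
  halt_prob P (fun s => f s <= rho) t c <= halt_prob P (fun s => f s <= 0) t c.
Proof.
have base c' : exists2 rho, 0 < rho &
    (`[< f c' <= rho >])%:R <= (`[< f c' <= 0 >])%:R :> R.
  case: (leP (f c') 0) => h.
    by exists 1 => //; rewrite ler_nat; case: asboolP => // _; case: asboolP.
  exists (f c' / 2); first by rewrite divr_gt0.
  by case: asboolP => // h2; exfalso; lra.
elim: t c => [|t IH] c /=; case: ifP => _; try exact: base; first by exists 1.
elim: (step P c) (step_ge0 c) => [|x l IHl].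
  by move=> _; exists 1 => //; rewrite !big_nil.
move=> /= /andP[x0 l0]; have [r1 r10 h1] := IHl l0; have [r2 r20 h2] := IH x.2.
exists (Num.min r1 r2); first by rewrite lt_min r10 r20.
rewrite !big_cons; apply: lerD.
  apply: ler_wpM2l => //; apply: le_trans h2; apply: halt_prob_mono => s.
  by rewrite le_min => /andP[].
apply: le_trans h1; apply: weighted_sum_le => // c'; apply: halt_prob_mono => s.
by rewrite le_min => /andP[].
Qed.

End HaltProb.

(** * Structured programs *)

Inductive guard := GN of nat & nat | GR of nat & nat.

Definition guard_instr g l :=
  match g with GN s t => NJumpLt s t l | GR x y => RJumpLt x y l end.

(* [LoopR x c] leaves the loop with probability [x] before each execution of  *)
(* [c]; [IfR x c] executes [c] with probability [x].                          *)
Inductive cmd :=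
| Blk of seq instr
| Rnd of nat & nat
| Sq of cmd & cmd
| If of guard & cmd
| While of guard & cmd
| IfR of nat & cmd
| LoopR of nat & cmd.

Fixpoint csize c : nat :=
  match c with
  | Blk b => size b
  | Rnd _ _ => 1
  | Sq c1 c2 => csize c1 + csize c2
  | If _ c => (csize c).+2
  | While _ c => (csize c).+3
  | IfR _ c => (csize c).+2
  | LoopR _ c => (csize c).+2
  end.

(** Jumps are absolute, hence the address [l]. A conditional instruction jumps only when its test
    succeeds, so [If], [While] and [IfR] put a plain jump over the body right behind it; [LoopR]
    tests for leaving and needs none. *)
Fixpoint compile l c : seq instr :=
  match c with
  | Blk b => b
  | Rnd r s => [:: NRand r s]
  | Sq c1 c2 => compile l c1 ++ compile (l + csize c1) c2
  | If g c => [:: guard_instr g l.+2, Jump (l.+2 + csize c) & compile l.+2 c]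
  | While g c => [:: guard_instr g l.+2, Jump (l.+2 + csize c).+1
                   & rcons (compile l.+2 c) (Jump l)]
  | IfR x c => [:: JumpRand x l.+2, Jump (l.+2 + csize c) & compile l.+2 c]
  | LoopR x c => JumpRand x (l.+1 + csize c).+1
                   :: rcons (compile l.+1 c) (Jump l)
  end.

Lemma size_compile c l : size (compile l c) = csize c.
Proof.
elim: c l => //= [c1 IH1 c2 IH2|g c IH|g c IH|x c IH|x c IH] l;
  by rewrite ?size_cat ?size_rcons ?IH1 ?IH2 ?IH.
Qed.

(** * Expected-time rules for structured programs *)

Section Semantics.
Variable R : realType.
Implicit Types (s : state R) (I : instr).

Definition guard_val g s : bool :=
  match g with
  | GN a b => (nreg s a < nreg s b)%N
  | GR x y => rreg s x < rreg s y
  end.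

Definition run1 I s : state R :=
  let N := nreg s in let X := rreg s in
  match I with
  | NConst r k => set_nreg r k s
  | NAdd r a b => set_nreg r (N a + N b)%N s
  | NSub r a b => set_nreg r (N a - N b)%N s
  | NLoad r a i => set_nreg r (narr s a (N i)) s
  | NStore a i b => set_narr a (N i) (N b) s
  | RCast x a => set_rreg x (N a)%:R s
  | RAdd x y z => set_rreg x (X y + X z) s
  | RSub x y z => set_rreg x (X y - X z) s
  | RMul x y z => set_rreg x (X y * X z) s
  | RDiv x y z => set_rreg x (X y / X z) s
  | RLoad x a i => set_rreg x (rarr s a (N i)) s
  | RStore a i x => set_rarr a (N i) (X x) s
  | _ => s
  end.

Definition straight I : bool :=
  match I with
  | Jump _ | NJumpLt _ _ _ | RJumpLt _ _ _ | NRand _ _ | JumpRand _ _ => false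
  | _ => true
  end.

Definition run b s := foldl (fun s I => run1 I s) s b.

Lemma exec_straight I s : straight I -> exec I s = [:: (1, run1 I s)].
Proof. by case: I. Qed.

Lemma run1_goto I l s : straight I -> run1 I (goto l s) = goto l.+1 (run1 I s).
Proof. by case: I. Qed.

Section Program.
Variables (P : program) (E : state R -> Prop) (T : nat).

(* [w] bounds the expected remaining running time, where halting outside [E]  *)
(* counts as [T] steps; [t] is the number of steps still available.           *)
Definition bounded t s w :=
  0 <= w /\ ((t <= T)%N -> t%:R - w <= T%:R * halt_prob P E t s).

Lemma bounded_le t s w w' : bounded t s w -> w <= w' -> bounded t s w'.
Proof.
move=> [w0 H] le; split; first exact: le_trans le.
by move=> /H h; apply: le_trans h; rewrite lerD2l lerN2.
Qed.

Lemma bounded0 s w : 0 <= w -> bounded 0 s w.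
Proof.
move=> w0; split=> // _; rewrite sub0r.
by apply: (@le_trans _ _ 0); rewrite ?oppr_le0 // mulr_ge0 ?halt_prob_ge0.
Qed.

Lemma bounded_halt t s w : halted P s -> 0 <= w ->
  (~ E s -> T%:R <= w) -> bounded t s w.
Proof.
move=> h w0 hw; split=> // tT.
have -> : halt_prob P E t s = (`[< E s >])%:R by case: t {tT} => /=; rewrite h.
case: asboolP => [_|/hw Tw]; first by rewrite mulr1 lerBlDr ler_wpDr ?ler_nat.
by rewrite mulr0 subr_le0 (le_trans _ Tw) // ler_nat.
Qed.

(** The inequality in [bounded] is affine in the bound, so it survives averaging over the outcomes,
    each of which comes with its own bound; the instruction itself lowers the steps left and the
    bound by one. [List.In] avoids a decidable equality on states. *)
Lemma bounded_exec t s (f : seq (R * state R * R)) w :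
  ~~ halted P s -> step P s = map fst f ->
  (forall x, x \in [seq y.1.1 | y <- f] -> 0 <= x) ->
  \sum_(y <- f) y.1.1 = 1 ->
  (forall y, List.In y f -> bounded t y.1.2 y.2) ->
  1 + \sum_(y <- f) y.1.1 * y.2 <= w -> bounded t.+1 s w.
Proof.
move=> /negbTE nh st p0 p1 H le.
have q0 : 0 <= \sum_(y <- f) y.1.1 * y.2.
  elim: f {st le p1} p0 H => [|y f IH] p0 H; rewrite ?big_nil // big_cons.
  have [] := H y (or_introl erefl) => y0 _.
  apply: addr_ge0; first by apply: mulr_ge0 => //; apply: p0; rewrite /= inE eqxx.
  by apply: IH => [x xf|z zf]; [apply: p0; rewrite inE xf orbT|apply: H; right].
split; first by apply: le_trans le; lra.
move=> tT; rewrite /= nh st big_map /=.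
have {}H y : List.In y f -> t%:R - y.2 <= T%:R * halt_prob P E t y.1.2.
  by move=> /H [_]; apply; exact: ltnW.
have key : \sum_(y <- f) y.1.1 * (t%:R - y.2)
   <= \sum_(y <- f) T%:R * (y.1.1 * halt_prob P E t y.1.2).
  elim: f {st le p1 q0} p0 H => [|y f IH] p0 H; rewrite ?big_nil // !big_cons.
  apply: lerD; last first.
    by apply: IH => [x xf|z zf]; [apply: p0; rewrite inE xf orbT|apply: H; right].
  rewrite [X in _ <= X]mulrCA ler_wpM2l ?p0 ?inE ?eqxx //.
  by apply: H; left.
rewrite big_distrr /=; apply: le_trans key.
under eq_bigr do rewrite mulrBr.
rewrite sumrB -big_distrl /= p1 mul1r -natr1; lra.
Qed.

Lemma bounded_exec1 t s s' w : ~~ halted P s -> step P s = [:: (1, s')] ->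
  bounded t s' (w - 1) -> bounded t.+1 s w.
Proof.
move=> nh st H; apply: (@bounded_exec _ _ [:: (1, s', w - 1)]) => //=.
- by move=> x; rewrite inE => /eqP ->.
- by rewrite big_seq1.
- by move=> y [<-|//].
- by rewrite big_seq1 /=; lra.
Qed.

Definition placed l c := exists P1 P2, P = P1 ++ compile l c ++ P2 /\ size P1 = l.

Lemma nth_placed l (b : seq instr) P1 P2 k : P = P1 ++ b ++ P2 -> size P1 = l ->
  (k < size b)%N -> (l + k < size P)%N /\ nth (Jump 0) P (l + k) = nth (Jump 0) b k.
Proof.
move=> -> <- kb; split; first by rewrite !size_cat ltn_add2l ltn_addr.
by rewrite nth_cat ltnNge leq_addr /= addKn nth_cat kb.
Qed.

(* Continuation-passing form: [K s w] is a bound that the rest of the program *)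
(* is known to satisfy.                                                       *)
Definition sem c s (K : state R -> R -> Prop) w :=
  forall l t, placed l c ->
  (forall t' s' w', (t' <= t)%N -> K s' w' -> bounded t' (goto (l + csize c) s') w') ->
  bounded t (goto l s) w.

Lemma sem_le c s K w w' : sem c s K w -> w <= w' -> sem c s K w'.
Proof. by move=> H le l t pl HK; apply: bounded_le le; apply: H. Qed.

Lemma sem_Sq c1 c2 s K w :
  sem c1 s (fun s' w' => sem c2 s' K w') w -> sem (Sq c1 c2) s K w.
Proof.
move=> H l t [P1 [P2 [eP sP]]] HK.
apply: H.
  by exists P1, (compile (l + csize c1) c2 ++ P2); rewrite eP /= -catA.
move=> t' s' w' le; apply.
  exists (P1 ++ compile l c1), P2; rewrite eP /= !catA size_cat size_compile sP.
  by [].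
move=> t2 s2 w2 le2 k2; rewrite -addnA; apply: HK => //.
exact: leq_trans le.
Qed.

Lemma sem_Blk b s (K : state R -> R -> Prop) w : all straight b ->
  K (run b s) (w - (size b)%:R) -> sem (Blk b) s K w.
Proof.
move=> sb k l t [P1 [P2 [eP sP]]] HK /=.
elim: b sb l P1 eP sP s t w k HK => [|I b IH] /= sb l P1 eP sP s t w k HK.
  by rewrite -[l]addn0; apply: HK; rewrite // -[w]subr0.
have [sI {}sb] := andP sb.
have [lP nI] : (l + 0 < size P)%N /\ nth (Jump 0) P (l + 0) = I.
  exact: (@nth_placed l (I :: b) P1 P2 0 eP sP isT).
rewrite addn0 in lP nI.
have key t' : (t' <= t)%N -> bounded t' (goto l.+1 (run1 I s)) (w - 1).
  move=> le; apply: (IH sb l.+1 (rcons P1 I)).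
  - by rewrite eP -cats1 -catA.
  - by rewrite size_rcons sP.
  - by rewrite -addrA -opprD nat1r.
  move=> t2 s2 w2 le2 k2; rewrite addSn -addnS; apply: HK => //.
  exact: leq_trans le.
case: t HK key => [|t] HK key.
  by apply: bounded0; have [] := key 0%N (leqnn _); lra.
apply: (@bounded_exec1 _ _ (goto l.+1 (run1 I s))); last exact: key.
  by rewrite /halted /= -ltnNge.
by rewrite /step /= nI exec_straight // run1_goto.
Qed.

Lemma sem_Rnd r a s (K : state R -> R -> Prop) N (f : nat -> R) :
  nreg s a = N -> (0 < N)%N ->
  (forall k, (k < N)%N -> K (set_nreg r k s) (f k)) ->
  sem (Rnd r a) s K (1 + (\sum_(k < N) f k) / N%:R).
Proof.
move=> <- a0 k l t [P1 [P2 [eP sP]]] HK.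
have [lP nI] := (nth_placed eP sP (k := 0) isT).
rewrite addn0 /= in lP nI HK.
have {}HK t' i : (t' <= t)%N -> (i < nreg s a)%N ->
    bounded t' (goto l.+1 (set_nreg r i s)) (f i).
  by move=> le ia; rewrite -[l.+1]addn1; apply: HK le _; apply: k.
have w0 : 0 <= 1 + (\sum_(k < nreg s a) f k) / (nreg s a)%:R.
  rewrite addr_ge0 // divr_ge0 // sumr_ge0 // => i _.
  by have [] := HK 0%N i isT (ltn_ord i).
case: t HK => [|t] HK; first exact: bounded0.
apply: (@bounded_exec _ _ [seq ((nreg s a)%:R^-1, goto l.+1 (set_nreg r i s), f i)
  | i <- iota 0 (nreg s a)]).
- by rewrite /halted /= -ltnNge.
- rewrite /step /= nI /=; case: (nreg s a) a0 => // m _.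
  by rewrite -map_comp.
- by move=> x; rewrite -map_comp => /mapP[i _ ->]; rewrite invr_ge0.
- rewrite big_map /= big_const_seq count_predT size_iota iter_addr_0.
  by rewrite -[X in X = _]mulr_natl mulfV // pnatr_eq0 -lt0n.
- move=> y /List.in_map_iff [i [<-]] /= ii; apply: HK => //.
  have : i \in iota 0 (nreg s a).
    elim: (iota _ _) ii => //= x v IH [->|/IH]; rewrite inE ?eqxx // => ->.
    by rewrite orbT.
  by rewrite mem_iota add0n.
- rewrite big_map /= -big_distrr /= mulrC -(big_mkord xpredT f) /index_iota subn0.
  exact: lexx.
Qed.

Lemma step_guard g l s k : nth (Jump 0) P l = guard_instr g k ->
  step P (goto l s) = [:: (1, goto (if guard_val g s then k else l.+1) s)].
Proof. by rewrite /step /= => ->; case: g. Qed.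

(** A successful guard costs one step; a failing one costs two, since the jump over the body
    follows. *)
Lemma sem_If g c s (K : state R -> R -> Prop) w :
  (if guard_val g s then sem c s K (w - 1) else K s (w - 2)) ->
  sem (If g c) s K w.
Proof.
move=> H l t [P1 [P2 [eP sP]]] HK.
have [l0 n0] := (nth_placed eP sP (k := 0) isT).
have [l1 n1] := (nth_placed eP sP (k := 1) isT).
rewrite addn0 addn1 /= in l0 n0 l1 n1 HK.
have pl : placed l.+2 c.
  exists (P1 ++ [:: guard_instr g l.+2; Jump (l.+2 + csize c)]), P2.
  by rewrite eP /= -catA size_cat sP addn2.
have key t' : (t' <= t)%N -> bounded t' (goto l s) w.
  elim: t' => [|t' IH] le.
    apply: bounded0; case: ifP H => _ H.
      have [] := H l.+2 0%N pl; last by lra.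
      move=> t2 s2 w2; rewrite leqn0 => /eqP -> /(HK 0%N).
      by rewrite -addSnnS -addSnnS; apply.
    by have [] := HK _ _ _ (leq0n _) H; lra.
  apply: (bounded_exec1 _ (step_guard _ n0)); first by rewrite /halted /= -ltnNge.
  case: ifP H => _ H.
    apply: H => // t2 s2 w2 le2 /(HK t2); rewrite -addSnnS -addSnnS; apply.
    exact: leq_trans le2 (ltnW le).
  case: t' le {IH} => [|t' le].
    by move=> _; apply: bounded0; have [] := HK _ _ _ (leq0n _) H; lra.
  apply: (bounded_exec1 (s' := goto (l.+2 + csize c) s)).
  - by rewrite /halted /= -ltnNge.
  - by rewrite /step /= n1.
  - rewrite addSnnS addSnnS; have -> : w - 1 - 1 = w - 2 by lra.
    by apply: HK H; lia.
exact: key.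
Qed.

(** A single unfolding: each use supplies its own induction, on iterations, blocks or epochs. The
    [- 1] after the body pays for the jump back. *)
Lemma sem_While g c s (K : state R -> R -> Prop) w :
  (if guard_val g s then sem c s (fun s' w' => sem (While g c) s' K (w' - 1)) (w - 1)
   else K s (w - 2)) ->
  sem (While g c) s K w.
Proof.
move=> H l t pl0 HK; have [P1 [P2 [eP sP]]] := pl0.
have [l0 n0] := (nth_placed eP sP (k := 0) isT).
have [l1 n1] := (nth_placed eP sP (k := 1) isT).
have [l2 n2] : (l + (csize c).+2 < size P)%N
    /\ nth (Jump 0) P (l + (csize c).+2) = Jump l.
  have := nth_placed eP sP (k := (csize c).+2).
  rewrite /= size_rcons size_compile ltnSn => /(_ isT) [? ->]; split=> //.
  by rewrite nth_rcons size_compile ltnn eqxx.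
rewrite addn0 addn1 /= in l0 n0 l1 n1 HK.
have pl : placed l.+2 c.
  exists (P1 ++ [:: guard_instr g l.+2; Jump (l.+2 + csize c).+1]), (Jump l :: P2).
  by rewrite eP /= -catA /= -cats1 -catA size_cat sP addn2.
have body t' : (t' <= t)%N ->
  sem c s (fun s' w' => sem (While g c) s' K (w' - 1)) (w - 1) ->
  bounded t' (goto l.+2 s) (w - 1).
  move=> le; apply=> // t2 s2 w2 le2 k2.
  (* With no step left after the body the jump back cannot run, and only nonnegativity of the bound
     is needed. *)
  have w0 : bounded 0 (goto l s2) (w2 - 1).
    by apply: k2 => // t3 s3 w3 le3; apply: HK; apply: leq_trans le3 _.
  case: t2 le2 => [|t2] le2; first by apply: bounded0; case: w0; lra.
  apply: (bounded_exec1 (s' := goto l s2)).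
  - by rewrite /halted /=; lia.
  - by rewrite /step /= addSnnS addSnnS n2.
  - apply: k2 => // t3 s3 w3 le3; apply: HK.
    by apply: leq_trans le3 _; apply: leq_trans le; apply: ltnW.
case: t HK body => [|t] HK body.
  apply: bounded0; case: ifP H => _ H; first by have [] := body 0%N isT H; lra.
  by have [] := HK _ _ _ (leq0n _) H; lra.
apply: (bounded_exec1 _ (step_guard _ n0)); first by rewrite /halted /= -ltnNge.
case: ifP H => _ H; first exact: body.
case: t HK {body} => [|t] HK.
  by apply: bounded0; have [] := HK _ _ _ (leq0n _) H; lra.
apply: (bounded_exec1 (s' := goto (l.+2 + csize c).+1 s)).
- by rewrite /halted /= -ltnNge.
- by rewrite /step /= n1.
- have -> : (l.+2 + csize c).+1 = (l + (csize c).+3)%N by rewrite -addnS !addSnnS.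
  have -> : w - 1 - 1 = w - 2 by lra.
  by apply: HK H; lia.
Qed.

Lemma bounded_rand t l s x k w1 w2 : (l < size P)%N ->
  nth (Jump 0) P l = JumpRand x k -> 0 <= rreg s x <= 1 ->
  bounded t (goto k s) w1 -> bounded t (goto l.+1 s) w2 ->
  bounded t.+1 (goto l s) (1 + rreg s x * w1 + (1 - rreg s x) * w2).
Proof.
move=> lP nI /andP[x0 x1] h1 h2.
have e : Num.min 1 (Num.max 0 (rreg s x)) = rreg s x.
  by rewrite (max_idPr x0) (min_idPr x1).
apply: (@bounded_exec _ _ [:: (rreg s x, goto k s, w1);
  (1 - rreg s x, goto l.+1 s, w2)]).
- by rewrite /halted /= -ltnNge.
- by rewrite /step /= nI /= e.
- by move=> y; rewrite !inE => /orP[] /eqP -> //=; rewrite subr_ge0.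
- by rewrite big_cons big_seq1 /=; lra.
- by move=> y /= [<-|[<-|//]].
- by rewrite big_cons big_seq1 /=; lra.
Qed.

Lemma sem_IfR x c s (K : state R -> R -> Prop) w1 w2 : 0 <= rreg s x <= 1 ->
  sem c s K w1 -> K s w2 ->
  sem (IfR x c) s K (1 + rreg s x * w1 + (1 - rreg s x) * (w2 + 1)).
Proof.
move=> x01 H1 H2 l t [P1 [P2 [eP sP]]] HK.
have [x0 x1] := andP x01.
have [l0 n0] := (nth_placed eP sP (k := 0) isT).
have [l1 n1] := (nth_placed eP sP (k := 1) isT).
rewrite addn0 addn1 /= in l0 n0 l1 n1 HK.
have pl : placed l.+2 c.
  exists (P1 ++ [:: JumpRand x l.+2; Jump (l.+2 + csize c)]), P2.
  by rewrite eP /= -catA size_cat sP addn2.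
have b1 t' : (t' <= t)%N -> bounded t' (goto l.+2 s) w1.
  move=> le; apply: H1 => // t2 s2 w2' le2 /(HK t2).
  by rewrite -addSnnS -addSnnS; apply; apply: leq_trans le.
have b2 t' : (t' <= t)%N -> bounded t' (goto l.+1 s) (w2 + 1).
  case: t' => [|t'] le.
    by apply: bounded0; have [] := HK _ _ _ (leq0n _) H2; lra.
  apply: (bounded_exec1 (s' := goto (l.+2 + csize c) s)).
  - by rewrite /halted /= -ltnNge.
  - by rewrite /step /= n1.
  - by rewrite addrK addSnnS addSnnS; apply: HK H2; apply: ltnW.
case: t HK b1 b2 => [|t] HK b1 b2.
  apply: bounded0; have [h1 _] := b1 0%N isT; have [h2 _] := b2 0%N isT.
  by rewrite !addr_ge0 // mulr_ge0 // subr_ge0.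
by apply: (bounded_rand l0 n0) => //; [apply: b1|apply: b2].
Qed.

(** No iteration count bounds this loop, but only finitely many steps are available, so the
    induction is on those. The invariant is a supermartingale condition: one step plus the average
    of leaving and continuing stays below [w]. *)
Lemma sem_LoopR x c (I K : state R -> R -> Prop) :
  (forall s w, I s w -> 0 <= w /\ exists w1 w2,
     [/\ 0 <= rreg s x <= 1, K s w1, sem c s (fun s' w' => I s' (w' - 1)) w2
      & 1 + rreg s x * w1 + (1 - rreg s x) * w2 <= w]) ->
  forall s w, I s w -> sem (LoopR x c) s K w.
Proof.
move=> H s w i l t [P1 [P2 [eP sP]]] HK.
have [l0 n0] := (nth_placed eP sP (k := 0) isT).
have [l2 n2] : (l + (csize c).+1 < size P)%N
    /\ nth (Jump 0) P (l + (csize c).+1) = Jump l.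
  have := nth_placed eP sP (k := (csize c).+1).
  rewrite /= size_rcons size_compile ltnSn => /(_ isT) [? ->]; split=> //.
  by rewrite nth_rcons size_compile ltnn eqxx.
rewrite addn0 /= in l0 n0 HK.
have pl : placed l.+1 c.
  exists (rcons P1 (JumpRand x (l.+1 + csize c).+1)), (Jump l :: P2).
  by rewrite eP /= -!cats1 /= -!catA /= size_cat sP addn1.
elim/ltn_ind: t s w i HK => -[|t] IH s w i HK.
  by apply: bounded0; case: (H _ _ i).
have [w0 [w1 [w2 [x01 k1 sc le]]]] := H _ _ i.
apply: bounded_le le; apply: (bounded_rand l0 n0) => //.
  have -> : (l.+1 + csize c).+1 = (l + (csize c).+2)%N by rewrite -addnS addSnnS.
  exact: HK k1.
apply: sc => // t2 s2 w2' le2 i2.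
case: t2 le2 => [|t2] le2.
  by apply: bounded0; case: (H _ _ i2); lra.
apply: (bounded_exec1 (s' := goto l s2)).
- by rewrite /halted /=; lia.
- by rewrite /step /= addSnnS n2.
- apply: IH => [|//|t3 s3 w3 le3]; first exact: leqW.
  by apply: HK; apply: leq_trans le3 _; apply: leqW; apply: ltnW.
Qed.

End Program.
End Semantics.

(** * Deterministic code *)

Definition For r e c := While (GN r e) (Sq c (Blk [:: NAdd r r 9])).

Section Deterministic.
Variable R : realType.
Implicit Types (s : state R) (Q : state R -> Prop).

(** Quantifying over program, event and continuation lets code without draws be verified once, with
    a worst-case cost, and then be inserted anywhere in an expected-cost argument. *)
Definition det c s Q (k : R) := forall P E T (K : state R -> R -> Prop) w,
  (forall s', Q s' -> K s' w) -> sem P E T c s K (w + k).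

Lemma det_mono c s Q Q' k k' : det c s Q k -> (forall s', Q s' -> Q' s') ->
  k <= k' -> det c s Q' k'.
Proof.
move=> H QQ le P E T K w HK.
apply: (@sem_le _ _ _ _ _ _ _ (w + k)); last by rewrite lerD2l.
by apply: H => s' /QQ; apply: HK.
Qed.

Lemma det_Sq c1 c2 s Q1 Q k1 k2 k : det c1 s Q1 k1 ->
  (forall s1, Q1 s1 -> det c2 s1 Q k2) -> k1 + k2 <= k -> det (Sq c1 c2) s Q k.
Proof.
move=> H1 H2 le P E T K w HK.
apply: (@sem_le _ _ _ _ _ _ _ (w + k2 + k1)); last by lra.
by apply: sem_Sq; apply: H1 => s1 /H2; apply.
Qed.

Lemma det_Blk b s Q k : all straight b -> Q (run b s) -> (size b)%:R <= k ->
  det (Blk b) s Q k.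
Proof.
move=> sb q le P E T K w HK.
apply: (@sem_le _ _ _ _ _ _ _ (w + (size b)%:R)); last by rewrite lerD2l.
by apply: sem_Blk => //; rewrite addrK; apply: HK.
Qed.

Lemma det_BlkSq b c s Q k : all straight b ->
  det c (run b s) Q (k - (size b)%:R) -> det (Sq (Blk b) c) s Q k.
Proof.
move=> sb H; apply: (@det_Sq _ _ _ (fun s' => s' = run b s) _ (size b)%:R) => //.
- by apply: det_Blk.
- by move=> s1 ->; apply: H.
- by lra.
Qed.

Lemma det_If g c s Q k : (if guard_val g s then det c s Q k else Q s) ->
  1 <= k -> det (If g c) s Q (k + 1).
Proof.
move=> H k1 P E T K w HK; case: (boolP (guard_val g s)) H => gs H.
  by apply: sem_If; rewrite gs addrA addrK; apply: H.
apply: (@sem_le _ _ _ _ _ _ _ (w + 2)); last by lra.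
by apply: sem_If; rewrite (negbTE gs) addrK; apply: HK.
Qed.

Lemma det_While g c (Inv : nat -> state R -> Prop) m (k : nat -> R) s :
  (forall j s', (j <= m)%N -> Inv j s' -> guard_val g s' = (j < m)%N) ->
  (forall j s', (j < m)%N -> Inv j s' -> det c s' (Inv j.+1) (k j)) ->
  Inv 0%N s ->
  det (While g c) s (Inv m) (\sum_(0 <= j < m) (k j + 2) + 2).
Proof.
move=> Hg Hc i0 P E T K w HK.
suff H j s' : (j <= m)%N -> Inv j s' ->
    sem P E T (While g c) s' K (w + (\sum_(j <= i < m) (k i + 2) + 2)).
  exact: H.
move: {2}(m - j)%N (erefl (m - j)%N) => a.
elim: a j s' => [|a IH] j s' e le i; apply: sem_While; rewrite (Hg j) //.
  have ej : j = m by apply/eqP; rewrite eqn_leq le -subn_eq0 e.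
  by rewrite ej ltnn big_geq // add0r addrK; apply: HK; rewrite -ej.
have lt : (j < m)%N by rewrite -subn_gt0 e.
rewrite lt big_ltn //.
set S := \sum_(_ <= _ < _) _.
have -> : w + (k j + 2 + S + 2) - 1 = (w + (S + 2) + 1) + k j by lra.
apply: (Hc _ _ lt i) => s2 i2; rewrite addrK; apply: IH => //.
by rewrite subnS e.
Qed.

Lemma det_For r e c (Inv : nat -> state R -> Prop) lo hi (k : nat -> R) s :
  (lo <= hi)%N ->
  (forall j s', (lo <= j <= hi)%N -> Inv j s' -> nreg s' r = j /\ nreg s' e = hi) ->
  (forall j s', (lo <= j < hi)%N -> Inv j s' ->
     det c s' (fun s2 => Inv j.+1 (run [:: NAdd r r 9] s2)) (k j)) ->
  Inv lo s ->
  det (For r e c) s (Inv hi) (\sum_(lo <= j < hi) (k j + 3) + 2).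
Proof.
move=> le Hr Hc i0.
have -> : \sum_(lo <= j < hi) (k j + 3) = \sum_(0 <= j < hi - lo) (k (lo + j)%N + 1 + 2).
  rewrite -{1}[lo]add0n big_addn; apply: eq_bigr => j _.
  by rewrite addnC -addrA; congr (_ + _); lra.
apply: (@det_mono _ _ (Inv (lo + (hi - lo))%N)); last exact: lexx.
2: by rewrite subnKC.
apply: (@det_While _ _ (fun j => Inv (lo + j)%N) _ (fun j => k (lo + j)%N + 1)) => [j s' jm i|j s' jm i|].
- have [|e1 e2] := Hr _ _ _ i; [lia|rewrite /= e1 e2].
  by lia.
- rewrite addnS; apply: det_Sq; last exact: lexx.
    by apply: Hc i; lia.
  by move=> s1 h1; apply: det_Blk.
- by rewrite addn0.
Qed.

(** Control instructions get tag 4, which names no part of the state that [agree] compares. *)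
Definition mods1 (I : instr) : nat * nat :=
  match I with
  | NConst r _ | NAdd r _ _ | NSub r _ _ | NLoad r _ _ | NRand r _ => (0, r)
  | RCast x _ | RAdd x _ _ | RSub x _ _ | RMul x _ _ | RDiv x _ _
  | RLoad x _ _ => (1, x)
  | NStore a _ _ => (2, a)
  | RStore a _ _ => (3, a)
  | _ => (4, 0)
  end%N.

(* [s'] agrees with [s] except possibly on the natural registers (tag 0),     *)
(* real registers (1), natural arrays (2) and real arrays (3) listed in [L].  *)
Definition agree (L : seq (nat * nat)) s s' :=
  [/\ forall r, (0%N, r) \notin L -> nreg s' r = nreg s r,
      forall r, (1%N, r) \notin L -> rreg s' r = rreg s r,
      forall r, (2%N, r) \notin L -> narr s' r = narr s r &
      forall r, (3%N, r) \notin L -> rarr s' r = rarr s r].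

Lemma agree_trans L s1 s2 s3 : agree L s1 s2 -> agree L s2 s3 -> agree L s1 s3.
Proof.
move=> [a1 b1 c1 d1] [a2 b2 c2 d2]; split=> r h.
- by rewrite a2 ?a1.
- by rewrite b2 ?b1.
- by rewrite c2 ?c1.
- by rewrite d2 ?d1.
Qed.

Lemma agree_sub L L' s1 s2 : all (fun x => x \in L') L ->
  agree L s1 s2 -> agree L' s1 s2.
Proof.
move=> /allP LL [a b c d].
by split=> r h; [apply: a|apply: b|apply: c|apply: d];
  apply: contra h => /LL.
Qed.

Lemma upd_other T (f : nat -> T) i v j : j != i -> upd f i v j = f j.
Proof. by rewrite /upd => /negbTE ->. Qed.

Lemma agree_set_nreg L r v s s' : (0%N, r) \in L ->
  agree L s s' -> agree L s (set_nreg r v s').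
Proof.
move=> rL [a b c d]; split=> // q h /=; rewrite upd_other ?a //.
by apply: contra h => /eqP ->.
Qed.

Lemma agree_run L b s s' : all (fun I => mods1 I \in L) b ->
  agree L s s' -> agree L s (run b s').
Proof.
elim: b s' => //= I b IH s' /andP[h1 h2] ag; apply: IH => //.
case: ag => a1 b1 c1 d1.
by case: I h1 => /=; intros; split=> //= q hq;
  (rewrite upd_other; [by rewrite ?a1 ?b1 ?c1 ?d1|];
   apply: contra hq => /eqP ->).
Qed.

Arguments upd {T} f i v j /.

Definition agreeN L s s' r (h : agree L s s') (hr : (0%N, r) \notin L) :
  nreg s' r = nreg s r := let: And4 a _ _ _ := h in a r hr.
Definition agreeR L s s' r (h : agree L s s') (hr : (1%N, r) \notin L) :
  rreg s' r = rreg s r := let: And4 _ a _ _ := h in a r hr.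
Definition agreeNA L s s' r (h : agree L s s') (hr : (2%N, r) \notin L) :
  narr s' r = narr s r := let: And4 _ _ a _ := h in a r hr.
Definition agreeRA L s s' r (h : agree L s s') (hr : (3%N, r) \notin L) :
  rarr s' r = rarr s r := let: And4 _ _ _ a := h in a r hr.

Definition ceiln (x : R) : nat := `|Num.ceil x|%N.

(** A loop counting up from 0 with the strict test [m < x] therefore turns exactly [ceiln x] times,
    which rounds [x] up without any conversion from reals to naturals. *)
Lemma ceilnP x m : 0 < x -> (m%:R < x) = (m < ceiln x)%N.
Proof.
move=> x0.
have c0 : (0 <= Num.ceil x)%R by rewrite ceil_ge0; apply: lt_trans x0; rewrite ltrN10.
have -> : m%:R = (m%:Z)%:~R :> R by [].
by rewrite ltNge -ceil_le_int -ltNge /ceiln; case: (Num.ceil x) c0.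
Qed.

Lemma ceiln_ge x : 0 < x -> x <= (ceiln x)%:R.
Proof. by move=> x0; rewrite leNgt ceilnP // ltnn. Qed.

Lemma ceiln_lt x : 0 < x -> (ceiln x)%:R < x + 1.
Proof.
move=> x0; have : (0 < ceiln x)%N by rewrite -ceilnP.
case e : (ceiln x) => [//|m] _.
have : m%:R < x by rewrite ceilnP // e.
by rewrite -natr1; lra.
Qed.

Lemma ceiln_gt0 x : 0 < x -> (0 < ceiln x)%N.
Proof. by move=> x0; rewrite -ceilnP. Qed.

(* Writes [ceiln x] copies of natural register [v] to array [a] from position *)
(* [p] on, where [x] is real register 10.                                     *)
Definition tickets a p v :=
  Sq (Blk [:: NConst 8 0; RCast 11 8])
     (While (GR 11 10) (Blk [:: NStore a p v; NAdd p p 9; NAdd 8 8 9; RCast 11 8])).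

Lemma det_tickets a p v s : (p != 8)%N -> (v != 8)%N -> (p != 9)%N -> (p != v)%N ->
  nreg s 9 = 1%N -> 0 < rreg s 10 ->
  det (tickets a p v) s (fun s' =>
    [/\ agree [:: (0, 8); (1, 11); (0, p); (2, a)]%N s s',
        nreg s' p = (nreg s p + ceiln (rreg s 10))%N,
        rreg s' 11 = (ceiln (rreg s 10))%:R &
        forall t, narr s' a t =
          if (nreg s p <= t < nreg s p + ceiln (rreg s 10))%N then nreg s v
          else narr s a t])
    (6 * (ceiln (rreg s 10))%:R + 4).
Proof.
move=> p8 v8 p9 pv h9 x0.
set x := rreg s 10; set L := [:: _; _; _; _].
apply: det_BlkSq => //=.
pose Inv m s' := [/\ agree L s s', nreg s' 8 = m, rreg s' 11 = m%:R,
   nreg s' p = (nreg s p + m)%N & forall t, narr s' a t =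
          if (nreg s p <= t < nreg s p + m)%N then nreg s v
          else narr s a t].
apply: (det_mono (@det_While _ _ Inv (ceiln x) (fun=> 4) _ _ _ _)).
- move=> j s' _ [ag _ e11 _ _] /=; rewrite e11.
  by rewrite (agreeR (r := 10) ag isT) ceilnP.
- move=> j s' jm [ag e8 e11 ep et].
  have L9 : (0%N, 9%N) \notin L by rewrite /L !inE !xpair_eqE /= orbF eq_sym.
  have Lv : (0%N, v) \notin L by rewrite /L !inE !xpair_eqE /= orbF (negbTE v8) eq_sym.
  have n9 : nreg s' 9 = 1%N by rewrite (agreeN ag L9).
  have nv : nreg s' v = nreg s v by rewrite (agreeN ag Lv).
  apply: det_Blk => //=.
  split=> /=.
  + by apply: (@agree_run L [:: NStore a p v; NAdd p p 9; NAdd 8 8 9; RCast 11 8])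
      => //=; rewrite /L !inE !eqxx ?orbT.
  + by rewrite [8%N == p]eq_sym (negbTE p8) [9%N == p]eq_sym (negbTE p9) e8 n9 addn1.
  + by rewrite [8%N == p]eq_sym (negbTE p8) [9%N == p]eq_sym (negbTE p9) e8 n9 addn1.
  + by rewrite (negbTE p8) eqxx ep n9 addn1 addnS.
  + move=> t; rewrite eqxx ep nv; rewrite /=; case: (t =P _) => [->|ne].
      by case: ifP => //; lia.
    by rewrite et; do 2 case: ifP; rewrite //; lia.
- split=> //=; last by move=> t; case: ifP => //; lia.
  + by apply: (@agree_run L [:: NConst 8 0; RCast 11 8]).
  + by rewrite (negbTE p8) addn0.
- by move=> s' [ag _ e11 ep et]; split.
- rewrite big_const_nat subn0 iter_addr_0 -mulr_natr; lra.
Qed.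

End Deterministic.

Arguments upd {T} f i v j /.

(** * Linear algebra and the sparse row format *)

Section Spectral.
Variable R : realType.
Import sesquilinear spectral complex.
Local Open Scope sesquilinear_scope.

(** [M] is complexified and diagonalised by a unitary matrix; the eigenvalues are real because it is
    hermitian, and in the eigenbasis both sides are sums of squared moduli that compare term by
    term. *)
Lemma sym_eigenvalue_bound d (M : 'M[R]_d) (mu : R) (x : 'cV[R]_d) :
  M^T = M -> (forall nu, eigenvalue M nu -> mu <= nu) ->
  mu * (x^T *m x) 0 0 <= (x^T *m M *m x) 0 0.
Proof.
move=> symM min_mu.
pose toC := real_complex R.
have toC_real a : toC a \is Num.real.
  by rewrite realE -(rmorph0 toC) !lecR -realE num_real.
pose MC := map_mx toC M; have eMC : map_mx toC M = MC by [].
have realMC : MC \is a realmx by apply/mxOverP => i j; rewrite mxE.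
have hermMC : MC \is hermsymmx.
  apply: realsym_hermsym => //.
  apply/is_hermitianmxP; rewrite expr0 scale1r; apply/matrixP=> i j.
  by rewrite !mxE -{1}symM mxE.
have /hermitian_normalmx /orthomx_spectralP eqM := hermMC.
have realD := hermitian_spectral_diag_real hermMC.
set U := spectralmx MC in eqM; set D := spectral_diag MC in eqM realD.
have Uu : U \is unitarymx := spectral_unitarymx MC.
have Uunit : U \in unitmx := spectral_unit MC.
clearbody U D MC.
(* A diagonal entry is a complex eigenvalue, with row [j] of [U] as left eigenvector; being real, it
   is a root of the characteristic polynomial of [M] itself. *)
have minD j : toC mu <= D 0 j.
  have /mxOverP/(_ 0 j) rD := realD.
  rewrite -(RRe_real rD) lecR; apply: min_mu.
  rewrite eigenvalue_root_char -(fmorph_root toC) map_char_poly.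
  rewrite -eigenvalue_root_char eMC /=.
  rewrite [X in eigenvalue _ X](_ : _ = D 0 j); last exact: RRe_real.
  apply/eigenvalueP; exists (row j U).
    rewrite {1}eqM !mulmxA -row_mul mulmxV // row1 -rowE row_diag_mx.
    by rewrite -scalemxAl rowE.
  apply/eqP => r0; have := mulmxV Uunit => /(congr1 (row j)).
  rewrite row_mul r0 mul0mx => /rowP/(_ j); rewrite !mxE eqxx => /eqP.
  by rewrite eq_sym oner_eq0.
pose xC := map_mx toC x; have exC : map_mx toC x = xC by [].
have xCT : xC^T = xC ^t*.
  by apply/matrixP=> i j; rewrite !mxE conj_Creal.
clearbody xC.
pose y := U *m xC; have yT : y ^t* = xC ^t* *m U ^t* by rewrite trmx_mul map_mxM.
have UU : U ^t* *m U = 1%:M by rewrite -invmx_unitary // mulVmx.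
have e1 : toC ((x^T *m M *m x) 0 0) = (y ^t* *m diag_mx D *m y) 0 0.
  have -> : toC ((x^T *m M *m x) 0 0) = (map_mx toC (x^T *m M *m x)) 0 0 by rewrite [RHS]mxE.
  rewrite map_mxM map_mxM -map_trmx eMC exC xCT eqM invmx_unitary // yT /y.
  by rewrite !mulmxA.
have e2 : toC ((x^T *m x) 0 0) = (y ^t* *m y) 0 0.
  have -> : toC ((x^T *m x) 0 0) = (map_mx toC (x^T *m x)) 0 0 by rewrite [RHS]mxE.
  rewrite map_mxM -map_trmx exC xCT yT /y.
  by rewrite -[in RHS]mulmxA (mulmxA (U ^t* )) UU mul1mx.
rewrite -lecR rmorphM /= -/toC e1 e2 mul_mx_diag !mxE mulr_sumr.
apply: ler_sum => j _; rewrite !mxE mulrC mulrAC.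
rewrite mulrAC [X in _ <= X]mulrAC; apply: ler_wpM2l => //.
by rewrite mulrC mul_conjC_ge0.
Qed.

End Spectral.

Lemma nth_flatten_take (T : Type) (x0 : T) (ss : seq (seq T)) i k :
  (k < size (nth [::] ss i))%N ->
  nth x0 (flatten ss) (sumn (shape (take i ss)) + k) = nth x0 (nth [::] ss i) k.
Proof.
elim: ss i => [|s ss IH] [|i] //= h; first by rewrite add0n nth_cat h.
by rewrite nth_cat -addnA ltnNge leq_addr /= addKn IH.
Qed.

(** * Sums over compressed rows *)

Section Csr.
Variable R : realType.
Variables (n d : nat) (A : 'M[R]_(n, d)).

Definition cval k : R := nth 0 (csr_val A) k.
Definition ccol k : nat := nth 0%N (csr_col A) k.
Definition ptr := csr_ptr A.

Lemma csr_ptr0 : ptr 0 = 0%N.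
Proof. by rewrite /ptr /csr_ptr big_pred0. Qed.

Lemma csr_ptrS (i : 'I_n) : ptr i.+1 = (ptr i + size (row_nz A i))%N.
Proof.
rewrite /ptr /csr_ptr (bigD1 i) /= ?ltnSn // addnC; congr (_ + _)%N.
by apply: eq_bigl => j; rewrite ltnS ltn_neqAle andbC.
Qed.

Lemma csr_ptr_le i : (i < n)%N -> (ptr i <= ptr i.+1)%N.
Proof. by move=> h; rewrite (csr_ptrS (Ordinal h)) leq_addr. Qed.

Lemma csr_ptr_take (T : Type) (f : 'I_n -> seq T) :
  (forall i, size (f i) = size (row_nz A i)) -> forall k, (k <= n)%N ->
  sumn (shape (take k [seq f i | i <- enum 'I_n])) = ptr k.
Proof.
move=> hf; elim=> [|k IH] h; first by rewrite take0 csr_ptr0.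
rewrite (take_nth (f (Ordinal h))); last by rewrite size_map size_enum_ord.
rewrite /shape map_rcons sumn_rcons -/(shape _) IH ?(ltnW h) //.
rewrite (nth_map (Ordinal h)) ?size_enum_ord // hf.
by rewrite (csr_ptrS (Ordinal h)) /= (nth_ord_enum _ (Ordinal h)).
Qed.

Lemma nth_csr (T : Type) (x0 : T) (f : 'I_n -> 'I_d -> T) (i : 'I_n) j0 k :
  (k < size (row_nz A i))%N ->
  nth x0 (flatten [seq [seq f i j | j <- row_nz A i] | i <- enum 'I_n]) (ptr i + k)
  = f i (nth j0 (row_nz A i) k).
Proof.
move=> h.
have hn : nth [::] [seq [seq f i j | j <- row_nz A i] | i <- enum 'I_n] i
    = [seq f i j | j <- row_nz A i].
  by rewrite (nth_map i) ?size_enum_ord ?ltn_ord // nth_ord_enum.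
rewrite -(csr_ptr_take (f := fun i => [seq f i j | j <- row_nz A i])); last first.
- exact/ltnW/ltn_ord.
- by move=> ?; rewrite size_map.
by rewrite nth_flatten_take hn ?size_map // (nth_map j0).
Qed.

(** The positions that are not stored hold zero entries, on which [f] vanishes. As [f] sees column
    and value together, indicators of a column and coordinates of a vector can be built into it. *)
Lemma csr_sum (V : nmodType) (f : nat -> R -> V) (i : 'I_n) :
  (forall j, f j 0 = 0) ->
  \sum_(ptr i <= k < ptr i.+1) f (ccol k) (cval k) = \sum_(j < d) f j (A i j).
Proof.
move=> f0; rewrite csr_ptrS -{1}[ptr i]add0n big_addn addKn.
have -> : \sum_(j < d) f j (A i j) = \sum_(j <- row_nz A i) f j (A i j).
  rewrite big_filter [RHS]big_mkcond /= big_enum /=; apply: eq_bigr => j _.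
  by case: eqP => // ->.
case e : (row_nz A i) => [|j0 r]; first by rewrite /= big_geq // big_nil.
rewrite -e [RHS](big_nth j0); rewrite !big_nat; apply: eq_bigr => k /andP[_ h].
rewrite addnC /ccol /cval /csr_col /csr_val (nth_csr _ (fun i j => val j) j0) //.
by rewrite (nth_csr _ (fun i j => A i j) j0).
Qed.

Lemma csr_entry (i : 'I_n) k : (ptr i <= k < ptr i.+1)%N ->
  exists2 j : 'I_d, ccol k = j & cval k = A i j /\ A i j != 0.
Proof.
rewrite csr_ptrS => /andP[h1 h2].
have h : (k - ptr i < size (row_nz A i))%N by rewrite ltn_subLR.
case e : (row_nz A i) (h) => [//|j0 r] _.
exists (nth j0 (row_nz A i) (k - ptr i)).
  by rewrite /ccol /csr_col -{1}(subnKC h1) (nth_csr _ (fun i j => val j) j0).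
rewrite /cval /csr_val -{1}(subnKC h1) (nth_csr _ (fun i j => A i j) j0) //.
by split=> //; have := mem_nth j0 h; rewrite mem_filter => /andP[].
Qed.

Lemma csr_ptr_mono : {in [pred k | (k <= n)%N] &, {homo ptr : i j / (i <= j)%N}}.
Proof.
move=> i j _ /= hj ij; rewrite -(subnKC ij); rewrite -(subnKC ij) inE in hj.
elim: (j - i)%N hj => [|m IH]; rewrite ?addn0 ?leqnn // addnS => h.
by apply: leq_trans (csr_ptr_le h); apply: IH; apply: ltnW.
Qed.

Lemma row_size_le (i : 'I_n) : (ptr i.+1 - ptr i <= d)%N.
Proof.
rewrite csr_ptrS addKn size_filter; apply: leq_trans (count_size _ _) _.
by rewrite size_enum_ord.
Qed.

Lemma nnz_ptr : nnz A = ptr n.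
Proof.
rewrite /nnz /ptr /csr_ptr -sum1_card.
under eq_bigl do rewrite inE.
rewrite -(pair_big_dep xpredT (fun i j => A i j != 0) (fun _ _ => 1%N)) /=.
under [RHS]eq_bigl => i do rewrite ltn_ord.
apply: eq_bigr => i _; rewrite sum1_card cardE /row_nz enumT.
by congr size; apply: eq_filter.
Qed.

Lemma csr_ptr_sum (V : nmodType) (f : nat -> V) m : (m <= n)%N ->
  \sum_(0 <= k < ptr m) f k = \sum_(0 <= i < m) \sum_(ptr i <= k < ptr i.+1) f k.
Proof.
elim: m => [|m IH] h; first by rewrite csr_ptr0 !big_geq.
rewrite big_nat_recr //= -IH ?(ltnW h) //.
by rewrite [LHS](big_cat_nat (n := ptr m)) // csr_ptr_le.
Qed.

Lemma rows_gt0 (i : 'I_n) : row i A != 0 -> (ptr i < ptr i.+1)%N.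
Proof.
rewrite csr_ptrS -[X in (X < _)%N]addn0 ltn_add2l => h.
rewrite lt0n size_eq0; apply: contra h => /eqP e; apply/eqP/rowP => j.
rewrite !mxE; apply/eqP/negPn/negP => hj.
have : j \in row_nz A i by rewrite mem_filter hj mem_enum.
by rewrite e.
Qed.

End Csr.

(** * The Gram matrix and least squares *)

Section LinearAlgebra.
Variable R : realType.

(** Lagrange's identity: the double sum of [(a i * b j - a j * b i) ^+ 2] is twice the gap. *)
Lemma Cauchy_Schwarz (I : finType) (a b : I -> R) :
  (\sum_i a i * b i) ^+ 2 <= (\sum_i a i ^+ 2) * (\sum_i b i ^+ 2).
Proof.
have : 0 <= \sum_i \sum_j (a i * b j - a j * b i) ^+ 2.
  by do 2 (apply: sumr_ge0 => ? _); apply: sqr_ge0.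
have -> : \sum_i \sum_j (a i * b j - a j * b i) ^+ 2 =
    \sum_i \sum_j (a i ^+ 2 * b j ^+ 2 + a j ^+ 2 * b i ^+ 2)
    - 2 * \sum_i \sum_j (a i * b i) * (a j * b j).
  rewrite mulr_sumr -sumrB; apply: eq_bigr => i _.
  rewrite mulr_sumr -sumrB; apply: eq_bigr => j _; ring.
have -> : \sum_i \sum_j (a i ^+ 2 * b j ^+ 2 + a j ^+ 2 * b i ^+ 2)
   = 2 * ((\sum_i a i ^+ 2) * (\sum_i b i ^+ 2)).
  rewrite mulr_suml mulr2n mulrDl mul1r.
  under eq_bigr do rewrite big_split /=.
  rewrite big_split /=; congr (_ + _); first by apply: eq_bigr => i _; rewrite mulr_sumr.
  by rewrite exchange_big; apply: eq_bigr => i _; rewrite mulr_sumr.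
have -> : \sum_i \sum_j (a i * b i) * (a j * b j) = (\sum_i a i * b i) ^+ 2.
  by rewrite expr2 mulr_suml; apply: eq_bigr => i _; rewrite mulr_sumr.
lra.
Qed.

Definition nsq m (x : 'cV[R]_m) : R := \sum_i x i 0 ^+ 2.

Lemma nsqE m (x : 'cV[R]_m) : nsq x = (x^T *m x) 0 0.
Proof. by rewrite mxE; apply: eq_bigr => i _; rewrite !mxE expr2. Qed.

Lemma nsq_ge0 m (x : 'cV[R]_m) : 0 <= nsq x.
Proof. by apply: sumr_ge0 => i _; apply: sqr_ge0. Qed.

Lemma nsqD_le m (x y : 'cV[R]_m) : nsq (x - y) <= 2 * nsq x + 2 * nsq y.
Proof.
rewrite /nsq !mulr_sumr -big_split; apply: ler_sum => i _; rewrite !mxE /=.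
have := sqr_ge0 (x i 0 + y i 0); nra.
Qed.

Definition frob m n (A : 'M[R]_(m, n)) : R := \sum_i \sum_j A i j ^+ 2.

Lemma frob_ge0 m n (A : 'M[R]_(m, n)) : 0 <= frob A.
Proof. by do 2 (apply: sumr_ge0 => ? _); apply: sqr_ge0. Qed.

Lemma l2norm_sq m n (A : 'M[R]_(m, n)) : l2norm A ^+ 2 = frob A.
Proof. by rewrite /l2norm sqr_sqrtr // frob_ge0. Qed.

Variables (n d : nat) (A : 'M[R]_(n, d)).

(** Cauchy-Schwarz in each column; the Frobenius norm stands in for the operator norm when gradients
    are bounded. *)
Lemma nsq_tr_mul (y : 'cV[R]_n) : nsq (A^T *m y) <= frob A * nsq y.
Proof.
rewrite /nsq /frob exchange_big mulr_suml; apply: ler_sum => j _.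
have -> : (A^T *m y) j 0 = \sum_i A i j * y i 0.
  by rewrite mxE; apply: eq_bigr => i _; rewrite mxE.
exact: Cauchy_Schwarz.
Qed.

Variables (mu : R) (b : 'cV[R]_n).
Hypothesis mu_min : is_smallest_eigenvalue (A^T *m A) mu.
Hypothesis mu_gt0 : 0 < mu.

Lemma gram_bound (x : 'cV[R]_d) : mu * nsq x <= nsq (A *m x).
Proof.
rewrite !nsqE trmx_mul mulmxA -[_ *m A^T *m A]mulmxA.
by apply: sym_eigenvalue_bound mu_min.2; rewrite trmx_mul trmxK.
Qed.

Lemma dim_gt0 : (0 < d)%N.
Proof.
case: mu_min => /eigenvalueP[v _ v0] _; move: v v0; case: (d) => // v.
by rewrite thinmx0 eqxx.
Qed.

(** By [gram_bound] at the basis vectors every column of [A] has squared norm at least [mu]. This is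
    the source of [d <= kappa]. *)
Lemma dim_le_frob : d%:R * mu <= frob A.
Proof.
have -> : d%:R * mu = \sum_(j < d) mu by rewrite sumr_const card_ord mulr_natl.
rewrite /frob exchange_big; apply: ler_sum => j _.
have := gram_bound (\col_k (k == j)%:R).
have -> : nsq (\col_k (k == j)%:R) = 1.
  rewrite /nsq (bigD1 j) //= big1 ?mxE ?eqxx ?expr1n ?addr0 //.
  by move=> k /negbTE h; rewrite !mxE h expr0n.
rewrite mulr1; congr (_ <= _); apply: eq_bigr => i _; rewrite mxE (bigD1 j) //=.
rewrite big1 ?mxE ?eqxx ?mulr1 ?addr0 //.
by move=> k /negbTE h; rewrite !mxE h mulr0.
Qed.

Lemma gram_unit : A^T *m A \in unitmx.
Proof.
apply/negPn/negP => h.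
suff : eigenvalue (A^T *m A) 0 by move=> /mu_min.2; rewrite leNgt mu_gt0.
rewrite /eigenvalue /eigenspace raddf0 subr0 kermx_eq0.
by rewrite row_free_unit.
Qed.

Definition opt : 'cV[R]_d := invmx (A^T *m A) *m (A^T *m b).

Lemma opt_normal : A^T *m (A *m opt) = A^T *m b.
Proof. by rewrite mulmxA /opt mulKVmx // gram_unit. Qed.

Lemma frob_nsq (x : 'cV[R]_n) : frob x = nsq x.
Proof. by apply: eq_bigr => i _; rewrite big_ord1. Qed.

(** Pythagoras: by the normal equations the residual at [opt] is orthogonal to the range of [A]. *)
Lemma opt_solution : regression_solution A b opt.
Proof.
move=> x; rewrite !l2norm_sq !frob_nsq.
have e : A *m x - b = (A *m opt - b) + A *m (x - opt).
  by rewrite mulmxBr [RHS]addrC addrA subrK.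
have o : \sum_i (A *m opt - b) i 0 * (A *m (x - opt)) i 0 = 0.
  have -> : \sum_i (A *m opt - b) i 0 * (A *m (x - opt)) i 0
     = ((A *m (x - opt))^T *m (A *m opt - b)) 0 0.
    by rewrite mxE; apply: eq_bigr => i _; rewrite mulrC [in RHS]mxE.
  by rewrite trmx_mul -mulmxA mulmxBr opt_normal subrr mulmx0 mxE.
have -> : nsq (A *m x - b) = nsq (A *m opt - b) + nsq (A *m (x - opt)).
  rewrite -[RHS]addr0 -(mulr0 2) -o mulr_sumr /nsq -!big_split; apply: eq_bigr => i _.
  rewrite e [in LHS]mxE /=; ring.
by rewrite lerDl nsq_ge0.
Qed.

Lemma mnorm_gram (x : 'cV[R]_d) : mnorm (A^T *m A) x = Num.sqrt (nsq (A *m x)).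
Proof. by rewrite /mnorm nsqE trmx_mul !mulmxA. Qed.

End LinearAlgebra.

(** * Stratified sampling *)

Lemma count_near_start (B a e : nat) : (\sum_(a <= t < e) (t < a + B) <= B)%N.
Proof.
rewrite -{1}[a]add0n big_addn.
elim: (e - a)%N {-2}(e - a)%N (leqnn (e - a)) => [|m IH] q hq.
  by rewrite big_geq.
case: q hq => [|q] hq; first by rewrite big_geq.
have -> : (\sum_(0 <= t < q.+1) (t + a < a + B) = minn q.+1 B)%N; last by lia.
elim: (q.+1) => [|r IHr]; first by rewrite big_geq // min0n.
rewrite big_nat_recr //= IHr; lia.
Qed.

Lemma count_near_end (B a e : nat) : (\sum_(a <= t < e) (e <= t + B) <= B)%N.
Proof.
rewrite big_nat_rev /=; apply: leq_trans (count_near_start B a e).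
by rewrite big_nat [X in (_ <= X)%N]big_nat; apply: leq_sum => t; lia.
Qed.

Section Stratified.
Variable R : realType.
Variables (st tick : nat -> nat) (lo hi B : nat) (w : nat -> R).
Hypothesis lohi : (lo <= hi)%N.
Hypothesis st_le : forall k, (lo <= k < hi)%N -> (st k <= st k.+1)%N.
Hypothesis tickP : forall k t, (lo <= k < hi)%N -> (st k <= t < st k.+1)%N ->
  tick t = k.

(** Slots past the end have value 0 and fill up the last block, so that every block has [B] slots
    and is sampled uniformly. *)
Definition slot_val t : R := if (t < st hi)%N then w (tick t) else 0.
Definition blk_sum p : R := \sum_(p <= t < p + B) slot_val t.
(** The variance of [B] times the value of a uniform slot of the block, a variable of mean
    [blk_sum p]. *)
Definition blk_var p : R :=
  B%:R * (\sum_(p <= t < p + B) slot_val t ^+ 2) - blk_sum p ^+ 2.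

(** [mean_from] and [var_from] recurse over the blocks still to be drawn, as the sampling loop does;
    variances add up because the draws are independent. *)
Fixpoint mean_from m p : R :=
  if m is m'.+1 then blk_sum p + mean_from m' (p + B) else 0.
Fixpoint var_from m p : R :=
  if m is m'.+1 then blk_var p + var_from m' (p + B) else 0.

Lemma st_mono i j : (lo <= i)%N -> (i <= j)%N -> (j <= hi)%N -> (st i <= st j)%N.
Proof.
move=> li ij jh; rewrite -(subnKC ij); rewrite -(subnKC ij) in jh.
elim: (j - i)%N jh => [|m IH] h; rewrite ?addn0 // addnS.
apply: leq_trans (st_le _); [apply: IH|]; lia.
Qed.

Lemma find_run t : (st lo <= t < st hi)%N ->
  exists2 k, (lo <= k < hi)%N & (st k <= t < st k.+1)%N.
Proof.
move=> /andP[h1 h2].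
have [m mh {h2}] : exists2 m, (lo + m <= hi)%N & (t < st (lo + m))%N.
  by exists (hi - lo)%N; rewrite subnKC.
elim: m mh => [|m IH] mh h2; first by rewrite addn0 in h2; lia.
case: (ltnP t (st (lo + m))) => h3; first by apply: IH => //; lia.
by exists (lo + m)%N; rewrite -?addnS ?h3 //; lia.
Qed.

Lemma runs_sum (f : nat -> nat -> R) :
  \sum_(st lo <= t < st hi) f (tick t) t =
  \sum_(lo <= k < hi) \sum_(st k <= t < st k.+1) f k t.
Proof.
suff H m : (lo + m <= hi)%N -> \sum_(st lo <= t < st (lo + m)) f (tick t) t =
    \sum_(lo <= k < lo + m) \sum_(st k <= t < st k.+1) f k t.
  by have := H (hi - lo)%N; rewrite subnKC //; apply.
elim: m => [|m IH] h; first by rewrite addn0 !big_geq.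
rewrite addnS big_nat_recr ?leq_addr //= -IH; last by lia.
rewrite (big_cat_nat (n := st (lo + m))); last first.
- by apply: st_le; lia.
- by apply: st_mono; lia.
congr (_ + _); rewrite !big_nat; apply: eq_bigr => t ht.
by rewrite (tickP (k := lo + m)) //; lia.
Qed.

Lemma slots_total (f : nat -> R) p m : (p <= st hi <= p + m * B)%N ->
  (forall t, (st hi <= t)%N -> f t = 0) ->
  \sum_(p <= t < p + m * B) f t = \sum_(p <= t < st hi) f t.
Proof.
move=> /andP[h1 h2] f0; rewrite (big_cat_nat (n := st hi)) //=.
rewrite [X in _ + X]big_nat [X in _ + X]big1 ?addr0 // => t /andP[h _]; exact: f0.
Qed.

Lemma mean_from_sum m p : mean_from m p = \sum_(p <= t < p + m * B) slot_val t.
Proof.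
elim: m p => [|m IH] p /=; first by rewrite big_geq // addn0.
rewrite IH mulSn addnA [RHS](big_cat_nat (n := (p + B)%N)) ?leq_addr //.
Qed.

(** Unbiasedness: the blocks cover all slots once, and an entry's value occurs once per slot of its
    run. *)
Lemma mean_total m : (st hi <= st lo + m * B)%N ->
  mean_from m (st lo) = \sum_(lo <= k < hi) (st k.+1 - st k)%:R * w k.
Proof.
move=> h; rewrite mean_from_sum slots_total ?h ?st_mono //; last first.
  by move=> t; rewrite /slot_val ltnNge => ->.
rewrite (_ : \sum_(st lo <= t < st hi) slot_val t
   = \sum_(st lo <= t < st hi) w (tick t)); last first.
  by rewrite !big_nat; apply: eq_bigr => t /andP[_ h2]; rewrite /slot_val h2.
rewrite (runs_sum (fun k _ => w k)); apply: eq_bigr => k _.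
by rewrite big_const_nat iter_addr_0 mulr_natl.
Qed.

(* Slots of a run lying in blocks that meet other runs are within [B] of an   *)
(* end of the run.                                                            *)
Definition near_end k t := (t < st k + B)%N || (st k.+1 <= t + B)%N.

Definition mixed_sq t : R :=
  if (t < st hi)%N && near_end (tick t) t then w (tick t) ^+ 2 else 0.

(** If the block has a slot farther than [B] from both ends of its run, the whole block lies in that
    run and is constant, so the variance is 0. Otherwise all its slots are near an end, and the
    squared mean is dropped. *)
Lemma blk_var_le p : (st lo <= p)%N ->
  blk_var p <= B%:R * \sum_(p <= t < p + B) mixed_sq t.
Proof.
move=> hp.
case: (boolP (has (fun t => (t < st hi)%N && ~~ near_end (tick t) t)
  (index_iota p (p + B)))) => [/hasP[t]|/hasPn H].
  rewrite mem_index_iota => ht /andP[th].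
  have [|k kr kt] := find_run (t := t); first by lia.
  rewrite (tickP kr kt) negb_or -!leqNgt => /andP[h1]; rewrite -ltnNge => h2.
  have st1 : (st k.+1 <= st hi)%N by apply: st_mono; lia.
  have e q : (p <= q < p + B)%N -> slot_val q = w k.
    move=> hq; rewrite /slot_val (tickP kr); last by lia.
    by case: ifP => //; lia.
  have -> : blk_var p = 0.
    rewrite /blk_var /blk_sum.
    have -> : \sum_(p <= t < p + B) slot_val t = B%:R * w k.
      rewrite big_nat (eq_bigr (fun=> w k)) => [|q /e //].
      by rewrite -big_nat big_const_nat iter_addr_0 addKn mulr_natl.
    have -> : \sum_(p <= t < p + B) slot_val t ^+ 2 = B%:R * w k ^+ 2.
      rewrite big_nat (eq_bigr (fun=> w k ^+ 2)) => [|q /e -> //].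
      by rewrite -big_nat big_const_nat iter_addr_0 addKn mulr_natl.
    by ring.
  rewrite mulr_ge0 // sumr_ge0 // => q _; rewrite /mixed_sq.
  by case: ifP => // _; apply: sqr_ge0.
have -> : \sum_(p <= t < p + B) mixed_sq t = \sum_(p <= t < p + B) slot_val t ^+ 2.
  rewrite !big_nat; apply: eq_bigr => t ht; rewrite /mixed_sq /slot_val.
  have := H t; rewrite mem_index_iota ht => /(_ isT).
  by case: (t < st hi)%N => //=; rewrite ?expr0n // negbK => ->.
by rewrite /blk_var lerBlDr lerDl sqr_ge0.
Qed.

(** A run has at most [B] slots near each end, so its square is counted at most [2 B] times, and
    [blk_var_le] contributes another factor [B]. *)
Lemma var_total m : (st hi <= st lo + m * B)%N ->
  var_from m (st lo) <= 2 * B%:R ^+ 2 * \sum_(lo <= k < hi) w k ^+ 2.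
Proof.
move=> h.
have H q p : (st lo <= p)%N ->
    var_from q p <= B%:R * \sum_(p <= t < p + q * B) mixed_sq t.
  elim: q p => [|q IH] p hp /=; first by rewrite big_geq ?addn0 // mulr0.
  rewrite mulSn addnA [X in _ <= _ * X](big_cat_nat (n := (p + B)%N)) ?leq_addr //=.
  by rewrite mulrDr; apply: lerD; [exact: blk_var_le|apply: IH; lia].
apply: le_trans (H m _ (leqnn _)) _.
rewrite slots_total ?h ?st_mono //; last first.
  by move=> t; rewrite /mixed_sq ltnNge => ->.
rewrite (_ : \sum_(st lo <= t < st hi) mixed_sq t
   = \sum_(st lo <= t < st hi) (w (tick t) ^+ 2 * (near_end (tick t) t)%:R)); last first.
  rewrite !big_nat; apply: eq_bigr => t /andP[_ h2]; rewrite /mixed_sq h2 /=.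
  by case: near_end; rewrite ?mulr1 ?mulr0.
rewrite (runs_sum (fun k t => w k ^+ 2 * (near_end k t)%:R)).
have le k : \sum_(st k <= t < st k.+1) w k ^+ 2 * (near_end k t)%:R
    <= w k ^+ 2 * (B + B)%:R.
  rewrite -mulr_sumr ler_wpM2l ?sqr_ge0 // -natr_sum ler_nat.
  apply: leq_trans (leq_add (count_near_start B (st k) (st k.+1))
    (count_near_end B (st k) (st k.+1))).
  by rewrite -big_split /=; apply: leq_sum => t _; rewrite /near_end; lia.
apply: (@le_trans _ _ (B%:R * \sum_(lo <= k < hi) w k ^+ 2 * (B + B)%:R)).
  by rewrite ler_wpM2l //; apply: ler_sum => k _; apply: le.
by rewrite -mulr_suml natrD; set S := \sum_(_ <= _ < _) _; lra.
Qed.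

Lemma var_from1 m p : B = 1%N -> var_from m p = 0.
Proof.
move=> B1; elim: m p => //= m IH p; rewrite IH addr0 /blk_var /blk_sum B1.
by rewrite addn1 !big_nat1 mul1r subrr.
Qed.

Hypothesis B_gt0 : (0 < B)%N.

(** Quadratics in the partial sum are stable under averaging over a draw: the mean moves by
    [blk_sum] and the second moment gains [blk_var]. This is why the charges of both sampling loops
    are quadratic. *)
Lemma quad_blk (p0 p1 p2 c : R) p :
  (\sum_(k < B) (p0 + p1 * (c + B%:R * slot_val (p + k))
     + p2 * (c + B%:R * slot_val (p + k)) ^+ 2)) / B%:R =
  p0 + p1 * (c + blk_sum p) + p2 * ((c + blk_sum p) ^+ 2 + blk_var p).
Proof.
have b0 : B%:R != 0 :> R by rewrite pnatr_eq0 -lt0n.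
have shift (f : nat -> R) : \sum_(p <= t < p + B) f t = \sum_(k < B) f (p + k)%N.
  rewrite -{1}[p]add0n big_addn addKn big_mkord; apply: eq_bigr => k _.
  by rewrite addnC.
rewrite /blk_var /blk_sum !shift.
set S1 := \sum_(k < B) slot_val _; set S2 := \sum_(k < B) slot_val _ ^+ 2.
have -> : \sum_(k < B) (p0 + p1 * (c + B%:R * slot_val (p + k))
     + p2 * (c + B%:R * slot_val (p + k)) ^+ 2) =
  B%:R * (p0 + p1 * c + p2 * c ^+ 2) + (p1 * B%:R + 2 * p2 * c * B%:R) * S1
   + p2 * B%:R ^+ 2 * S2.
  have -> (y : R) : B%:R * y = \sum_(k < B) y by rewrite sumr_const card_ord mulr_natl.
  rewrite !mulr_sumr -!big_split /=.
  by apply: eq_bigr => k _; ring.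
by field.
Qed.

End Stratified.

(** * Preprocessing *)

(* Natural registers: 2 row, 3 entry, 4 end of the row, 5 and 6 next free     *)
(* entry and row slot, 7 block size [B], 9 the constant 1, 11 and 12 current  *)
(* and last slot of the row, 13 column.                                       *)
(* Real registers: 2 [F], 3 [kappa], 4 [n], 5 and 6 the row's l1 and squared  *)
(* l2 norm, 10 weight to be rounded up to slots, 13 coefficient of [g],       *)
(* 14 [eta], 15 stopping probability, 16 [beta], 17 [(eta / p_i) beta B],     *)
(* 18 [B], 19 factor by which the squared error must still shrink, 20 the     *)
(* constant 1, 21 number of row slots, 22 residual, 24 the constant 0.        *)
(* Natural arrays: 2 first slot of each row, 3 block size of each row, 4 and  *)
(* 5 owners of the entry and row slots.                                       *)
(* Real arrays: 3 [z], 4 [g], 5 [v] plus the multiple of [g], 6 entries       *)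
(* divided by their numbers of slots, 7 probability of keeping a drawn row,   *)
(* 8 unrounded row weight.                                                    *)
Definition copy_x0 := For 2 1 (Blk [:: RLoad 12 2 2; RStore 3 2 12]).

Definition frobenius :=
  Sq (Blk [:: NLoad 14 0 0; NConst 3 0])
     (For 3 14 (Blk [:: RLoad 12 0 3; RMul 12 12 12; RAdd 2 2 12])).

Definition load_abs :=
  Sq (Blk [:: RLoad 12 0 3; RAdd 10 12 24]) (If (GR 12 24) (Blk [:: RSub 10 24 12])).

Definition row_norms :=
  Sq (Blk [:: NLoad 3 0 2; NAdd 4 2 9; NLoad 4 0 4; NSub 14 4 3; RCast 7 14;
              RAdd 5 24 24; RAdd 6 24 24])
     (For 3 4 (Sq load_abs (Blk [:: RAdd 5 5 10; RMul 12 12 12; RAdd 6 6 12]))).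

(** A square root by linear search: real register 8 holds [bsq], real register 9 the square of the
    block size plus one, and the size grows while the latter is smaller. *)
Definition block_size :=
  Sq (Blk [:: RDiv 7 7 5; RMul 8 7 7; RMul 8 8 6; RDiv 8 8 3; NConst 7 1;
              NAdd 8 7 9; RCast 9 8; RMul 9 9 9])
     (While (GR 9 8) (Blk [:: NAdd 7 7 9; NAdd 8 7 9; RCast 9 8; RMul 9 9 9])).

Definition entry_slots :=
  Sq (Blk [:: NStore 3 2 7; NLoad 3 0 2])
     (For 3 4 (Sq load_abs (Sq (Blk [:: RMul 10 10 7]) (Sq (tickets 4 5 3)
        (Blk [:: RDiv 12 12 11; RStore 6 3 12]))))).

(** A row of weight [x] owns [ceiln x] slots and a draw of it is kept with probability
    [x / ceiln x], so that it is selected with probability exactly [x] over the number of slots. *)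
Definition row_slots :=
  Sq (Blk [:: NAdd 10 2 9; NStore 2 10 5; RMul 10 4 6; RDiv 10 10 2])
     (Sq (tickets 5 6 2) (Blk [:: RStore 8 2 10; RDiv 10 10 11; RStore 7 2 10])).

Definition prepare_row := Sq row_norms (Sq block_size (Sq entry_slots row_slots)).

Definition gradient_row :=
  Sq (Blk [:: NLoad 3 0 2; NAdd 4 2 9; NLoad 4 0 4; RLoad 22 1 2; RSub 22 24 22])
  (Sq (For 3 4 (Blk [:: RLoad 12 0 3; NLoad 13 1 3; RLoad 23 3 13; RMul 12 12 23;
                        RAdd 22 22 12]))
  (Sq (Blk [:: NLoad 3 0 2])
      (For 3 4 (Blk [:: RLoad 12 0 3; NLoad 13 1 3; RMul 12 12 22; RLoad 23 4 13;
                        RAdd 23 23 12; RStore 4 13 23])))).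

Definition gradient :=
  Sq (Blk [:: NConst 2 0])
  (Sq (For 2 1 (Blk [:: RStore 4 2 24; RStore 5 2 24]))
  (Sq (Blk [:: NConst 2 0]) (For 2 0 gradient_row))).

(** * Slot counts, block sizes and row weights *)

Section Data.
Variable R : realType.
Variables (n d : nat) (A : 'M[R]_(n, d)) (b : 'cV[R]_n) (mu eps : R).
Hypothesis nzrows : forall i : 'I_n, row i A != 0.
Hypothesis mu_min : is_smallest_eigenvalue (A^T *m A) mu.
Hypothesis mu_gt0 : 0 < mu.

Local Notation ptr := (ptr A).
Local Notation cval := (cval A).
Local Notation ccol := (ccol A).

Definition rlen i := (ptr i.+1 - ptr i)%N.
Definition rl1 i : R := \sum_(ptr i <= k < ptr i.+1) `|cval k|.
Definition rl2 i : R := \sum_(ptr i <= k < ptr i.+1) cval k ^+ 2.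
Definition fro : R := \sum_(0 <= k < ptr n) cval k ^+ 2.
Definition kap : R := fro / mu.
Definition thr i k : R := `|cval k| * ((rlen i)%:R / rl1 i).
Definition tau i k := ceiln (thr i k).
Definition sbase i := (\sum_(0 <= i' < i) \sum_(ptr i' <= k < ptr i'.+1) tau i' k)%N.
Definition rstart i k := (sbase i + \sum_(ptr i <= k' < k) tau i k')%N.
Definition uval i k : R := cval k / (tau i k)%:R.
Definition bsq i : R := (rlen i)%:R / rl1 i * ((rlen i)%:R / rl1 i) * rl2 i / kap.

Lemma bsize_ex i : exists m, bsq i <= (m.+2%:R) ^+ 2.
Proof.
exists (ceiln (`|bsq i| + 1)).
have h := @ceiln_ge R (`|bsq i| + 1) (ltr_wpDl (normr_ge0 _) ltr01).
have := ler_norm (bsq i); have := normr_ge0 (bsq i).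
by rewrite -!natr1; nra.
Qed.

(** The least [B >= 1] with [bsq i <= (B + 1)^2]. This inequality limits the number of blocks;
    minimality gives [B^2 < bsq i] for [B >= 2], which limits the variance. *)
Definition bsize i := (ex_minn (bsize_ex i)).+1.

Definition rwt i : R := n%:R * rl2 i / fro.
Definition rtick i := (\sum_(0 <= i' < i) ceiln (rwt i'))%N.

Lemma cval_neq0 i k : (i < n)%N -> (ptr i <= k < ptr i.+1)%N -> cval k != 0.
Proof.
by move=> h hk; have [j _ [-> ?]] := @csr_entry _ _ _ A (Ordinal h) k hk.
Qed.

Lemma ccol_lt i k : (i < n)%N -> (ptr i <= k < ptr i.+1)%N -> (ccol k < d)%N.
Proof.
by move=> h hk; have [j -> _] := @csr_entry _ _ _ A (Ordinal h) k hk.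
Qed.

Lemma rlen_gt0 i : (i < n)%N -> (0 < rlen i)%N.
Proof. by move=> h; rewrite subn_gt0 (@rows_gt0 _ _ _ A (Ordinal h)). Qed.

Lemma rl2_gt0 i : (i < n)%N -> 0 < rl2 i.
Proof.
move=> h; have := rlen_gt0 h; rewrite subn_gt0 /rl2 => h2.
rewrite big_ltn //; apply: ltr_pwDl.
  by rewrite exprn_even_gt0 //= (cval_neq0 h) // leqnn.
by apply: sumr_ge0 => k _; apply: sqr_ge0.
Qed.

Lemma rl1_gt0 i : (i < n)%N -> 0 < rl1 i.
Proof.
move=> h; have := rlen_gt0 h; rewrite subn_gt0 /rl1 => h2.
rewrite big_ltn //; apply: ltr_pwDl.
  by rewrite normr_gt0 (cval_neq0 h) // leqnn.
by apply: sumr_ge0 => k _.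
Qed.

Lemma fro_rows : fro = \sum_(0 <= i < n) rl2 i.
Proof. by rewrite /fro csr_ptr_sum. Qed.

Lemma rl2_row (i : 'I_n) : rl2 i = \sum_j A i j ^+ 2.
Proof. by rewrite -(@csr_sum R n d A R (fun _ a => a ^+ 2) i) // => _; rewrite expr0n. Qed.

Lemma rl1_row (i : 'I_n) : rl1 i = \sum_j `|A i j|.
Proof. by rewrite -(@csr_sum R n d A R (fun _ a => `|a|) i) // => _; rewrite normr0. Qed.

Lemma fro_frob : fro = frob A.
Proof.
by rewrite fro_rows big_mkord /frob; apply: eq_bigr => i _; rewrite rl2_row.
Qed.

Lemma fro_gt0 : 0 < fro.
Proof.
rewrite fro_frob; apply: lt_le_trans (dim_le_frob mu_min).
by rewrite mulr_gt0 // ltr0n (dim_gt0 mu_min).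
Qed.

Lemma kap_ge : d%:R <= kap.
Proof. by rewrite /kap ler_pdivlMr // fro_frob dim_le_frob. Qed.

Lemma kap_ge1 : 1 <= kap.
Proof. by apply: le_trans kap_ge; rewrite ler1n (dim_gt0 mu_min). Qed.

Lemma kap_gt0 : 0 < kap.
Proof. by apply: lt_le_trans kap_ge1. Qed.

Lemma n_gt0 : (0 < n)%N.
Proof.
have := fro_gt0; rewrite fro_rows; case: (n) => //.
by rewrite big_geq // ltxx.
Qed.

Lemma thr_gt0 i k : (i < n)%N -> (ptr i <= k < ptr i.+1)%N -> 0 < thr i k.
Proof.
move=> h hk; rewrite /thr mulr_gt0 ?normr_gt0 ?(cval_neq0 h) //.
by rewrite divr_gt0 ?rl1_gt0 // ltr0n rlen_gt0.
Qed.

Lemma rwt_gt0 i : (i < n)%N -> 0 < rwt i.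
Proof.
by move=> h; rewrite /rwt divr_gt0 ?fro_gt0 // mulr_gt0 ?rl2_gt0 // ltr0n n_gt0.
Qed.

Lemma rl2_le i : rl2 i <= rl1 i ^+ 2.
Proof.
rewrite /rl2 /rl1; set lo := ptr i; set hi := ptr i.+1.
have [le|lt] := leqP lo hi; last by rewrite !big_geq ?expr0n // ltnW.
rewrite -(subnKC le); elim: (hi - lo)%N => [|m IH].
  by rewrite addn0 !big_geq // expr0n.
rewrite addnS !(big_nat_recr (lo + m)) ?leq_addr //= -real_normK ?num_real //.
set S1 := \sum_(_ <= _ < _) `|_| in IH *; set S2 := \sum_(_ <= _ < _) _ in IH *.
have s0 : 0 <= S1 by apply: sumr_ge0.
by have := normr_ge0 (cval (lo + m)); nra.
Qed.

Lemma bsize_gt0 i : (0 < bsize i)%N.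
Proof. by []. Qed.

Lemma bsize_loop i j : ((j.+2)%:R ^+ 2 < bsq i) = (j < (bsize i).-1)%N.
Proof.
rewrite /bsize /=; case: ex_minnP => m hm min.
apply/idP/idP => h.
  rewrite ltnNge; apply/negP => mj.
  have : (m.+2%:R : R) <= j.+2%:R by rewrite ler_nat !ltnS.
  move: h; rewrite ltNge => /negP h h2; apply: h; apply: le_trans hm _.
  by rewrite ler_pXn2r // nnegrE.
by rewrite ltNge; apply/negP => /min; rewrite leqNgt h.
Qed.

Lemma bsize_ge i : bsq i <= ((bsize i).+1)%:R ^+ 2.
Proof. by rewrite /bsize; case: ex_minnP. Qed.

(** [bsq i <= N^2], as the l2 norm is at most the l1 norm and [kappa >= 1]. So the search for the
    block size is linear in the length of the row. *)
Lemma bsize_le i : (i < n)%N -> ((bsize i).-1 <= rlen i)%N.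
Proof.
move=> h; rewrite leqNgt -bsize_loop -leNgt.
have k1 := kap_ge1; have k0 := kap_gt0; have a0 := rl1_gt0 h; have le := rl2_le i.
rewrite /bsq ler_pdivrMr // (_ : _ * _ * _ = (rlen i)%:R ^+ 2 * (rl2 i / rl1 i ^+ 2)).
  have r1 : rl2 i / rl1 i ^+ 2 <= 1 by rewrite ler_pdivrMr ?mul1r // exprn_gt0.
  have r0 : 0 <= rl2 i / rl1 i ^+ 2 by rewrite divr_ge0 ?sqr_ge0 // ltW // rl2_gt0.
  apply: (@le_trans _ _ ((rlen i)%:R ^+ 2)); first by rewrite ler_piMr ?sqr_ge0.
  apply: (@le_trans _ _ ((rlen i).+2%:R ^+ 2)); first by rewrite ler_pXn2r ?nnegrE // ler_nat leqW.
  by rewrite ler_peMr ?sqr_ge0.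
by field; rewrite gt_eqF.
Qed.

(* Each of the [rlen i] roundings adds less than one slot. *)
Lemma tau_sum_le i : (i < n)%N ->
  (\sum_(ptr i <= k < ptr i.+1) tau i k <= 2 * rlen i)%N.
Proof.
move=> h; rewrite -(ler_nat R) natr_sum.
apply: (@le_trans _ _ (\sum_(ptr i <= k < ptr i.+1) (thr i k + 1))).
  apply: ler_sum_nat => k hk.
  by apply: ltW; apply: ceiln_lt; apply: thr_gt0.
rewrite big_split /= -mulr_suml -/(rl1 i) mulrC mulfVK ?gt_eqF ?rl1_gt0 //.
by rewrite big_const_nat iter_addr_0 -/(rlen i) natrM; lra.
Qed.

(** The weights are scaled to sum to [n], so that the [n] roundings at most double the number of
    slots. *)
Lemma rtick_le : (rtick n <= 2 * n)%N.
Proof.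
rewrite -(ler_nat R) natr_sum.
apply: (@le_trans _ _ (\sum_(0 <= i < n) (rwt i + 1))).
  apply: ler_sum_nat => i /andP[_ h].
  by apply: ltW; apply: ceiln_lt; apply: rwt_gt0.
rewrite big_split /= -mulr_suml -mulr_sumr -fro_rows mulfK ?gt_eqF ?fro_gt0 //.
by rewrite big_const_nat iter_addr_0 subn0 natrM; lra.
Qed.

Lemma rtick_ge : n%:R <= (rtick n)%:R :> R.
Proof.
rewrite natr_sum.
apply: (@le_trans _ _ (\sum_(0 <= i < n) rwt i)).
  by rewrite -mulr_suml -mulr_sumr -fro_rows mulfK ?gt_eqF ?fro_gt0.
apply: ler_sum_nat => i /andP[_ h].
by apply: ceiln_ge; apply: rwt_gt0.
Qed.

End Data.

Ltac agree_blk := repeat (apply: agree_run; [by []|]).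

(** * Correctness and cost of the preprocessing of a row *)

Section Phases.
Variable R : realType.
Variables (n d : nat) (A : 'M[R]_(n, d)) (b : 'cV[R]_n) (mu : R).
Implicit Types s : state R.

Local Notation ptr := (ptr A).
Local Notation cval := (cval A).
Local Notation ccol := (ccol A).
Local Notation rlen := (rlen A).
Local Notation rl1 := (rl1 A).
Local Notation rl2 := (rl2 A).
Local Notation fro := (fro A).
Local Notation kap := (kap A mu).
Local Notation thr := (thr A).
Local Notation tau := (tau A).
Local Notation sbase := (sbase A).
Local Notation rstart := (rstart A).
Local Notation uval := (uval A).
Local Notation bsq := (bsq A mu).
Local Notation bsize := (bsize A mu).
Local Notation rwt := (rwt A).
Local Notation rtick := (rtick A).

Lemma sumr_nat_const (c : R) lo hi : \sum_(lo <= j < hi) c = (hi - lo)%:R * c.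
Proof. by rewrite big_const_nat iter_addr_0 mulr_natl. Qed.

Record env s : Prop := Env {
  env_n : nreg s 0 = n;
  env_d : nreg s 1 = d;
  env_1 : nreg s 9 = 1%N;
  env_0 : rreg s 24 = 0;
  env_ptr : narr s 0 = ptr;
  env_col : narr s 1 = ccol;
  env_val : rarr s 0 = cval;
  env_b : rarr s 1 = vec_cells b }.

Definition env_cells : seq (nat * nat) :=
  [:: (0, 0); (0, 1); (0, 9); (1, 24); (2, 0); (2, 1); (3, 0); (3, 1)]%N.

(** Preservation of the environment becomes disjointness of two lists of cells, which is checked by
    computation. *)
Lemma env_agree L s s' : all (fun x => x \notin L) env_cells ->
  agree L s s' -> env s -> env s'.
Proof.
move=> /allP h ag [e1 e2 e3 e4 e5 e6 e7 e8].
by split; rewrite ?(agreeN ag) ?(agreeR ag) ?(agreeNA ag) ?(agreeRA ag) // ?h.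
Qed.

Lemma det_copy_x0 s : env s -> nreg s 2 = 0%N ->
  det copy_x0 s (fun s' => agree [:: (0, 2); (1, 12); (3, 3)]%N s s' /\
     forall j, (j < d)%N -> rarr s' 3 j = rarr s 2 j) (5 * d%:R + 2).
Proof.
move=> es e2; set L := [:: _; _; _].
pose Inv j s' := [/\ agree L s s', nreg s' 2 = j &
   forall i, (i < j)%N -> rarr s' 3 i = rarr s 2 i].
apply: (det_mono (@det_For _ 2 1 _ Inv 0 d (fun=> 2) s _ _ _ _)) => //.
- move=> j s' _ [ag e _]; split=> //.
  by rewrite (env_d (env_agree _ ag es)).
- move=> j s' hj [ag e h].
  have es' := env_agree (isT : all (fun x => x \notin L) env_cells) ag es.
  apply: det_Blk => //; split.
  + by agree_blk.
  + by rewrite /= e (env_1 es') addn1.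
  + move=> i hi /=; rewrite e (agreeRA (r := 2) ag) //.
    by case: eqP => [->//|ne]; apply: h; lia.
- by move=> s' [].
- by rewrite sumr_nat_const subn0; lra.
Qed.

Lemma det_frobenius s : env s -> rreg s 2 = 0 ->
  det frobenius s (fun s' => agree [:: (0, 3); (0, 14); (1, 12); (1, 2)]%N s s' /\
     rreg s' 2 = fro) (6 * (ptr n)%:R + 4).
Proof.
move=> es e2; set L := [:: _; _; _; _].
apply: det_BlkSq => //.
pose Inv j s' := [/\ agree L s s', nreg s' 3 = j, nreg s' 14 = ptr n &
   rreg s' 2 = \sum_(0 <= k < j) cval k ^+ 2].
apply: (det_mono (@det_For _ 3 14 _ Inv 0 (ptr n) (fun=> 3) _ _ _ _ _)) => //.
- by move=> j s' _ [].
- move=> j s' hj [ag e e14 h].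
  have es' := env_agree (isT : all (fun x => x \notin L) env_cells) ag es.
  apply: det_Blk => //; split.
  + by agree_blk.
  + by rewrite /= e (env_1 es') addn1.
  + by rewrite /= e14.
  + by rewrite /= h e (env_val es') big_nat_recr.
- split.
  + by agree_blk.
  + by [].
  + by rewrite /= (env_n es) (env_ptr es).
  + by rewrite /= e2 big_geq.
- by move=> s' [].
- by rewrite sumr_nat_const subn0 /=; lra.
Qed.

Lemma det_load_abs s : rreg s 24 = 0 ->
  det load_abs s (fun s' => [/\ agree [:: (1, 12); (1, 10)]%N s s',
     rreg s' 12 = rarr s 0 (nreg s 3) & rreg s' 10 = `|rarr s 0 (nreg s 3)|]) 4.
Proof.
move=> e0; set L := [:: _; _].
apply: det_BlkSq => //.
have -> : 4 - (size [:: RLoad 12 0 3; RAdd 10 12 24])%:R = 1 + 1 :> R by rewrite /=; lra.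
apply: det_If; last exact: lexx.
case: ifP => h; rewrite /= e0 in h.
  apply: det_Blk => //; split; first by agree_blk.
  + by [].
  + by rewrite /= e0 sub0r ltr0_norm.
split; first by agree_blk.
- by [].
- by rewrite /= e0 addr0 ger0_norm // leNgt h.
Qed.

Lemma det_row_norms i s : (i < n)%N -> env s -> nreg s 2 = i ->
  det row_norms s (fun s' => [/\
     agree [:: (0, 3); (0, 4); (0, 14); (1, 5); (1, 6); (1, 7); (1, 10); (1, 12)]%N s s',
     nreg s' 4 = ptr i.+1, rreg s' 5 = rl1 i, rreg s' 6 = rl2 i &
     rreg s' 7 = (rlen i)%:R]) (10 * (rlen i)%:R + 9).
Proof.
move=> hi es e2; set L := [:: _; _; _; _; _; _; _; _].
have le := csr_ptr_le A hi.
apply: det_BlkSq => //.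
pose Inv j s' := [/\ agree L s s', nreg s' 3 = j, nreg s' 4 = ptr i.+1,
   rreg s' 7 = (rlen i)%:R & rreg s' 5 = \sum_(ptr i <= k < j) `|cval k| /\
   rreg s' 6 = \sum_(ptr i <= k < j) cval k ^+ 2].
apply: (det_mono (@det_For _ 3 4 _ Inv (ptr i) (ptr i.+1) (fun=> 7) _ _ _ _ _)) => //.
- by move=> j s' _ [].
- move=> j s' hj [ag e e4 e7 [e5 e6]].
  have es' := env_agree (isT : all (fun x => x \notin L) env_cells) ag es.
  apply: det_Sq (det_load_abs (env_0 es')) _ _; last first.
    have -> : 7 = 4 + 3 :> R by lra.
    exact: lexx.
  move=> s2 [ag2 e12 e10].
  apply: det_Blk => //; split.
  + agree_blk; apply: agree_trans ag _; exact: agree_sub ag2.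
  + by rewrite /= (agreeN ag2) // (agreeN ag2) // e (env_1 es') addn1.
  + by rewrite /= (agreeN ag2).
  + by rewrite /= (agreeR ag2).
  + move: hj => /andP[hj _]; rewrite /= e12 e10 !(agreeR ag2) // e5 e6 e (env_val es').
    by rewrite !(big_nat_recr j).
- split.
  + by agree_blk.
  + by rewrite /= e2 (env_ptr es).
  + by rewrite /= e2 (env_ptr es) (env_1 es) addn1.
  + by rewrite /= e2 (env_ptr es) (env_1 es) addn1.
  + by rewrite /= (env_0 es) addr0 !big_geq.
- by move=> s' [ag e e4 e7 [e5 e6]].
- by rewrite sumr_nat_const -/(rlen i) /=; lra.
Qed.

Lemma det_block_size i s : nreg s 9 = 1%N -> rreg s 5 = rl1 i -> rreg s 6 = rl2 i ->
  rreg s 7 = (rlen i)%:R -> rreg s 3 = kap ->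
  det block_size s (fun s' => [/\
     agree [:: (1, 7); (1, 8); (1, 9); (0, 7); (0, 8)]%N s s',
     nreg s' 7 = bsize i & rreg s' 7 = (rlen i)%:R / rl1 i])
    (6 * ((bsize i).-1)%:R + 10).
Proof.
move=> e9 e5 e6 e7 e3; set L := [:: _; _; _; _; _].
apply: det_BlkSq => //.
pose Inv j s' := [/\ agree L s s', nreg s' 7 = j.+1, rreg s' 9 = j.+2%:R ^+ 2,
   rreg s' 7 = (rlen i)%:R / rl1 i & rreg s' 8 = bsq i].
apply: (det_mono (@det_While _ _ _ Inv (bsize i).-1 (fun=> 4) _ _ _ _)) => //.
- by move=> j s' _ [ag e7' e9' _ e8] /=; rewrite e9' e8 bsize_loop.
- move=> j s' hj [ag e7' e9' e7r e8].
  apply: det_Blk => //; split=> //=.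
  + by apply: (@agree_run _ L [:: NAdd 7 7 9; NAdd 8 7 9; RCast 9 8; RMul 9 9 9]).
  + by rewrite e7' (agreeN ag) // e9 addn1.
  + by rewrite e7' (agreeN ag) // e9 !addn1 expr2.
- split.
  + by agree_blk.
  + by [].
  + by rewrite /= e9 expr2.
  + by rewrite /= e7 e5.
  + by rewrite /= e7 e5 e6 e3.
- by move=> s' [].
- by rewrite sumr_nat_const subn0 /=; lra.
Qed.

Lemma rstartS i k : (ptr i <= k)%N -> rstart i k.+1 = (rstart i k + tau i k)%N.
Proof. by move=> h; rewrite /rstart big_nat_recr //= addnA. Qed.

Lemma rstart_ptr i : rstart i (ptr i) = sbase i.
Proof. by rewrite /rstart big_geq // addn0. Qed.

Lemma rstart_end i : rstart i (ptr i.+1) = sbase i.+1.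
Proof. by rewrite /sbase big_nat_recr. Qed.

Lemma rstart_ge i k : (sbase i <= rstart i k)%N.
Proof. exact: leq_addr. Qed.

Lemma rstart_mono i k k' : (ptr i <= k)%N -> (k <= k')%N -> (rstart i k <= rstart i k')%N.
Proof.
move=> h le; rewrite /rstart leq_add2l [X in (_ <= X)%N](big_cat_nat (n := k)) //=.
exact: leq_addr.
Qed.

Hypothesis nzrows : forall i : 'I_n, row i A != 0.

Lemma det_entry_slots i s : (i < n)%N -> env s -> nreg s 2 = i ->
  nreg s 4 = ptr i.+1 -> nreg s 7 = bsize i -> rreg s 7 = (rlen i)%:R / rl1 i ->
  nreg s 5 = sbase i ->
  det entry_slots s (fun s' => [/\
     agree [:: (2, 3); (0, 3); (1, 12); (1, 10); (0, 8); (1, 11); (0, 5); (2, 4);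
               (3, 6)]%N s s',
     nreg s' 5 = sbase i.+1,
     (forall j, narr s' 3 j = if j == i then bsize i else narr s 3 j),
     (forall t, (t < sbase i)%N -> narr s' 4 t = narr s 4 t) &
     [/\ forall k, (k < ptr i)%N -> rarr s' 6 k = rarr s 6 k,
         forall k, (ptr i <= k < ptr i.+1)%N -> rarr s' 6 k = uval i k &
         forall k t, (ptr i <= k < ptr i.+1)%N ->
           (rstart i k <= t < rstart i k.+1)%N -> narr s' 4 t = k]])
    (26 * (rlen i)%:R + 4).
Proof.
move=> hi es e2 e4 e7 e7r e5; set L := [:: _; _; _; _; _; _; _; _; _].
have le := csr_ptr_le A hi.
apply: det_BlkSq => //.
pose Inv j s' := [/\ agree L s s', nreg s' 3 = j, nreg s' 5 = rstart i j,
     (forall j, narr s' 3 j = if j == i then bsize i else narr s 3 j) &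
     [/\ (forall t, (t < sbase i)%N -> narr s' 4 t = narr s 4 t),
         (forall k, (k < ptr i)%N -> rarr s' 6 k = rarr s 6 k),
         (forall k, (ptr i <= k < j)%N -> rarr s' 6 k = uval i k) &
         forall k t, (ptr i <= k < j)%N ->
           (rstart i k <= t < rstart i k.+1)%N -> narr s' 4 t = k]].
apply: (det_mono (@det_For _ 3 4 _ Inv (ptr i) (ptr i.+1)
   (fun k => 6 * (tau i k)%:R + 11) _ _ _ _ _)) => //.
- by move=> j s' _ [ag e _ _ _]; rewrite e (agreeN ag) // e4.
- move=> j s' hj [ag e e5' e3 [h1 h2 h3 h4]].
  have es' := env_agree (isT : all (fun x => x \notin L) env_cells) ag es.
  apply: (det_Sq (det_load_abs (env_0 es')) (k2 := 6 * (tau i j)%:R + 7)); last by lra.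
  move=> s2 [ag2 e12 e10].
  apply: det_BlkSq => //.
  set s3 := run _ s2.
  have ag3 : agree L s s3.
    by agree_blk; apply: agree_trans ag _; exact: agree_sub ag2.
  have ag23 : agree [:: (1, 10); (1, 12)]%N s' s3.
    by agree_blk; exact: agree_sub ag2.
  have e103 : rreg s3 10 = thr i j.
    by rewrite /= e10 (agreeR ag2) // (agreeR ag) // e7r e (env_val es').
  have j33 : nreg s3 3 = j by rewrite (agreeN ag23).
  have j35 : nreg s3 5 = rstart i j by rewrite (agreeN ag23).
  have e123 : rreg s3 12 = cval j by rewrite /= e12 e (env_val es').
  have t3 : narr s3 4 = narr s' 4 by rewrite (agreeNA ag23).
  have a63 : rarr s3 6 = rarr s' 6 by rewrite (agreeRA ag23).
  have a33 : narr s3 3 = narr s' 3 by rewrite (agreeNA ag23).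
  clearbody s3.
  have n9 : nreg s3 9 = 1%N by rewrite (agreeN ag3) // (env_1 es).
  have th0 : 0 < rreg s3 10 by rewrite e103 (thr_gt0 _ hi).
  apply: (det_Sq (det_tickets (a := 4) (p := 5) (v := 3) isT isT isT isT n9 th0) (k2 := 2)); last first.
    by rewrite e103 -/(tau i j) /=; lra.
  rewrite e103 -/(tau i j) j35 j33 => s4 [ag4 e54 e114 t4].
  have a64 : rarr s4 6 = rarr s' 6 by rewrite (agreeRA ag4).
  have e124 : rreg s4 12 = cval j by rewrite (agreeR ag4).
  have j34 : nreg s4 3 = j by rewrite (agreeN ag4).
  have n94 : nreg s4 9 = 1%N by rewrite (agreeN ag4).
  have a34 : narr s4 3 = narr s' 3 by rewrite (agreeNA ag4).
  have [lej _] := andP hj.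
  apply: det_Blk => //; split.
  + agree_blk; apply: agree_trans ag3 _; exact: agree_sub ag4.
  + by rewrite /= j34 n94 addn1.
  + by rewrite /= e54 rstartS.
  + by move=> q; rewrite /= a34 e3.
  + split=> [t ht|k hk|k hk|k t hk ht] /=.
    * rewrite t4 t3 h1 //; case: ifP => // /andP[h _].
      by have := rstart_ge i j; lia.
    * by rewrite j34 a64; case: eqP => [ek|_]; [lia|exact: h2].
    * rewrite j34 a64 e124 e114; case: eqP => [->//|ne]; apply: h3; lia.
    * rewrite t4 t3; have [ek|ne] := eqVneq k j.
        by rewrite -rstartS // -ek ht.
      case: ifP => h; last by apply: h4 => //; lia.
      by have := @rstart_mono i k.+1 j; lia.
- split.
  + by agree_blk.
  + by rewrite /= e2 (env_ptr es).
  + by rewrite /= e5 rstart_ptr.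
  + by move=> j; rewrite /= e2 e7.
  + by split=> // k; lia.
- by move=> s' [ag e e5' e3 [h1 h2 h3 h4]]; rewrite -rstart_end; split.
(* Six steps per slot with at most [2 N] slots, and 14 per entry: [12 + 14 = 26]. *)
- have -> : \sum_(ptr i <= j < ptr i.+1) (6 * (tau i j)%:R + 11 + 3)
     = 6 * (\sum_(ptr i <= j < ptr i.+1) tau i j)%:R + (rlen i)%:R * 14 :> R.
    by rewrite natr_sum mulr_sumr -sumr_nat_const -big_split /=; apply: eq_bigr => j _; lra.
  have := tau_sum_le nzrows hi; rewrite -(ler_nat R) natrM /=; lra.
Qed.

Hypothesis mu_min : is_smallest_eigenvalue (A^T *m A) mu.
Hypothesis mu_gt0 : 0 < mu.

Lemma det_row_slots i s : (i < n)%N -> nreg s 9 = 1%N -> nreg s 2 = i ->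
  nreg s 5 = sbase i.+1 -> nreg s 6 = rtick i -> rreg s 4 = n%:R ->
  rreg s 6 = rl2 i -> rreg s 2 = fro ->
  det row_slots s (fun s' => [/\
     agree [:: (0, 10); (2, 2); (1, 10); (0, 8); (1, 11); (0, 6); (2, 5); (3, 7);
               (3, 8)]%N s s',
     nreg s' 6 = rtick i.+1,
     (forall j, narr s' 2 j = if j == i.+1 then sbase i.+1 else narr s 2 j),
     (forall t, narr s' 5 t = if (rtick i <= t < rtick i.+1)%N then i else narr s 5 t) &
     (forall j, rarr s' 8 j = if j == i then rwt i else rarr s 8 j) /\
     (forall j, rarr s' 7 j = if j == i then rwt i / (ceiln (rwt i))%:R
        else rarr s 7 j)])
    (6 * (ceiln (rwt i))%:R + 11).
Proof.
move=> hi e9 e2 e5 e6 e4 e6r e2r; set L := [:: _; _; _; _; _; _; _; _; _].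
have rtS : rtick i.+1 = (rtick i + ceiln (rwt i))%N by rewrite /rtick big_nat_recr.
apply: det_BlkSq => //; set s1 := run _ s.
have ag1 : agree [:: (0, 10); (2, 2); (1, 10)]%N s s1 by agree_blk.
have e10 : rreg s1 10 = rwt i by rewrite /= e4 e6r e2r.
have a2 j : narr s1 2 j = if j == i.+1 then sbase i.+1 else narr s 2 j.
  by rewrite /= e2 e9 addn1 e5.
clearbody s1.
have n9 : nreg s1 9 = 1%N by rewrite (agreeN ag1).
have th0 : 0 < rreg s1 10 by rewrite e10 (rwt_gt0 _ mu_min).
apply: (det_Sq (det_tickets (a := 5) (p := 6) (v := 2) isT isT isT isT n9 th0) (k2 := 3)); last first.
  by rewrite e10 /=; lra.
rewrite e10 => s2 [ag2 e62 e112 t2].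
rewrite (agreeN ag1) // e6 -rtS in e62 t2.
have j22 : nreg s2 2 = i by rewrite (agreeN ag2) // (agreeN ag1).
have e102 : rreg s2 10 = rwt i by rewrite (agreeR ag2).
apply: det_Blk => //; split.
- agree_blk; apply: agree_trans (agree_sub _ ag1) (agree_sub _ ag2) => //.
- by [].
- by move=> j; rewrite /= (agreeNA ag2).
- by move=> t; rewrite /= t2 (agreeN ag1) // e2 (agreeNA ag1).
- split=> j; rewrite /= j22 e102 ?e112.
    by rewrite (agreeRA ag2) // (agreeRA ag1).
  by rewrite (agreeRA ag2) // (agreeRA ag1).
Qed.

End Phases.

(** [D] depends on the failure probability alone, so it may be a literal of the program. Real
    register 19 starts at [eps^2 / D] instead of [eps^2]; the factor [D] is the margin for Markov's
    inequality on the error. *)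
Definition setup D :=
  Sq (Blk [:: NConst 9 1; RCast 20 9; NConst 2 0])
  (Sq copy_x0
  (Sq frobenius
  (Sq (Blk [:: RDiv 3 2 1; RCast 4 0; NConst 2 0])
  (Sq (For 2 0 prepare_row)
      (Blk [:: RCast 21 6; NConst 10 300; RCast 12 10; RMul 12 12 2; RDiv 14 20 12;
               NConst 10 8; RCast 12 10; RMul 15 14 1; RDiv 15 15 12;
               RMul 19 0 0; NConst 10 D; RCast 12 10; RDiv 19 19 12]))))).

Definition finish :=
  Sq (Blk [:: NConst 2 0])
     (For 2 1 (Blk [:: RLoad 12 5 2; RLoad 23 4 2; RMul 23 13 23; RSub 12 12 23;
                       RLoad 23 3 2; RAdd 23 23 12; RStore 3 2 23])).

(** * Setup, full gradient and end of an epoch *)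

Section Phases2.
Variable R : realType.
Variables (n d : nat) (A : 'M[R]_(n, d)) (b : 'cV[R]_n) (mu : R).
Implicit Types s : state R.

Local Notation ptr := (ptr A).
Local Notation cval := (cval A).
Local Notation ccol := (ccol A).
Local Notation rlen := (rlen A).
Local Notation rl2 := (rl2 A).
Local Notation fro := (fro A).
Local Notation kap := (kap A mu).
Local Notation sbase := (sbase A).
Local Notation rstart := (rstart A).
Local Notation uval := (uval A).
Local Notation bsize := (bsize A mu).
Local Notation rwt := (rwt A).
Local Notation rtick := (rtick A).
Local Notation env := (env A b).

Lemma sbase_mono i j : (i <= j)%N -> (sbase i <= sbase j)%N.
Proof.
move=> le; rewrite /sbase [X in (_ <= X)%N](big_cat_nat (n := i)) //=.
exact: leq_addr.
Qed.

Lemma rtick_mono i j : (i <= j)%N -> (rtick i <= rtick j)%N.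
Proof.
move=> le; rewrite /rtick [X in (_ <= X)%N](big_cat_nat (n := i)) //=.
exact: leq_addr.
Qed.

Record row_data i s : Prop := RowData {
  row_end : narr s 2 i.+1 = sbase i.+1;
  row_bsize : narr s 3 i = bsize i;
  row_acc : rarr s 7 i = rwt i / (ceiln (rwt i))%:R;
  row_wt : rarr s 8 i = rwt i;
  row_tick : forall t, (rtick i <= t < rtick i.+1)%N -> narr s 5 t = i;
  row_uval : forall k, (ptr i <= k < ptr i.+1)%N -> rarr s 6 k = uval i k;
  row_slot : forall k t, (ptr i <= k < ptr i.+1)%N ->
     (rstart i k <= t < rstart i k.+1)%N -> narr s 4 t = k }.

Definition rows_done m s := [/\ nreg s 5 = sbase m, nreg s 6 = rtick m,
  narr s 2 0 = 0%N & forall i, (i < m)%N -> row_data i s].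

Definition prepare_cells : seq (nat * nat) :=
  [:: (0, 3); (0, 4); (0, 5); (0, 6); (0, 7); (0, 8); (0, 10); (0, 14);
      (1, 5); (1, 6); (1, 7); (1, 8); (1, 9); (1, 10); (1, 11); (1, 12);
      (2, 2); (2, 3); (2, 4); (2, 5); (3, 6); (3, 7); (3, 8)]%N.

Definition stepsize : R := 1 / (300 * fro).
Definition stop_prob : R := stepsize * mu / 8.

Record ready s : Prop := Ready {
  ready_env : env s;
  ready_rows : forall i, (i < n)%N -> row_data i s;
  ready_base : narr s 2 0 = 0%N;
  ready_M : nreg s 6 = rtick n;
  ready_eta : rreg s 14 = stepsize;
  ready_prob : rreg s 15 = stop_prob;
  ready_1 : rreg s 20 = 1;
  ready_MR : rreg s 21 = (rtick n)%:R }.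

Definition ready_cells : seq (nat * nat) := env_cells ++
  [:: (0, 6); (1, 14); (1, 15); (1, 20); (1, 21); (2, 2); (2, 3); (2, 4); (2, 5);
      (3, 6); (3, 7); (3, 8)]%N.

Lemma ready_agree L s s' : all (fun x => x \notin L) ready_cells ->
  agree L s s' -> ready s -> ready s'.
Proof.
move=> h0 ag [e rows b0 M et pr o MR]; have /allP h := h0.
have n2 : narr s' 2 = narr s 2 by rewrite (agreeNA ag) ?h.
have n3 : narr s' 3 = narr s 3 by rewrite (agreeNA ag) ?h.
have n4 : narr s' 4 = narr s 4 by rewrite (agreeNA ag) ?h.
have n5 : narr s' 5 = narr s 5 by rewrite (agreeNA ag) ?h.
have r6 : rarr s' 6 = rarr s 6 by rewrite (agreeRA ag) ?h.
have r7 : rarr s' 7 = rarr s 7 by rewrite (agreeRA ag) ?h.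
have r8 : rarr s' 8 = rarr s 8 by rewrite (agreeRA ag) ?h.
split; rewrite ?(agreeN ag) ?(agreeR ag) ?n2 ?h //.
  by apply: env_agree ag e; move: h0; rewrite all_cat => /andP[].
by move=> i /rows [q1 q2 q3 q4 q5 q6 q7]; split; rewrite ?n2 ?n3 ?n4 ?n5 ?r6 ?r7 ?r8.
Qed.

Lemma sum_rlen : \sum_(0 <= i < n) (rlen i)%:R = (ptr n)%:R :> R.
Proof.
have := @csr_ptr_sum _ _ _ A R (fun=> 1) n (leqnn n).
rewrite sumr_nat_const subn0 mulr1 => ->.
by apply: eq_bigr => i _; rewrite sumr_nat_const mulr1.
Qed.

Definition residual (z : nat -> R) i : R :=
  \sum_(ptr i <= k < ptr i.+1) cval k * z (ccol k) - vec_cells b i.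

Definition grad_upto m (z : nat -> R) j : R :=
  \sum_(0 <= i < m) \sum_(ptr i <= k < ptr i.+1)
     (ccol k == j)%:R * (cval k * residual z i).

Lemma det_gradient_row i s : (i < n)%N -> env s -> nreg s 2 = i ->
  det gradient_row s (fun s' =>
     agree [:: (0, 3); (0, 4); (0, 13); (1, 22); (1, 12); (1, 23); (3, 4)]%N s s' /\
     forall j, rarr s' 4 j = rarr s 4 j + \sum_(ptr i <= k < ptr i.+1)
       (ccol k == j)%:R * (cval k * residual (rarr s 3) i))
    (17 * (rlen i)%:R + 10).
Proof.
move=> hi es e2; set L := [:: _; _; _; _; _; _; _].
have le := csr_ptr_le A hi.
apply: det_BlkSq => //; set s1 := run _ s.
have ag1 : agree L s s1 by agree_blk.
have e31 : nreg s1 3 = ptr i by rewrite /= e2 (env_ptr es).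
have e41 : nreg s1 4 = ptr i.+1 by rewrite /= e2 (env_ptr es) (env_1 es) addn1.
have e221 : rreg s1 22 = - vec_cells b i by rewrite /= e2 (env_0 es) (env_b es) sub0r.
have g1 : rarr s1 4 = rarr s 4 by [].
clearbody s1.
pose Inv j s' := [/\ agree L s s', nreg s' 3 = j, nreg s' 4 = ptr i.+1,
   rarr s' 4 = rarr s 4 &
   rreg s' 22 = \sum_(ptr i <= k < j) cval k * rarr s 3 (ccol k) - vec_cells b i].
apply: (det_Sq (@det_For _ 3 4 _ Inv (ptr i) (ptr i.+1) (fun=> 5) s1 _ _ _ _)
   (k2 := 9 * (rlen i)%:R + 3)) => //.
- by move=> j s' _ [].
- move=> j s' /andP[hj _] [ag e e4 e5 e22].
  have es' : env s' by apply: env_agree ag es.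
  apply: det_Blk => //; split.
  + by agree_blk.
  + by rewrite /= e (env_1 es') addn1.
  + by [].
  + by [].
  + rewrite /= e22 e (env_val es') (env_col es') (agreeRA ag) // big_nat_recr //=.
    by rewrite addrAC.
- by split=> //; rewrite e221 big_geq ?add0r.
- move=> s2 [ag2 _ e42 g2 e222].
  have es2 : env s2 by apply: env_agree ag2 es.
  apply: det_BlkSq => //.
  pose Inv2 j s' := [/\ agree L s s', nreg s' 3 = j, nreg s' 4 = ptr i.+1,
     rreg s' 22 = residual (rarr s 3) i &
     forall q, rarr s' 4 q = rarr s 4 q + \sum_(ptr i <= k < j)
       (ccol k == q)%:R * (cval k * residual (rarr s 3) i)].
  apply: (det_mono (@det_For _ 3 4 _ Inv2 (ptr i) (ptr i.+1) (fun=> 6) _ _ _ _ _)) => //.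
  + by move=> j s' _ [].
  + move=> j s' /andP[hj _] [ag e e4 e22 h].
    have es' : env s' by apply: env_agree ag es.
    apply: det_Blk => //; split.
    * by agree_blk.
    * by rewrite /= e (env_1 es') addn1.
    * by [].
    * by [].
    * move=> q; rewrite /= e22 e (env_val es') (env_col es') big_nat_recr //= !h.
      rewrite [q == _]eq_sym; case: eqP => [->|_]; last by rewrite mul0r addr0.
      by rewrite mul1r addrA.
  + split.
    * by agree_blk.
    * by rewrite /= (agreeN ag2) // e2 (env_ptr es2).
    * by [].
    * by rewrite /= e222.
    * by move=> q; rewrite /= g2 big_geq // addr0.
  + by move=> s' [].
  + by rewrite sumr_nat_const -/(rlen i) /=; lra.
- by rewrite sumr_nat_const -/(rlen i) /=; lra.
Qed.

Lemma det_gradient s : ready s ->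
  det gradient s (fun s' => [/\
     agree [:: (0, 2); (0, 3); (0, 4); (0, 13); (1, 22); (1, 12); (1, 23); (3, 4);
               (3, 5)]%N s s',
     (forall j, (j < d)%N -> rarr s' 4 j = grad_upto n (rarr s 3) j) &
     forall j, (j < d)%N -> rarr s' 5 j = 0])
    (17 * (ptr n)%:R + 13 * n%:R + 5 * d%:R + 6).
Proof.
move=> rs; have es := ready_env rs; set L := [:: _; _; _; _; _; _; _; _; _].
apply: det_BlkSq => //; set s1 := run _ s.
have ag1 : agree L s s1 by agree_blk.
have i1 : nreg s1 2 = 0%N by [].
clearbody s1.
pose Inv j s' := [/\ agree L s s', nreg s' 2 = j &
   forall q, (q < j)%N -> rarr s' 4 q = 0 /\ rarr s' 5 q = 0].
apply: (det_Sq (@det_For _ 2 1 _ Inv 0 d (fun=> 2) s1 _ _ _ _)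
   (k2 := 17 * (ptr n)%:R + 13 * n%:R + 3)) => //.
- move=> j s' _ [ag e _]; split=> //.
  by rewrite (agreeN ag) // (env_d es).
- move=> j s' _ [ag e h].
  have es' : env s' by apply: env_agree ag es.
  apply: det_Blk => //; split.
  + by agree_blk.
  + by rewrite /= e (env_1 es') addn1.
  + move=> q hq /=; rewrite e (env_0 es').
    by case: eqP => // ne; apply: h; lia.
- move=> s2 [ag2 i2 z2].
  have es2 : env s2 by apply: env_agree ag2 es.
  apply: det_BlkSq => //.
  pose Inv2 i s' := [/\ agree L s s', nreg s' 2 = i,
    (forall j, (j < d)%N -> rarr s' 4 j = grad_upto i (rarr s 3) j) &
     forall j, (j < d)%N -> rarr s' 5 j = 0].
  apply: (det_mono (@det_For _ 2 0 _ Inv2 0 n (fun i => 17 * (rlen i)%:R + 10)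
     _ _ _ _ _)) => //.
  + by move=> i s' _ [ag e _ _]; rewrite e (agreeN ag) // (env_n es).
  + move=> i s' /andP[_ hi] [ag e hg hy].
    have es' : env s' by apply: env_agree ag es.
    apply: det_mono (det_gradient_row hi es' e) _ (lexx _).
    move=> s3 [ag3 h3]; split.
    * by agree_blk; apply: agree_trans ag (agree_sub _ ag3).
    * by rewrite /= (agreeN ag3) // (agreeN ag3) // e (env_1 es') addn1.
    * move=> j hj; rewrite /= h3 hg // (agreeRA ag) // /grad_upto.
      by rewrite big_nat_recr.
    * by move=> j hj; rewrite /= (agreeRA ag3) // hy.
  + split.
    * by agree_blk.
    * by [].
    * by move=> j /z2 [-> _]; rewrite /grad_upto big_geq.
    * by move=> j /z2 [].
  + by move=> s' [].
  + have -> : \sum_(0 <= j < n) (17 * (rlen j)%:R + 10 + 3)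
       = 17 * (ptr n)%:R + n%:R * 13 :> R.
      rewrite -sum_rlen !mulr_sumr -[n in n%:R * _]subn0 -sumr_nat_const.
      by rewrite -!big_split /=; apply: eq_bigr => j _; lra.
    by rewrite /=; lra.
- by rewrite sumr_nat_const subn0 /=; lra.
Qed.

Lemma det_finish s : ready s ->
  det finish s (fun s' => agree [:: (0, 2); (1, 12); (1, 23); (3, 3)]%N s s' /\
     forall j, (j < d)%N ->
       rarr s' 3 j = rarr s 3 j + (rarr s 5 j - rreg s 13 * rarr s 4 j))
    (10 * d%:R + 3).
Proof.
move=> rs; have es := ready_env rs; set L := [:: _; _; _; _].
apply: det_BlkSq => //.
pose Inv j s' := [/\ agree L s s', nreg s' 2 = j &
   forall q, rarr s' 3 q = if (q < j)%N then
     rarr s 3 q + (rarr s 5 q - rreg s 13 * rarr s 4 q) else rarr s 3 q].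
apply: (det_mono (@det_For _ 2 1 _ Inv 0 d (fun=> 7) _ _ _ _ _)) => //.
- move=> j s' _ [ag e _]; split=> //.
  by rewrite (agreeN ag) // (env_d es).
- move=> j s' hj [ag e h].
  have es' : env s' by apply: env_agree ag es.
  apply: det_Blk => //; split.
  + by agree_blk.
  + by rewrite /= e (env_1 es') addn1.
  + move=> q /=; rewrite e !h !(agreeRA ag) // (agreeR ag) //.
    case: eqP => [->|ne]; first by rewrite ltnn ltnSn.
    by rewrite ltnS [in RHS]leq_eqVlt; case: eqP ne.
- by split=> //; agree_blk.
- by move=> s' [ag _ h]; split=> // j hj; rewrite h hj.
- by rewrite sumr_nat_const subn0 /=; lra.
Qed.

Hypothesis nzrows : forall i : 'I_n, row i A != 0.
Hypothesis mu_min : is_smallest_eigenvalue (A^T *m A) mu.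
Hypothesis mu_gt0 : 0 < mu.

Lemma det_prepare_row i s : (i < n)%N -> env s -> nreg s 2 = i -> rreg s 2 = fro ->
  rreg s 3 = kap -> rreg s 4 = n%:R -> rows_done i s ->
  det prepare_row s (fun s' => agree prepare_cells s s' /\ rows_done i.+1 s')
    (42 * (rlen i)%:R + 6 * (ceiln (rwt i))%:R + 34).
Proof.
move=> hi es e2 e2r e3r e4r [d5 d6 d20 dat].
set c1 := 42 * _.
apply: (det_Sq (det_row_norms hi es e2) (k2 := 32 * (rlen i)%:R
  + 6 * (ceiln (rwt i))%:R + 25)); last by rewrite /c1; lra.
move=> s1 [ag1 e41 e51 e61 e71].
have es1 : env s1 by apply: env_agree ag1 es.
have bl := bsize_le nzrows mu_min mu_gt0 hi.
have e31 : rreg s1 3 = kap by rewrite (agreeR ag1).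
apply: (det_Sq (det_block_size (env_1 es1) e51 e61 e71 e31) (k2 := 26 * (rlen i)%:R
  + 6 * (ceiln (rwt i))%:R + 15)); last first.
  by move: bl; rewrite -(ler_nat R); lra.
move=> s2 [ag2 e72 e7r2].
have es2 : env s2 by apply: env_agree ag2 es1.
have ag02 : agree prepare_cells s s2.
  by apply: agree_trans (agree_sub _ ag1) (agree_sub _ ag2).
have i2 : nreg s2 2 = i by rewrite (agreeN ag02).
have e42 : nreg s2 4 = ptr i.+1 by rewrite (agreeN ag2).
have e52 : nreg s2 5 = sbase i by rewrite (agreeN ag2) // (agreeN ag1).
apply: (det_Sq (det_entry_slots nzrows hi es2 i2 e42 e72 e7r2 e52) (k2 :=
  6 * (ceiln (rwt i))%:R + 11)); last by lra.
move=> s3 [ag3 e53 a33 t43 [u63 u63' t43']].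
have es3 : env s3 by apply: env_agree ag3 es2.
have ag03 : agree prepare_cells s s3.
  by apply: agree_trans ag02 (agree_sub _ ag3).
have i3 : nreg s3 2 = i by rewrite (agreeN ag03).
have f3 : rreg s3 2 = fro by rewrite (agreeR ag03).
have n3 : rreg s3 4 = n%:R by rewrite (agreeR ag03).
have e63 : nreg s3 6 = rtick i.
  by rewrite (agreeN ag3) // (agreeN ag2) // (agreeN ag1).
have l23 : rreg s3 6 = rl2 i by rewrite (agreeR ag3) // (agreeR ag2).
apply: det_mono (det_row_slots nzrows mu_min mu_gt0 hi (env_1 es3) i3 e53 e63 n3 l23 f3)
  _ (lexx _).
move=> s4 [ag4 e64 b24 t54 [w84 a74]].
split; first by apply: agree_trans ag03 (agree_sub _ ag4).
have n2 : narr s3 2 = narr s 2.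
  by rewrite (agreeNA ag3) // (agreeNA ag2) // (agreeNA ag1).
have n33 : narr s2 3 = narr s 3 by rewrite (agreeNA ag2) // (agreeNA ag1).
have n4 : narr s2 4 = narr s 4 by rewrite (agreeNA ag2) // (agreeNA ag1).
have n5 : narr s3 5 = narr s 5.
  by rewrite (agreeNA ag3) // (agreeNA ag2) // (agreeNA ag1).
have r6 : rarr s2 6 = rarr s 6 by rewrite (agreeRA ag2) // (agreeRA ag1).
have r7 : rarr s3 7 = rarr s 7.
  by rewrite (agreeRA ag3) // (agreeRA ag2) // (agreeRA ag1).
have r8 : rarr s3 8 = rarr s 8.
  by rewrite (agreeRA ag3) // (agreeRA ag2) // (agreeRA ag1).
split.
- by rewrite (agreeN ag4).
- by [].
- by rewrite b24 n2 d20.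
move=> j; rewrite ltnS leq_eqVlt => /predU1P[->|ji].
  split.
  - by rewrite b24 eqxx.
  - by rewrite (agreeNA ag4) // a33 eqxx.
  - by rewrite a74 eqxx.
  - by rewrite w84 eqxx.
  - by move=> t ht; rewrite t54 ht.
  - by move=> k hk; rewrite (agreeRA ag4) // u63'.
  - by move=> k t hk ht; rewrite (agreeNA ag4) // (t43' k).
have [q1 q2 q3 q4 q5 q6 q7] := dat j ji.
(* The entries of earlier rows lie below [ptr i], so preparing row [i] leaves their data intact. *)
have mp : (ptr j.+1 <= ptr i)%N.
  by apply: csr_ptr_mono => //; rewrite inE; lia.
split.
- by rewrite b24 n2 q1 eqSS; case: eqP => // ->.
- by rewrite (agreeNA ag4) // a33 n33; case: eqP => [ej|_] //; lia.
- by rewrite a74 r7; case: eqP => [ej|_] //; lia.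
- by rewrite w84 r8; case: eqP => [ej|_] //; lia.
- move=> t ht; rewrite t54 n5 q5 //; case: ifP => // h.
  by have := rtick_mono ji; lia.
- by move=> k hk; rewrite (agreeRA ag4) // u63 ?r6 ?q6 //; lia.
- move=> k t hk ht; rewrite (agreeNA ag4) // t43 ?n4 ?(q7 k) //.
  have := sbase_mono ji; have := @rstart_mono _ _ _ A j k.+1 (ptr j.+1).
  by rewrite rstart_end; lia.
Qed.

Lemma det_setup D s (x0 : nat -> R) (eps : R) : nreg s 0 = n -> nreg s 1 = d ->
  rreg s 0 = eps -> rreg s 1 = mu -> narr s 0 = ptr -> narr s 1 = ccol ->
  rarr s 0 = cval -> rarr s 1 = vec_cells b -> rarr s 2 = x0 ->
  rreg s 2 = 0 -> rreg s 24 = 0 -> nreg s 5 = 0%N -> nreg s 6 = 0%N ->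
  narr s 2 0 = 0%N ->
  det (setup D) s (fun s' => [/\ ready s', rreg s' 19 = eps * eps / D%:R &
     forall j, (j < d)%N -> rarr s' 3 j = x0 j])
    (5 * d%:R + 48 * (ptr n)%:R + 49 * n%:R + 27).
Proof.
move=> en ed e0 e1 ep ec ev eb ex f0 z0 n5 n6 a20.
apply: det_BlkSq => //; set s1 := run _ s.
have ag1 : agree [:: (0, 9); (1, 20); (0, 2)]%N s s1 by agree_blk.
have es1 : env s1.
  by split=> //; rewrite ?(agreeN ag1) ?(agreeR ag1) ?(agreeNA ag1) ?(agreeRA ag1).
have o1 : rreg s1 20 = 1 by [].
have i1 : nreg s1 2 = 0%N by [].
clearbody s1.
apply: (det_Sq (det_copy_x0 es1 i1) (k2 := 48 * (ptr n)%:R + 49 * n%:R + 22));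
  last by rewrite /=; lra.
move=> s2 [ag2 z2].
have es2 : env s2 by apply: env_agree ag2 es1.
have f2 : rreg s2 2 = 0 by rewrite (agreeR ag2) // (agreeR ag1).
apply: (det_Sq (det_frobenius es2 f2) (k2 := 42 * (ptr n)%:R + 49 * n%:R + 18));
  last by lra.
move=> s3 [ag3 f3].
have es3 : env s3 by apply: env_agree ag3 es2.
apply: det_BlkSq => //; set s4 := run _ s3.
set L := [:: (0, 9); (1, 20); (0, 2); (1, 12); (3, 3); (0, 3); (0, 14); (1, 2); (1, 3);
   (1, 4)]%N.
have ag04 : agree L s s4.
  agree_blk; apply: agree_trans (agree_sub _ ag1) _ => //.
  by apply: agree_trans (agree_sub _ ag2) (agree_sub _ ag3).
have es4 : env s4.
  by apply: env_agree es3; [|apply: (@agree_run _ [:: (1, 3); (1, 4); (0, 2)]%N)].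
have f4 : rreg s4 2 = fro by rewrite /= f3.
have k4 : rreg s4 3 = kap.
  by rewrite /= f3 (agreeR ag3) // (agreeR ag2) // (agreeR ag1) // e1.
have n4 : rreg s4 4 = n%:R by rewrite /= (env_n es3).
have i4 : nreg s4 2 = 0%N by [].
have o4 : rreg s4 20 = 1 by rewrite /= (agreeR ag3) // (agreeR ag2).
have z4 : rarr s4 3 = rarr s2 3 by rewrite /= (agreeRA ag3).
clearbody s4.
have done4 : rows_done 0 s4.
  split=> //; rewrite ?(agreeN ag04) ?(agreeNA ag04) //.
  - by rewrite n5 /sbase big_geq.
  - by rewrite n6 /rtick big_geq.
set L2 := (0, 2)%N :: prepare_cells.
pose Inv i s' := [/\ agree L2 s4 s', nreg s' 2 = i & rows_done i s'].
apply: (det_Sq (@det_For _ 2 0 _ Inv 0 n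
  (fun i => 42 * (rlen i)%:R + 6 * (ceiln (rwt i))%:R + 34) s4 _ _ _ _) (k2 := 13)) => //.
- by move=> i s' hi [ag e _]; rewrite e (agreeN ag) // (env_n es4).
- move=> i s' /andP[_ hi] [ag e dn].
  have es' : env s' by apply: env_agree ag es4.
  have f' : rreg s' 2 = fro by rewrite (agreeR ag).
  have k' : rreg s' 3 = kap by rewrite (agreeR ag).
  have n' : rreg s' 4 = n%:R by rewrite (agreeR ag).
  apply: det_mono (det_prepare_row hi es' e f' k' n' dn) _ (lexx _).
  move=> s5 [ag5 [q1 q2 q3 q4]]; split.
  + by agree_blk; apply: agree_trans ag (agree_sub _ ag5).
  + by rewrite /= (agreeN ag5) // (agreeN ag5) // e (env_1 es') addn1.
  + split=> // j hj; have [r1 r2 r3 r4 r5 r6 r7] := q4 j hj; by split.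
- move=> s5 [ag5 i5 [q1 q2 q3 q4]].
  have es5 : env s5 by apply: env_agree ag5 es4.
  apply: det_Blk => //; split.
  + split.
    * by apply: env_agree es5; [|apply: (@agree_run _ [:: (1, 21); (0, 10); (1, 12);
        (1, 14); (1, 15); (1, 19)]%N)].
    * by move=> j hj; have [r1 r2 r3 r4 r5 r6 r7] := q4 j hj; split.
    * by [].
    * by rewrite /= q2.
    * by rewrite /= (agreeR ag5) // o4 (agreeR ag5) // f4.
    * rewrite /= (agreeR ag5) // o4 (agreeR ag5) // f4 (agreeR ag5) // (agreeR ag04) //.
      by rewrite e1.
    * by rewrite /= (agreeR ag5).
    * by rewrite /= q2.
  + by rewrite /= (agreeR ag5) // (agreeR ag04) // e0.
  + move=> j hj; rewrite /= (agreeRA ag5) // z4 z2 // (agreeRA ag1) //.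
    by rewrite ex.
- have -> : \sum_(0 <= j < n) (42 * (rlen j)%:R + 6 * (ceiln (rwt j))%:R + 34 + 3)
     = 42 * (ptr n)%:R + 6 * (rtick n)%:R + n%:R * 37 :> R.
    rewrite -sum_rlen natr_sum !mulr_sumr -[n in n%:R * _]subn0 -sumr_nat_const.
    by rewrite -!big_split /=; apply: eq_bigr => j _; lra.
  (* At most [2 n] row slots at six steps each turn [37 n] into [49 n]. *)
  by have := rtick_le nzrows mu_min mu_gt0; rewrite -(ler_nat R) natrM /=; lra.
Qed.

End Phases2.

(** * The inner loop *)

(* Draws one slot from each block of natural register 7 consecutive slots     *)
(* between natural registers 11 and 12, and runs [c] with the drawn entry in  *)
(* natural register 3; draws beyond the last slot are void.                   *)
Definition sampling c :=
  While (GN 11 12)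
    (Sq (Rnd 10 7) (Sq (Blk [:: NAdd 10 11 10])
    (Sq (If (GN 10 12) (Sq (Blk [:: NLoad 3 4 10]) c)) (Blk [:: NAdd 11 11 7])))).

Definition dot_code :=
  [:: NLoad 13 1 3; RLoad 12 5 13; RLoad 23 4 13; RMul 23 13 23; RSub 12 12 23;
      RLoad 23 6 3; RMul 12 12 23; RMul 12 12 18; RAdd 16 16 12].

Definition axpy_code :=
  [:: NLoad 13 1 3; RLoad 12 6 3; RMul 12 12 17; RLoad 23 5 13; RSub 23 23 12;
      RStore 5 13 23].

(** [1 / p_i] is the number of row slots (real register 21) over the row weight (12). Resetting
    natural register 11 starts a second pass over the same blocks with fresh draws. *)
Definition update :=
  Sq (Blk [:: NLoad 7 3 2; RCast 18 7; NLoad 11 2 2; NAdd 12 2 9; NLoad 12 2 12;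
              RAdd 16 24 24])
  (Sq (sampling (Blk dot_code))
  (Sq (Blk [:: RLoad 12 8 2; RMul 17 16 14; RMul 17 17 21; RDiv 17 17 12;
               RMul 17 17 18; NLoad 11 2 2])
      (sampling (Blk axpy_code)))).

(** * Expected outcome of a sampling loop *)

Section Sampling.
Variable R : realType.
Implicit Types s : state R.
Variables (P : program) (Ev : state R -> Prop) (T : nat).

(** [x] is what the loop accumulates and [phi m p x] the expected final charge with [m] blocks left
    from slot [p]; the averaging hypothesis makes it a martingale. A turn costs 7 besides [cb]:
    guard, draw, two additions, inner guard, load, jump back. *)
Lemma sem_sampling (X : Type) (cb : seq instr) (Inv : state R -> X -> Prop)
    (B e p0 : nat) (tk : nat -> nat) (up : X -> nat -> X)
    (phi : nat -> nat -> X -> R) (K : state R -> R -> Prop) :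
  all straight cb -> (0 < size cb)%N -> (0 < B)%N ->
  (forall s x s', agree [:: (0, 10); (0, 3); (0, 11)]%N s s' -> Inv s x -> Inv s' x) ->
  (forall s x, Inv s x -> [/\ nreg s 7 = B, nreg s 12 = e & narr s 4 = tk]) ->
  (forall s x t, (p0 <= t < e)%N -> nreg s 3 = tk t -> Inv s x ->
     Inv (run cb s) (up x (tk t)) /\ nreg (run cb s) 11 = nreg s 11) ->
  (forall m p x, (\sum_(r < B) phi m (p + B)%N
     (if (p + r < e)%N then up x (tk (p + r)%N) else x)) / B%:R = phi m.+1 p x) ->
  (forall s x p, Inv s x -> K s (phi 0%N p x)) ->
  forall m p s x, (p0 <= p)%N -> (e <= p + m * B)%N -> (m * B < e - p + B)%N ->
  Inv s x -> nreg s 11 = p ->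
  sem P Ev T (sampling (Blk cb)) s K (phi m p x + (7 + (size cb)%:R) * m%:R + 2).
Proof.
move=> scb cb0 B0 Iag Ifix Ibody Hphi HK.
elim=> [|m IH] p s x hp h1 h2 i e11; apply: sem_While; have [e7 e12 e4] := Ifix _ _ i.
  rewrite /= e11 e12 ltnNge (_ : (e <= p)%N) /=; last by lia.
  have -> : phi 0%N p x + (7 + (size cb)%:R) * 0%:R + 2 - 2 = phi 0%N p x by ring.
  exact: HK.
rewrite /= e11 e12 (_ : (p < e)%N); last by nia.
set w := _ + 2.
apply: sem_Sq.
pose f r := phi m (p + B)%N (if (p + r < e)%N then up x (tk (p + r)%N) else x)
  + (7 + (size cb)%:R) * m%:R + 2 + (5 + (size cb)%:R).
have ef : 1 + (\sum_(r < B) f r) / B%:R = w - 1.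
  have -> : \sum_(r < B) f r = \sum_(r < B) phi m (p + B)%N
      (if (p + r < e)%N then up x (tk (p + r)%N) else x)
      + ((7 + (size cb)%:R) * m%:R + 2 + (5 + (size cb)%:R)) * B%:R.
    have -> (y : R) : y * B%:R = \sum_(r < B) y by rewrite sumr_const card_ord mulr_natr.
    rewrite -big_split /=.
    by apply: eq_bigr => r _; rewrite /f -!addrA.
  rewrite mulrDl Hphi /w mulfK ?pnatr_eq0 -?lt0n // -natr1; ring.
rewrite -ef; apply: sem_Rnd => // r hr.
apply: sem_Sq; apply: sem_Blk => //; apply: sem_Sq.
set s1 := run _ _.
have ag1 : agree [:: (0, 10); (0, 3); (0, 11)]%N s s1.
  by agree_blk; apply: agree_set_nreg.
have e10 : nreg s1 10 = (p + r)%N by rewrite /= e11.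
have e111 : nreg s1 11 = p by [].
have {ag1} i1 : Inv s1 x by exact: Iag ag1 i.
clearbody s1; have [e71 e121 e41] := Ifix _ _ i1.
have last s2 x2 w' : Inv s2 x2 -> nreg s2 11 = p ->
   phi m (p + B)%N x2 + (7 + (size cb)%:R) * m%:R + 2 + 2 <= w' ->
   sem P Ev T (Blk [:: NAdd 11 11 7]) s2 (fun s' w'' =>
     sem P Ev T (sampling (Blk cb)) s' K (w'' - 1)) w'.
  move=> i2 e112 le; apply: sem_Blk => //.
  have [e72 _ _] := Ifix _ _ i2.
  apply: (@sem_le _ _ _ _ _ _ _ (phi m (p + B)%N x2 + (7 + (size cb)%:R) * m%:R + 2));
    last by rewrite /=; lra.
  apply: IH => //; rewrite ?mulSn in h1 h2 *; try lia.
  - by apply: Iag i2; agree_blk.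
  - by rewrite /= e112 e72.
apply: sem_If; rewrite /= e10 e121 /f.
case: ifP => hlt.
  apply: sem_Sq; apply: sem_Blk => //; apply: sem_Blk => //.
  set s2 := run [:: NLoad 3 4 10] s1.
  have i2 : Inv s2 x by apply: Iag i1; agree_blk.
  have e32 : nreg s2 3 = tk (p + r)%N by rewrite /= e10 e41.
  have [|i3 e113] := Ibody s2 x (p + r)%N _ e32 i2; first by lia.
  by apply: last i3 _ _; [rewrite e113|rewrite /= hlt; lra].
apply: last i1 e111 _.
have : 1 <= (size cb)%:R :> R by rewrite ler1n.
by rewrite /= hlt; lra.
Qed.

End Sampling.

(** * Mean and variance of a sampled row *)

Section Rows.
Variable R : realType.
Variables (n d : nat) (A : 'M[R]_(n, d)) (b : 'cV[R]_n) (mu : R).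
Implicit Types s : state R.

Local Notation ptr := (ptr A).
Local Notation cval := (cval A).
Local Notation rlen := (rlen A).
Local Notation rl1 := (rl1 A).
Local Notation rl2 := (rl2 A).
Local Notation kap := (kap A mu).
Local Notation thr := (thr A).
Local Notation tau := (tau A).
Local Notation sbase := (sbase A).
Local Notation rstart := (rstart A).
Local Notation uval := (uval A).
Local Notation bsq := (bsq A mu).
Local Notation bsize := (bsize A mu).

Definition nblk i := ((sbase i.+1 - sbase i + (bsize i).-1) %/ bsize i)%N.

Lemma nblkP i : (sbase i.+1 <= sbase i + nblk i * bsize i)%N /\
  (nblk i * bsize i < sbase i.+1 - sbase i + bsize i)%N.
Proof.
have b0 := bsize_gt0 A mu i.
rewrite /nblk; set L := (_ - _)%N; set c := bsize i in b0 *.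
have := divn_eq (L + c.-1) c; have := ltn_pmod (L + c.-1) b0.
by rewrite /L; lia.
Qed.

Hypothesis nzrows : forall i : 'I_n, row i A != 0.

Lemma tau_gt0 i k : (i < n)%N -> (ptr i <= k < ptr i.+1)%N -> 0 < (tau i k)%:R :> R.
Proof. by move=> hi hk; rewrite ltr0n ceiln_gt0 // thr_gt0. Qed.

Lemma rstartB i k : (ptr i <= k)%N -> (rstart i k.+1 - rstart i k)%N = tau i k.
Proof. by move=> h; rewrite rstartS // addKn. Qed.

Lemma tau_uval i k : (i < n)%N -> (ptr i <= k < ptr i.+1)%N ->
  (tau i k)%:R * uval i k = cval k.
Proof. by move=> hi hk; rewrite mulrC divfK // gt_eqF ?tau_gt0. Qed.

(** Because slot counts are rounded up, no slot is worth more than [||a_i||_1 / N], however large or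
    small its entry. *)
Lemma uval_le i k : (i < n)%N -> (ptr i <= k < ptr i.+1)%N ->
  uval i k ^+ 2 <= (rl1 i / (rlen i)%:R) ^+ 2.
Proof.
move=> hi hk; have l0 := rl1_gt0 nzrows hi.
have N0 : 0 < (rlen i)%:R :> R by rewrite ltr0n rlen_gt0.
rewrite -real_normK ?num_real // ler_pXn2r ?nnegrE //; last exact/ltW/divr_gt0.
rewrite /uval normrM normfV (ger0_norm (ler0n _ _)) ler_pdivrMr ?tau_gt0 //.
have := ceiln_ge (thr_gt0 nzrows hi hk).
rewrite -[ceiln _]/(tau i k) /thr mulrA ler_pdivrMr // => h.
by rewrite mulrAC ler_pdivlMr // [X in _ <= X]mulrC.
Qed.

Variable tk : nat -> nat.

Definition wmean i (c : nat -> R) := mean_from (rstart i) tk (ptr i.+1) (bsize i)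
  (fun k => uval i k * c k).
Definition wvar i (c : nat -> R) := var_from (rstart i) tk (ptr i.+1) (bsize i)
  (fun k => uval i k * c k).

Hypothesis slots : forall i k t, (i < n)%N -> (ptr i <= k < ptr i.+1)%N ->
  (rstart i k <= t < rstart i k.+1)%N -> tk t = k.

Lemma wmean_total i c : (i < n)%N ->
  wmean i c (nblk i) (sbase i) = \sum_(ptr i <= k < ptr i.+1) cval k * c k.
Proof.
move=> hi; rewrite /wmean -rstart_ptr mean_total //.
- rewrite !big_nat; apply: eq_bigr => k hk.
  by have [h _] := andP hk; rewrite rstartB // mulrA tau_uval.
- exact: csr_ptr_le.
- by move=> k /andP[hk _]; rewrite rstart_mono.
- by move=> k t hk; apply: slots.
- by rewrite rstart_ptr rstart_end; case: (nblkP i).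
Qed.

Hypothesis mu_min : is_smallest_eigenvalue (A^T *m A) mu.
Hypothesis mu_gt0 : 0 < mu.

(** [B^2 <= bsq i] and the bound on slot values combine to [B^2 u^2 <= ||a_i||_2^2 / kappa] for
    every entry. *)
Lemma wvar_total i c : (i < n)%N ->
  wvar i c (nblk i) (sbase i) <=
  2 * (rl2 i / kap) * \sum_(ptr i <= k < ptr i.+1) c k ^+ 2.
Proof.
move=> hi.
have k0 := kap_gt0 mu_min mu_gt0; have l20 := rl2_gt0 nzrows hi.
have S0 : 0 <= \sum_(ptr i <= k < ptr i.+1) c k ^+ 2.
  by apply: sumr_ge0 => k _; apply: sqr_ge0.
(* With one slot per block everything is read and the variance is 0; minimality of the block size
   bounds [B^2] only from 2 on. *)
have [b1|b1] := leqP (bsize i) 1.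
  rewrite /wvar var_from1; last by apply/eqP; rewrite eqn_leq b1 bsize_gt0.
  by rewrite !mulr_ge0 // ?invr_ge0 ltW.
have B2 : (bsize i)%:R ^+ 2 <= bsq i.
  have := bsize_loop A mu i (bsize i).-2; rewrite (_ : (bsize i).-2.+2 = bsize i); last by lia.
  by rewrite (_ : (_ < _)%N = true) => [/ltW|]; last by lia.
have l0 := rl1_gt0 nzrows hi.
have N0 : 0 < (rlen i)%:R :> R by rewrite ltr0n rlen_gt0.
rewrite /wvar -rstart_ptr; apply: (@le_trans _ _ (2 * (bsize i)%:R ^+ 2 *
    \sum_(ptr i <= k < ptr i.+1) (uval i k * c k) ^+ 2)).
  apply: var_total.
  - exact: csr_ptr_le.
  - by move=> k /andP[hk _]; rewrite rstart_mono.
  - by move=> k t hk; apply: slots.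
  - by rewrite rstart_ptr rstart_end; case: (nblkP i).
rewrite -mulrA -[X in _ <= X]mulrA ler_wpM2l //.
have -> : rl2 i / kap = bsq i * (rl1 i / (rlen i)%:R) ^+ 2.
  by rewrite /bsq; field; rewrite !gt_eqF.
rewrite -mulrA; apply: ler_pM; rewrite ?sqr_ge0 //.
  by apply: sumr_ge0 => k _; apply: sqr_ge0.
rewrite mulr_sumr; apply: ler_sum_nat => k hk.
by rewrite exprMn ler_wpM2r ?sqr_ge0 ?uval_le.
Qed.

End Rows.

(** * Update along a sampled row *)

Section Update.
Variable R : realType.
Variables (n d : nat) (A : 'M[R]_(n, d)) (b : 'cV[R]_n) (mu : R).
Implicit Types s : state R.

Local Notation ptr := (ptr A).
Local Notation cval := (cval A).
Local Notation ccol := (ccol A).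
Local Notation rlen := (rlen A).
Local Notation rl2 := (rl2 A).
Local Notation kap := (kap A mu).
Local Notation sbase := (sbase A).
Local Notation rstart := (rstart A).
Local Notation uval := (uval A).
Local Notation bsize := (bsize A mu).

Local Notation ready := (ready A b mu).
Local Notation nblk := (nblk A mu).
Hypothesis nzrows : forall i : 'I_n, row i A != 0.
Hypothesis mu_min : is_smallest_eigenvalue (A^T *m A) mu.
Hypothesis mu_gt0 : 0 < mu.
Variables (P : program) (Ev : state R -> Prop) (T : nat).

Definition wslot tk i (c : nat -> R) := slot_val (rstart i) tk (ptr i.+1)
  (fun k => uval i k * c k).

Lemma wquad_step tk i c (p0 p1 p2 x : R) m p :
  (\sum_(r < bsize i) (p0
     + p1 * (x + (bsize i)%:R * wslot tk i c (p + r) + wmean A mu tk i c m (p + bsize i))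
     + p2 * ((x + (bsize i)%:R * wslot tk i c (p + r)
                + wmean A mu tk i c m (p + bsize i)) ^+ 2
             + wvar A mu tk i c m (p + bsize i)))) / (bsize i)%:R =
  p0 + p1 * (x + wmean A mu tk i c m.+1 p)
     + p2 * ((x + wmean A mu tk i c m.+1 p) ^+ 2 + wvar A mu tk i c m.+1 p).
Proof.
have := quad_blk (rstart i) tk (ptr i.+1) (fun k => uval i k * c k) (bsize_gt0 A mu i)
  (p0 + p2 * wvar A mu tk i c m (p + bsize i)) p1 p2
  (x + wmean A mu tk i c m (p + bsize i)) p.
rewrite -/(wslot _ _ _) /= => h.
rewrite (eq_bigr (fun r : 'I_(bsize i) => p0 + p2 * wvar A mu tk i c m (p + bsize i)
  + p1 * (x + wmean A mu tk i c m (p + bsize i) + (bsize i)%:R * wslot tk i c (p + r))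
  + p2 * (x + wmean A mu tk i c m (p + bsize i)
     + (bsize i)%:R * wslot tk i c (p + r)) ^+ 2)); last by move=> r _; ring.
rewrite h /wmean /wvar /=; ring.
Qed.

Definition rdot i (x : nat -> R) := \sum_(ptr i <= k < ptr i.+1) cval k * x (ccol k).

Lemma sum_col_le i (x : nat -> R) : (i < n)%N ->
  \sum_(ptr i <= k < ptr i.+1) x (ccol k) ^+ 2 <= \sum_(j < d) x j ^+ 2.
Proof.
move=> hi.
(* The test for 0 is vacuous on stored entries and makes the summand vanish on zero entries, as
   [csr_sum] requires. *)
have -> : \sum_(ptr i <= k < ptr i.+1) x (ccol k) ^+ 2 =
   \sum_(ptr i <= k < ptr i.+1) (fun j a => if a == 0 then 0 else x j ^+ 2) (ccol k) (cval k).
  by rewrite !big_nat; apply: eq_bigr => k hk /=; rewrite (negbTE (cval_neq0 hi hk)).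
rewrite (@csr_sum R n d A R (fun j a => if a == 0 then 0 else x j ^+ 2) (Ordinal hi)) //.
  by apply: ler_sum => j _; case: ifP => // _; apply: sqr_ge0.
by move=> j; rewrite eqxx.
Qed.

Lemma sum_col_eq i k : (i < n)%N -> (ptr i <= k < ptr i.+1)%N ->
  \sum_(j < d) (ccol k == j)%:R = 1 :> R.
Proof.
move=> hi hk; have hc := ccol_lt hi hk.
rewrite (bigD1 (Ordinal hc)) //= eqxx big1 ?addr0 // => j /negbTE.
by rewrite -val_eqE /= eq_sym => ->.
Qed.

(* This is where [d <= kap] enters. *)
Lemma sum_wvar_le tk i (g : R) : (i < n)%N ->
  (forall i k t, (i < n)%N -> (ptr i <= k < ptr i.+1)%N ->
     (rstart i k <= t < rstart i k.+1)%N -> tk t = k) ->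
  \sum_(j < d) wvar A mu tk i (fun k => g * (ccol k == j)%:R) (nblk i) (sbase i)
  <= 2 * rl2 i * g ^+ 2.
Proof.
move=> hi slots; have k0 := kap_gt0 mu_min mu_gt0; have l20 := rl2_gt0 nzrows hi.
apply: (@le_trans _ _ (\sum_(j < d) 2 * (rl2 i / kap) *
   \sum_(ptr i <= k < ptr i.+1) g ^+ 2 * (ccol k == j)%:R)).
  apply: ler_sum => j _; apply: le_trans (wvar_total nzrows slots mu_min mu_gt0 _ hi) _.
  apply: ler_wpM2l; first by rewrite mulr_ge0 // divr_ge0 // ltW.
  apply: ler_sum_nat => k hk.
  by rewrite exprMn; case: eqP; rewrite ?expr1n ?expr0n.
rewrite -mulr_sumr exchange_big /=.
have -> : \sum_(ptr i <= k < ptr i.+1) \sum_(j < d) g ^+ 2 * (ccol k == j)%:R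
   = (rlen i)%:R * g ^+ 2.
  rewrite -sumr_nat_const !big_nat; apply: eq_bigr => k hk.
  by rewrite -mulr_sumr (sum_col_eq hi) // mulr1.
have N1 : (rlen i)%:R / kap <= 1.
  rewrite ler_pdivrMr // mul1r; apply: le_trans (kap_ge mu_min mu_gt0).
  by rewrite ler_nat (row_size_le A (Ordinal hi)).
have -> : 2 * (rl2 i / kap) * ((rlen i)%:R * g ^+ 2)
   = 2 * rl2 i * g ^+ 2 * ((rlen i)%:R / kap) by field; rewrite gt_eqF.
by rewrite ler_piMr // mulr_ge0 ?sqr_ge0 // mulr_ge0 // ltW.
Qed.

Definition update_cells : seq (nat * nat) :=
  [:: (0, 7); (0, 11); (0, 12); (0, 10); (0, 3); (0, 13); (1, 18); (1, 16); (1, 12);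
      (1, 23); (1, 17); (3, 5)]%N.

Lemma ready_sbase i s : ready s -> (i < n)%N -> narr s 2 i = sbase i.
Proof.
move=> rs; case: i => [|i] hi; first by rewrite (ready_base rs) /sbase big_geq.
exact: (row_end (ready_rows rs (ltnW hi))).
Qed.

Lemma slot_entry tk i t : (i < n)%N -> (sbase i <= t < sbase i.+1)%N ->
  (forall i k t, (i < n)%N -> (ptr i <= k < ptr i.+1)%N ->
     (rstart i k <= t < rstart i k.+1)%N -> tk t = k) ->
  (ptr i <= tk t < ptr i.+1)%N.
Proof.
move=> hi ht slots.
have [k hk h] : exists2 k, (ptr i <= k < ptr i.+1)%N &
    (rstart i k <= t < rstart i k.+1)%N.
  by apply: find_run; rewrite ?rstart_ptr ?rstart_end //; apply: csr_ptr_le.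
by rewrite (slots i k t hi hk h).
Qed.

(** [r] is a fixed shift; later it holds the error at the start of the epoch and the multiple of the
    gradient. The 3 is one part squared mean and two parts variance. *)
Lemma sem_axpy i s (K : state R -> R -> Prop) (r : nat -> R) a c0 g :
  (i < n)%N -> ready s -> 0 <= a ->
  nreg s 7 = bsize i -> nreg s 11 = sbase i -> nreg s 12 = sbase i.+1 ->
  rreg s 17 = g * (bsize i)%:R ->
  (forall s', agree update_cells s s' ->
     K s' (a * (\sum_(j < d) (rarr s' 5 j + r j) ^+ 2) + c0)) ->
  sem P Ev T (sampling (Blk axpy_code)) s K
    (a * (\sum_(j < d) (rarr s 5 j + r j) ^+ 2
        - 2 * g * rdot i (fun j => rarr s 5 j + r j) + 3 * rl2 i * g ^+ 2) + c0
     + 13 * (nblk i)%:R + 2).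
Proof.
move=> hi rs a0 e7 e11 e12 e17 HK.
set L := [:: (0, 10); (0, 3); (0, 11); (0, 13); (1, 12); (1, 23); (3, 5)]%N.
pose tk := narr s 4; pose y := rarr s 5.
have slots i' k t : (i' < n)%N -> (ptr i' <= k < ptr i'.+1)%N ->
     (rstart i' k <= t < rstart i' k.+1)%N -> tk t = k.
  by move=> h; apply: (row_slot (ready_rows rs h)).
(* Coordinate [j] sees the sampled vector through an indicator and has its own mean and variance;
   [phi] sums the second moments. *)
pose c (j : nat) k := - g * (ccol k == j)%:R.
pose Inv s' (y' : nat -> R) := agree L s s' /\ rarr s' 5 = y'.
pose up (y' : nat -> R) k := upd y' (ccol k)
  (y' (ccol k) - uval i k * (g * (bsize i)%:R)).
pose phi m p (y' : nat -> R) := a * (\sum_(j < d) ((y' j + r j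
   + wmean A mu tk i (c j) m p) ^+ 2 + wvar A mu tk i (c j) m p)) + c0.
have [nb1 nb2] := nblkP A mu i.
apply: (@sem_le _ _ _ _ _ _ _ (phi (nblk i) (sbase i) y
   + (7 + (size axpy_code)%:R) * (nblk i)%:R + 2)).
  apply: (@sem_sampling _ P Ev T _ axpy_code Inv (bsize i) (sbase i.+1) (sbase i) tk up)
    => //.
  - move=> s1 y1 s2 ag [ag1 e1]; split; last by rewrite (agreeRA ag).
    by apply: agree_trans ag1 (agree_sub _ ag).
  - by move=> s1 y1 [ag _]; rewrite !(agreeN ag) // (agreeNA ag).
  - move=> s1 y1 t ht e3 [ag e1]; have rs1 : ready s1 by apply: ready_agree ag rs.
    split=> //; split; first by agree_blk.
    rewrite /= e3 (env_col (ready_env rs1)) e1 (agreeR ag) // e17.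
    by rewrite (row_uval (ready_rows rs1 hi)) // slot_entry.
  - move=> m p y1.
    rewrite /phi big_split /= sumr_const card_ord mulrDl -(mulr_natr c0).
    rewrite mulfK ?pnatr_eq0 //; congr (_ + _).
    rewrite -mulr_sumr -mulrA; congr (_ * _).
    rewrite exchange_big /= mulr_suml; apply: eq_bigr => j _.
    have := wquad_step tk i (c j) 0 0 1 (y1 j + r j) m p.
    rewrite !mul0r !add0r !mul1r => <-; congr (_ / _); apply: eq_bigr => q _.
    rewrite !mul0r !add0r mul1r; congr ((_ + _) ^+ 2 + _).
    rewrite /wslot /slot_val rstart_end /up; case: ifP => _; last by rewrite mulr0 addr0.
    rewrite /c /= [j == _ :> nat]eq_sym; case: eqP => [->|_]; last by rewrite !mulr0 addr0.
    by rewrite mulr1; ring.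
  - move=> s1 y1 p [ag e1]; rewrite -e1.
    have -> : phi 0%N p (rarr s1 5) = a * (\sum_(j < d) (rarr s1 5 j + r j) ^+ 2) + c0.
      by rewrite /phi; congr (_ * _ + _); apply: eq_bigr => j _; rewrite /= !addr0.
    apply: HK; exact: agree_sub ag.
rewrite /= !lerD2r.
have -> : 7 + 6 = 13 :> R by lra.
rewrite !lerD2r ler_wpM2l //.
have mean j : wmean A mu tk i (c j) (nblk i) (sbase i)
    = - g * \sum_(ptr i <= k < ptr i.+1) cval k * (ccol k == j)%:R.
  rewrite wmean_total // mulr_sumr; apply: eq_bigr => k _; rewrite /c; ring.
have var := sum_wvar_le (- g) hi slots; rewrite sqrrN in var.
have rowE (j : 'I_d) : \sum_(ptr i <= k < ptr i.+1) cval k * (ccol k == j)%:R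
    = A (Ordinal hi) j.
  rewrite (@csr_sum R n d A R (fun q a => a * (q == j :> nat)%:R) (Ordinal hi)).
    rewrite (bigD1 j) //= eqxx mulr1 big1 ?addr0 // => q /negbTE.
    by rewrite -val_eqE /= => ->; rewrite mulr0.
  by move=> q; rewrite mul0r.
rewrite big_split /=.
have -> : \sum_(j < d) (y j + r j + wmean A mu tk i (c j) (nblk i) (sbase i)) ^+ 2
   = \sum_(j < d) (y j + r j) ^+ 2 - 2 * g * rdot i (fun j => y j + r j)
     + rl2 i * g ^+ 2.
  rewrite /rdot (@csr_sum R n d A R (fun q a => a * (y q + r q)) (Ordinal hi)); last first.
    by move=> q; rewrite mul0r.
  rewrite (rl2_row A (Ordinal hi)) mulr_suml mulr_sumr -sumrB -big_split /=.
  by apply: eq_bigr => j _; rewrite mean rowE; ring.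
rewrite -/y /c in var *.
by lra.
Qed.

End Update.

(** * One inner step *)

Definition body :=
  Sq (Rnd 10 6)
  (Sq (Blk [:: NLoad 2 5 10; RLoad 10 7 2])
  (Sq (IfR 10 update) (Blk [:: RAdd 13 13 14]))).

Section Body.
Variable R : realType.
Variables (n d : nat) (A : 'M[R]_(n, d)) (b : 'cV[R]_n) (mu : R).
Implicit Types s : state R.

Local Notation ptr := (ptr A).
Local Notation ccol := (ccol A).
Local Notation rl2 := (rl2 A).
Local Notation fro := (fro A).
Local Notation kap := (kap A mu).
Local Notation sbase := (sbase A).
Local Notation rstart := (rstart A).
Local Notation uval := (uval A).
Local Notation bsize := (bsize A mu).
Local Notation rwt := (rwt A).
Local Notation rtick := (rtick A).

Local Notation ready := (ready A b mu).
Local Notation stepsize := (stepsize A).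
Local Notation nblk := (nblk A mu).
Local Notation rdot := (rdot A).
Hypothesis nzrows : forall i : 'I_n, row i A != 0.
Hypothesis mu_min : is_smallest_eigenvalue (A^T *m A) mu.
Hypothesis mu_gt0 : 0 < mu.
Variables (P : program) (Ev : state R -> Prop) (T : nat).

Definition disp s j : R := rarr s 5 j - rreg s 13 * rarr s 4 j.

(** For a fixed estimate [x] of the inner product, [sem_axpy] bounds the second pass by a quadratic
    in [x]; this is the final charge of the first pass, which averages it through mean and variance
    of the estimate. *)
Lemma sem_update i s (K : state R -> R -> Prop) (r : nat -> R) a c0 si :
  (i < n)%N -> ready s -> 0 <= a -> nreg s 2 = i -> si = stepsize * (rtick n)%:R / rwt i ->
  (forall s', agree update_cells s s' ->
     K s' (a * (\sum_(j < d) (rarr s' 5 j + r j) ^+ 2) + c0)) ->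
  sem P Ev T update s K
    (a * (\sum_(j < d) (rarr s 5 j + r j) ^+ 2
       - 2 * si * rdot i (fun j => rarr s 5 j + r j) * rdot i (disp s)
       + 3 * rl2 i * si ^+ 2 *
         (rdot i (disp s) ^+ 2 + 2 * (rl2 i / kap) * \sum_(j < d) disp s j ^+ 2)) + c0
     + 29 * (nblk i)%:R + 16).
Proof.
move=> hi rs a0 e2 esi HK; have es := ready_env rs; have row := ready_rows rs hi.
apply: sem_Sq; apply: sem_Blk => //; set s1 := run _ s.
have ag1 : agree [:: (0, 7); (1, 18); (0, 11); (0, 12); (1, 16)]%N s s1 by agree_blk.
have rs1 : ready s1 by apply: ready_agree ag1 rs.
have e71 : nreg s1 7 = bsize i by rewrite /= e2 (row_bsize row).
have e181 : rreg s1 18 = (bsize i)%:R by rewrite /= e2 (row_bsize row).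
have e111 : nreg s1 11 = sbase i by rewrite /= e2 (ready_sbase rs).
have e121 : nreg s1 12 = sbase i.+1 by rewrite /= e2 (env_1 es) addn1 (row_end row).
have e161 : rreg s1 16 = 0 by rewrite /= (env_0 es) addr0.
clearbody s1.
set Y := \sum_(j < d) (rarr s 5 j + r j) ^+ 2.
set RY := rdot i (fun j => rarr s 5 j + r j); set V := \sum_(j < d) disp s j ^+ 2.
set L := [:: (0, 10); (0, 3); (0, 11); (0, 13); (1, 12); (1, 23); (1, 16)]%N.
pose tk := narr s1 4.
have slots i' k t : (i' < n)%N -> (ptr i' <= k < ptr i'.+1)%N ->
     (rstart i' k <= t < rstart i' k.+1)%N -> tk t = k.
  by move=> h; apply: (row_slot (ready_rows rs1 h)).
pose c k := disp s (ccol k).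
pose Inv s' (x : R) := agree L s1 s' /\ rreg s' 16 = x.
pose up (x : R) k := x + (bsize i)%:R * (uval i k * c k).
(* The coefficients of that quadratic; 8 counts the six instructions between the passes and the exit
   of the second loop. *)
pose p0 := a * Y + c0 + 13 * (nblk i)%:R + 8.
pose p1 := - 2 * a * si * RY; pose p2 := 3 * a * rl2 i * si ^+ 2.
pose phi m p (x : R) := p0 + p1 * (x + wmean A mu tk i c m p)
   + p2 * ((x + wmean A mu tk i c m p) ^+ 2 + wvar A mu tk i c m p).
have [nb1 nb2] := nblkP A mu i.
apply: sem_Sq.
apply: (@sem_le _ _ _ _ _ _ _ (phi (nblk i) (sbase i) 0
   + (7 + (size dot_code)%:R) * (nblk i)%:R + 2)).
  apply: (@sem_sampling _ P Ev T _ dot_code Inv (bsize i) (sbase i.+1) (sbase i) tk up)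
    => //.
  - move=> s2 y2 s3 ag [ag2 e3]; split; last by rewrite (agreeR ag).
    by apply: agree_trans ag2 (agree_sub _ ag).
  - by move=> s2 y2 [ag _]; rewrite !(agreeN ag) // (agreeNA ag).
  - move=> s2 y2 t ht e3 [ag e162]; have rs2 : ready s2 by apply: ready_agree ag rs1.
    split=> //; split; first by agree_blk.
    rewrite /= e3 (env_col (ready_env rs2)) e162 !(agreeR ag) // e181.
    rewrite (row_uval (ready_rows rs2 hi)) ?slot_entry // !(agreeRA ag) //.
    rewrite (agreeR ag1) // !(agreeRA ag1) // -/(disp s (ccol (tk t))) -/(c (tk t)).
    by rewrite /up; congr (_ + _); ring.
  - move=> m p x; rewrite /phi -wquad_step; congr (_ / _); apply: eq_bigr => q _.
    rewrite /wslot /slot_val rstart_end /up; case: ifP => _; last by rewrite mulr0 addr0.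
    by [].
  - move=> s2 x p [ag e162]; have rs2 : ready s2 by apply: ready_agree ag rs1.
    have -> : phi 0%N p x = p0 + p1 * x + p2 * x ^+ 2.
      by rewrite /phi /wmean /wvar /= !addr0.
    apply: sem_Sq; apply: sem_Blk => //; set s3 := run _ s2.
    have ag3 : agree [:: (1, 12); (1, 17); (0, 11)]%N s2 s3 by agree_blk.
    have i2 : nreg s2 2 = i by rewrite (agreeN ag) // (agreeN ag1).
    have rs3 : ready s3 by apply: ready_agree ag3 rs2.
    have e73 : nreg s3 7 = bsize i by rewrite (agreeN ag3) // (agreeN ag).
    have e113 : nreg s3 11 = sbase i by rewrite /= i2 (ready_sbase rs2).
    have e123 : nreg s3 12 = sbase i.+1 by rewrite (agreeN ag3) // (agreeN ag).
    have e173 : rreg s3 17 = x * si * (bsize i)%:R.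
      rewrite /= e162 (ready_eta rs2) (ready_MR rs2) i2 (row_wt (ready_rows rs2 hi)).
      by rewrite (agreeR ag) // e181 esi !mulrA.
    have y3 : rarr s3 5 = rarr s 5 by rewrite (agreeRA ag3) // (agreeRA ag) // (agreeRA ag1).
    clearbody s3.
    apply: (sem_le (sem_axpy nzrows mu_min mu_gt0 hi rs3 a0 e73 e113 e123 e173 _)).
      move=> s4 ag4; apply: HK.
      apply: agree_trans (agree_sub _ ag1) _ => //.
      apply: agree_trans (agree_sub _ ag) _ => //.
      by apply: agree_trans (agree_sub _ ag3) ag4.
    by rewrite y3 -/Y -/RY /p0 /p1 /p2 /=; lra.
rewrite /= /phi wmean_total // !add0r -/(rdot i (disp s)).
have var := wvar_total nzrows slots mu_min mu_gt0 c hi.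
have l20 := rl2_gt0 nzrows hi; have k0 := kap_gt0 mu_min mu_gt0.
have {}var : wvar A mu tk i c (nblk i) (sbase i) <= 2 * (rl2 i / kap) * V.
  apply: le_trans var _; apply: ler_wpM2l; first by rewrite mulr_ge0 // divr_ge0 // ltW.
  exact: (@sum_col_le _ _ _ A i (disp s) hi).
have p20 : 0 <= p2.
  apply: mulr_ge0 (sqr_ge0 _); apply: mulr_ge0 (ltW l20); exact: mulr_ge0.
have := ler_wpM2l p20 var.
rewrite /p0 /p1 /p2; set DV := rdot i (disp s).
set W := wvar _ _ _ _ _ _ _; set q := rl2 i / kap.
lra.
Qed.

Definition body_cells : seq (nat * nat) :=
  update_cells ++ [:: (0, 2); (1, 10); (1, 13)]%N.

Definition step_cost : R := 6 + \sum_(0 <= i < n) rl2 i / fro * (29 * (nblk i)%:R + 15).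

(** With [M] row slots, row [i] is kept with probability [rwt i / M], which cancels [1 / p_i] in the
    linear term. The quadratic term keeps a factor [M / n <= 2], turning 3 into 6; the time gets a
    factor [n / M <= 1]. *)
Lemma sem_body s (K : state R -> R -> Prop) (r : nat -> R) a c0 :
  ready s -> 0 <= a ->
  (forall s', agree body_cells s s' -> rreg s' 13 = rreg s 13 + stepsize ->
     K s' (a * (\sum_(j < d) (rarr s' 5 j + r j) ^+ 2) + c0)) ->
  sem P Ev T body s K
    (a * (\sum_(j < d) (rarr s 5 j + r j) ^+ 2
       - 2 * stepsize * (\sum_(0 <= i < n)
            rdot i (fun j => rarr s 5 j + r j) * rdot i (disp s))
       + 6 * stepsize ^+ 2 * fro * (\sum_(0 <= i < n)
         (rdot i (disp s) ^+ 2 + 2 * (rl2 i / kap) * \sum_(j < d) disp s j ^+ 2))) + c0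
     + step_cost).
Proof.
move=> rs a0 HK; have es := ready_env rs.
set Y := \sum_(j < d) (rarr s 5 j + r j) ^+ 2.
set V := \sum_(j < d) disp s j ^+ 2.
pose RY i := rdot i (fun j => rarr s 5 j + r j).
pose M : R := (rtick n)%:R.
have F0 := fro_gt0 mu_min mu_gt0; have N0 := n_gt0 mu_min mu_gt0.
have n0 : 0 < n%:R :> R by rewrite ltr0n.
have Mn : n%:R <= M by exact: (rtick_ge nzrows mu_min mu_gt0).
have M2 : M <= 2 * n%:R by rewrite -natrM ler_nat (rtick_le nzrows mu_min mu_gt0).
have M0 : 0 < M by apply: lt_le_trans Mn.
pose si i := stepsize * M / rwt i.
pose D i : R := a * (- 2 * si i * RY i * rdot i (disp s) + 3 * rl2 i * si i ^+ 2 *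
         (rdot i (disp s) ^+ 2 + 2 * (rl2 i / kap) * V)) + 29 * (nblk i)%:R + 15.
pose f i : R := 4 + (a * Y + c0 + 1) + rwt i / (ceiln (rwt i))%:R * D i.
have rt0 : rtick 0 = 0%N by rewrite /rtick big_geq.
apply: sem_Sq.
apply: (@sem_le _ _ _ _ _ _ _ (1 + (\sum_(t < rtick n) f (narr s 5 t)) / (rtick n)%:R)).
  apply: (@sem_Rnd _ P Ev T 10 6 s _ (rtick n) (fun t => f (narr s 5 t))).
  - exact: (ready_M rs).
  - by rewrite -(ltr0n R).
  move=> t ht.
  have [i hi hti] : exists2 i, (0 <= i < n)%N & (rtick i <= t < rtick i.+1)%N.
    by apply: find_run; rewrite ?rt0.
  have {}hi : (i < n)%N by [].
  have row := ready_rows rs hi.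
  have ti : narr s 5 t = i by apply: (row_tick row).
  apply: sem_Sq; apply: sem_Blk => //; set s1 := run _ _.
  have ag1 : agree body_cells s s1 by agree_blk; apply: agree_set_nreg.
  have rs1 : ready s1 by apply: ready_agree ag1 rs.
  have i1 : nreg s1 2 = i by rewrite /= ti.
  have e101 : rreg s1 10 = rwt i / (ceiln (rwt i))%:R by rewrite /= ti (row_acc row).
  have y1 : rarr s1 5 = rarr s 5 by [].
  have a1 : rreg s1 13 = rreg s 13 by [].
  have g1 : rarr s1 4 = rarr s 4 by [].
  clearbody s1.
  have w0 := rwt_gt0 nzrows mu_min mu_gt0 hi.
  have c1 : rwt i <= (ceiln (rwt i))%:R by apply: ceiln_ge.
  have acc01 : 0 <= rreg s1 10 <= 1.
    rewrite e101; apply/andP; split; first by apply: divr_ge0 => //; apply: ltW.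
    by rewrite ler_pdivrMr ?mul1r // (lt_le_trans w0).
  have last s' : agree body_cells s s' -> rreg s' 13 = rreg s 13 ->
     sem P Ev T (Blk [:: RAdd 13 13 14]) s' K
       (a * (\sum_(j < d) (rarr s' 5 j + r j) ^+ 2) + (c0 + 1)).
    move=> ag e13; apply: sem_Blk => //.
    rewrite /= addrA addrK.
    apply: (HK (run [:: RAdd 13 13 14] s')); first by agree_blk.
    have rs' : ready s' by apply: ready_agree ag rs.
    by rewrite /= e13 (ready_eta rs').
  apply: sem_Sq.
  have upd := sem_update hi rs1 a0 i1 (erefl (si i)).
  have {}upd := upd (fun s' w' => sem P Ev T (Blk [:: RAdd 13 13 14]) s' K w') r (c0 + 1).
  have key := @sem_IfR _ P Ev T 10 update s1
    (fun s' w' => sem P Ev T (Blk [:: RAdd 13 13 14]) s' K w') _ _ acc01 (upd _)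
    (last s1 ag1 a1).
  apply: sem_le (key _) _.
    move=> s' ag'; apply: last; last by rewrite (agreeR ag').
    by apply: agree_trans ag1 (agree_sub _ ag').
  have -> : disp s1 = disp s by apply: funext => j; rewrite /disp y1 a1 g1.
  rewrite y1 -/Y -/V e101 ti /f /D -/(RY i).
  set acc := rwt i / _; set q := rl2 i / kap.
  by rewrite /=; lra.
have -> : \sum_(t < rtick n) f (narr s 5 t) = \sum_(0 <= i < n) (ceiln (rwt i))%:R * f i.
  rewrite -(big_mkord xpredT (fun t => f (narr s 5 t))).
  transitivity (\sum_(0 <= i < n) \sum_(rtick i <= t < rtick i.+1) f i).
    rewrite -[X in \sum_(X <= _ < _) _ = _]rt0.
    apply: (@runs_sum _ rtick (narr s 5) 0 n _ _ _ (fun i _ => f i)) => //.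
    - by move=> i _; rewrite rtick_mono.
    - by move=> i t hi; apply: (row_tick (ready_rows rs hi)).
  apply: eq_bigr => i _; rewrite big_const_nat iter_addr_0 mulr_natl.
  by rewrite {1}/rtick big_nat_recr //= addKn.
have -> : \sum_(0 <= i < n) (ceiln (rwt i))%:R * f i
   = M * (4 + (a * Y + c0 + 1)) + \sum_(0 <= i < n) rwt i * D i.
  rewrite /M /rtick natr_sum mulr_suml -big_split /= !big_nat; apply: eq_bigr => i hi.
  have w0 := rwt_gt0 nzrows mu_min mu_gt0 hi.
  have c1 : 0 < (ceiln (rwt i))%:R :> R by rewrite ltr0n ceiln_gt0.
  by rewrite /f; field; rewrite gt_eqF.
rewrite -/M mulrDl [M * _]mulrC mulfK ?gt_eqF // mulr_suml.
have -> : 6 * stepsize ^+ 2 * fro * (\sum_(0 <= i < n)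
         (rdot i (disp s) ^+ 2 + 2 * (rl2 i / kap) * V)) = \sum_(0 <= i < n)
   6 * stepsize ^+ 2 * fro * (rdot i (disp s) ^+ 2 + 2 * (rl2 i / kap) * V).
  by rewrite mulr_sumr.
rewrite mulr_sumr /step_cost.
suff : \sum_(0 <= i < n) (rwt i * D i / M) <= a * (- \sum_(0 <= i < n)
   2 * stepsize * (RY i * rdot i (disp s)) + \sum_(0 <= i < n)
   6 * stepsize ^+ 2 * fro * (rdot i (disp s) ^+ 2 + 2 * (rl2 i / kap) * V))
   + \sum_(0 <= i < n) rl2 i / fro * (29 * (nblk i)%:R + 15).
  set S1 := \sum_(_ <= _ < _) _; set S2 := \sum_(_ <= _ < _) _.
  set S3 := \sum_(_ <= _ < _) _; set S4 := \sum_(_ <= _ < _) _; lra.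
rewrite -sumrN -big_split /= mulr_sumr -big_split /=; apply: ler_sum_nat => i hi.
have {}hi : (i < n)%N by [].
have w0 := rwt_gt0 nzrows mu_min mu_gt0 hi; have l20 := rl2_gt0 nzrows hi.
have k0 := kap_gt0 mu_min mu_gt0.
have -> : rwt i * D i / M = a * (- (2 * stepsize * (RY i * rdot i (disp s)))
   + 3 * stepsize ^+ 2 * fro * (M / n%:R) *
      (rdot i (disp s) ^+ 2 + 2 * (rl2 i / kap) * V))
   + rl2 i / fro * (29 * (nblk i)%:R + 15) * (n%:R / M).
  rewrite /D /si /rwt; field.
  by rewrite !gt_eqF.
have V0 : 0 <= V by apply: sumr_ge0 => j _; apply: sqr_ge0.
apply: lerD.
  apply: ler_wpM2l => //; rewrite lerD2l; apply: ler_wpM2r.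
    apply: addr_ge0 (sqr_ge0 _) _; apply: mulr_ge0 V0; apply: mulr_ge0 => //.
    by apply: divr_ge0; exact: ltW.
  have r2 : M / n%:R <= 2 by rewrite ler_pdivrMr.
  have e0 : 0 <= stepsize ^+ 2 * fro by rewrite mulr_ge0 ?sqr_ge0 // ltW.
  by have := ler_wpM2l e0 r2; lra.
rewrite ler_piMr ?ler_pdivrMr ?mul1r //.
by apply: mulr_ge0; [apply: divr_ge0; exact: ltW|rewrite addr_ge0 ?mulr_ge0].
Qed.

End Body.

(** * Contraction over an epoch *)

Definition epoch :=
  Sq (Blk [:: RAdd 19 19 19])
  (Sq gradient
  (Sq (Blk [:: RAdd 13 24 24])
  (Sq (LoopR 15 body) finish))).

Section Epoch.
Variable R : realType.
Variables (n d : nat) (A : 'M[R]_(n, d)) (b : 'cV[R]_n) (mu : R).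
Implicit Types s : state R.

Local Notation ptr := (ptr A).
Local Notation rl2 := (rl2 A).
Local Notation fro := (fro A).
Local Notation kap := (kap A mu).

Local Notation ready := (ready A b mu).
Local Notation stepsize := (stepsize A).
Local Notation stop_prob := (stop_prob A mu).
Local Notation rdot := (rdot A).
Local Notation step_cost := (step_cost A mu).
Local Notation xs := (opt A b).

Definition vec (f : nat -> R) : 'cV[R]_d := \col_j f j.

Definition dotv m (x y : 'cV[R]_m) : R := \sum_i x i 0 * y i 0.

Lemma dotvE m (x y : 'cV[R]_m) : dotv x y = (x^T *m y) 0 0.
Proof. by rewrite mxE; apply: eq_bigr => i _; rewrite mxE. Qed.

Lemma dotv_adj (x y : 'cV[R]_d) : dotv (A *m x) (A *m y) = dotv x (A^T *m (A *m y)).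
Proof. by rewrite !dotvE trmx_mul -mulmxA. Qed.

Lemma nsq_dotv m (x : 'cV[R]_m) : nsq x = dotv x x.
Proof. by apply: eq_bigr => i _; rewrite expr2. Qed.

Lemma nsq_subZ m (x y : 'cV[R]_m) (h : R) :
  nsq (x - h *: y) = nsq x - 2 * h * dotv x y + h ^+ 2 * nsq y.
Proof.
rewrite /nsq /dotv !mulr_sumr -sumrB -big_split /=; apply: eq_bigr => i _.
by rewrite !mxE; ring.
Qed.

Lemma rdotE (i : 'I_n) f : rdot i f = (A *m vec f) i 0.
Proof.
rewrite /rdot (@csr_sum R n d A R (fun q a => a * f q) i); last by move=> j; rewrite mul0r.
by rewrite mxE; apply: eq_bigr => j _; rewrite mxE.
Qed.

Lemma grad_uptoE z (j : 'I_d) :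
  grad_upto A b n z j = (A^T *m (A *m vec z - b)) j 0.
Proof.
rewrite /grad_upto big_mkord mxE; apply: eq_bigr => i _.
rewrite (@csr_sum R n d A R (fun q a => (q == j :> nat)%:R * (a * residual A b z i)) i);
  last by move=> q; rewrite mul0r mulr0.
rewrite (bigD1 j) //= eqxx mul1r big1 ?addr0.
  rewrite mxE [in RHS]mxE -rdotE; congr (_ * (_ + _)).
  by rewrite mxE /vec_cells (valK i).
by move=> q /negbTE; rewrite -val_eqE /= => ->; rewrite mul0r.
Qed.

Hypothesis nzrows : forall i : 'I_n, row i A != 0.
Hypothesis mu_min : is_smallest_eigenvalue (A^T *m A) mu.
Hypothesis mu_gt0 : 0 < mu.

Lemma stepsizeF : stepsize * fro = 1 / 300.
Proof.
have F0 := fro_gt0 mu_min mu_gt0; rewrite /stepsize; field.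
by rewrite gt_eqF.
Qed.

Lemma stepsize_gt0 : 0 < stepsize.
Proof. by rewrite divr_gt0 // mulr_gt0 // (fro_gt0 mu_min mu_gt0). Qed.

(* The left-hand side is the bound on the expected squared distance to the    *)
(* optimum that [sem_body] gives.                                             *)
Lemma step_bound (e0 v : 'cV[R]_d) (h := stepsize) (e := e0 + v)
    (w := e - h *: (A^T *m (A *m e0))) :
  nsq w - 2 * h * dotv (A *m w) (A *m v)
    + 6 * h ^+ 2 * fro * (nsq (A *m v) + 2 * mu * nsq v) <=
  nsq e - h * nsq (A *m e) + 36 * h ^+ 2 * fro * nsq (A *m e0).
Proof.
have F0 := fro_gt0 mu_min mu_gt0; have h0 := stepsize_gt0; have hF := stepsizeF.
rewrite -/h in h0 hF.
(* Adding the squared norm of [h A^T A v] completes the left-hand side to that of [w - h A^T A v],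
   the exact gradient step from [e], since [e = e0 + v]. *)
have e1 : nsq w - 2 * h * dotv (A *m w) (A *m v) <=
    nsq e - 2 * h * nsq (A *m e) + h ^+ 2 * (fro * nsq (A *m e)).
  apply: (@le_trans _ _ (nsq (w - h *: (A^T *m (A *m v))))).
    by rewrite nsq_subZ dotv_adj lerDl mulr_ge0 ?sqr_ge0 ?nsq_ge0.
  have -> : w - h *: (A^T *m (A *m v)) = e - h *: (A^T *m (A *m e)).
    by rewrite /w -addrA -opprD -scalerDr -!mulmxDr.
  rewrite nsq_subZ -dotv_adj -nsq_dotv lerD2l ler_wpM2l ?sqr_ge0 //.
  by rewrite fro_frob; exact: nsq_tr_mul.
(* Variance reduction: the noise scales with the displacement, which the current and the initial
   error control. *)
have e2 : nsq (A *m v) <= 2 * nsq (A *m e) + 2 * nsq (A *m e0).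
  have -> : A *m v = A *m e - A *m e0 by rewrite -mulmxBr /e addrAC subrr add0r.
  exact: nsqD_le.
have e3 := gram_bound mu_min v.
have hh : h ^+ 2 * fro = h / 300 by rewrite expr2 -mulrA hF; lra.
have := nsq_ge0 (A *m e) => e4.
have c0 : 0 <= h / 300 by apply: divr_ge0 => //; apply: ltW.
(* Strong convexity gives [3 |A v|^2], hence 6 for each of the two errors; [6 * 6 = 36]. *)
have e5 : h / 300 * (nsq (A *m v) + 2 * mu * nsq v) <=
   h / 300 * (6 * nsq (A *m e) + 6 * nsq (A *m e0)) by apply: ler_wpM2l => //; lra.
have e6 : 0 <= h * nsq (A *m e) by apply: mulr_ge0 => //; apply: ltW.
rewrite mulrA hh in e1.
rewrite -!(mulrA 6) -!(mulrA 36) hh; lra.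
Qed.

Variables (P : program) (Ev : state R -> Prop) (T : nat).

Lemma stop_probE : stop_prob = stepsize * mu / 8.
Proof. by []. Qed.

Lemma stop_prob_kap : stop_prob * (2400 * kap) = 1.
Proof.
have F0 := fro_gt0 mu_min mu_gt0.
by rewrite stop_probE /stepsize /kap; field; rewrite !gt_eqF.
Qed.

Lemma stop_prob_bounds : 0 < stop_prob <= 1 / 2.
Proof.
have h0 := stepsize_gt0; have k1 := kap_ge1 mu_min mu_gt0.
have p0 : 0 < stop_prob by rewrite divr_gt0 // mulr_gt0.
rewrite p0 /=; have := stop_prob_kap; nra.
Qed.

Definition err (z : nat -> R) : R := nsq (A *m (vec z - xs)).

Definition step_offset (z : nat -> R) (j : nat) : R :=
  if insub j is Some q then (vec z - xs) q 0 else 0.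

(** The potential is [a |e|^2 + c] with [a h = 2 p D]. A step lowers [a |e|^2] by [2 p D |A e|^2] up
    to noise, which pays for [D |A e|^2] being charged with probability [p]; so the value at the
    geometric time is bounded by the initial potential. *)
Lemma sem_inner s (K : state R -> R -> Prop) D k0 :
  ready s -> 0 <= D -> 0 <= k0 -> rreg s 13 = 0 ->
  (forall j, (j < d)%N -> rarr s 5 j = 0) ->
  (forall j, (j < d)%N -> rarr s 4 j = grad_upto A b n (rarr s 3) j) ->
  (forall s', agree body_cells s s' ->
     K s' (D * err (fun j => rarr s' 3 j + disp s' j) + k0)) ->
  sem P Ev T (LoopR 15 body) s K
    (D / 2 * err (rarr s 3) + k0 + 2400 * kap * (2 + step_cost)).
Proof.
move=> rs D0 k00 al0 y0 gE HK.
set e0 := vec (rarr s 3) - xs; set E0 := nsq (A *m e0).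
set h := stepsize; set p := stop_prob.
have h0 : 0 < h := stepsize_gt0.
have [p0 p2] := andP stop_prob_bounds; rewrite -/p in p0 p2.
have F0 := fro_gt0 mu_min mu_gt0; have k1 := kap_gt0 mu_min mu_gt0.
have sc0 : 0 <= step_cost.
  rewrite /step_cost addr_ge0 // sumr_ge0 // => i _.
  apply: mulr_ge0; last by rewrite addr_ge0 ?mulr_ge0.
  by apply: divr_ge0 (ltW F0); apply: sumr_ge0 => k _; apply: sqr_ge0.
have E00 : 0 <= E0 := nsq_ge0 _.
pose a := 2 * p * D / h.
have a0 : 0 <= a by apply: divr_ge0 (ltW h0); apply: mulr_ge0 => //; lra.
(* The time and the noise of a step, each multiplied by [1 / p], the order of the expected number of
   steps. *)
pose c := k0 + (2 + step_cost) / p + 36 * a * h ^+ 2 * fro * E0 / p.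
have c0 : 0 <= c.
  rewrite /c !addr_ge0 //; first by apply: divr_ge0 (ltW p0); lra.
  apply: divr_ge0 (ltW p0); apply: mulr_ge0 => //; apply: mulr_ge0 (ltW F0).
  by apply: mulr_ge0 (sqr_ge0 _); apply: mulr_ge0.
pose ee s' := e0 + vec (disp s').
pose I s' w := agree body_cells s s' /\ a * nsq (ee s') + c <= w.
have start : I s (a * nsq e0 + c).
  split=> //; rewrite /ee (_ : vec (disp s) = 0) ?addr0 //.
  by apply/matrixP => j q; rewrite !mxE /disp al0 mul0r subr0 y0.
apply: sem_le (sem_LoopR _ start) _; last first.
  (* The stopping probability [h mu / 8] makes [a = D mu / 4]. *)
  have b1 : a * nsq e0 <= D / 4 * E0.
    have -> : a = D / 4 * mu.
      by rewrite /a /p stop_probE -/h; field; rewrite gt_eqF.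
    rewrite -(mulrA (D / 4)); apply: ler_wpM2l (gram_bound mu_min _).
    exact: divr_ge0.
  (* The 300 in the step size is large enough here: [72 / 300 <= 1 / 4]. *)
  have b2 : 36 * a * h ^+ 2 * fro * E0 / p <= D / 4 * E0.
    have -> : 36 * a * h ^+ 2 * fro * E0 / p = 72 * (h * fro) * D * E0.
      by rewrite /a; field; rewrite !gt_eqF.
    rewrite stepsizeF; have := mulr_ge0 D0 E00; lra.
  have pn0 : p != 0 by rewrite gt_eqF.
  have pV : p^-1 = 2400 * kap by apply: (mulfI pn0); rewrite mulfV // stop_prob_kap.
  rewrite /c; have -> : (2 + step_cost) / p = 2400 * kap * (2 + step_cost) by rewrite mulrC pV.
  by rewrite /err -/e0 -/E0; lra.
move=> s1 w [ag le].
have rs1 : ready s1 by apply: ready_agree ag rs.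
have w0 : 0 <= w.
  by apply: le_trans le; apply: addr_ge0 => //; apply: mulr_ge0 (nsq_ge0 _).
split=> //.
set v := vec (disp s1); set e := ee s1; set wv := e - h *: (A^T *m (A *m e0)).
have errE : err (fun j => rarr s1 3 j + disp s1 j) = nsq (A *m e).
  rewrite /err; congr (nsq (_ *m _)); apply/matrixP => j q.
  by rewrite /e /ee /e0 !mxE (agreeRA ag) //; ring.
exists (D * nsq (A *m e) + k0).
exists (a * (nsq wv - 2 * h * dotv (A *m wv) (A *m v)
    + 6 * h ^+ 2 * fro * (nsq (A *m v) + 2 * mu * nsq v)) + (c + 1) + step_cost).
rewrite (ready_prob rs1) -/p; split.
- by apply/andP; split; lra.
- by rewrite -errE; apply: HK.
(* The body raises the coefficient of [g] only at its end. The shift uses the raised value from the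
   start, so the tracked vector is [wv], the error with the full-gradient part of the step already
   made. *)
- pose r j := step_offset (rarr s 3) j - (rreg s1 13 + h) * rarr s1 4 j.
  have G1 : rarr s1 4 = rarr s 4 by rewrite (agreeRA ag).
  have rE (s2 : state R) (j : 'I_d) : rarr s2 4 = rarr s1 4 ->
      rarr s2 5 j + r j = e0 j 0 + (rarr s2 5 j - (rreg s1 13 + h) * rarr s2 4 j).
    by move=> ->; rewrite /r /step_offset (valK j); ring.
  have gj (j : 'I_d) : rarr s1 4 j = (A^T *m (A *m e0)) j 0.
    rewrite G1 gE // grad_uptoE; congr (fun_of_matrix _ j 0).
    rewrite /e0 !mulmxBr; congr (_ - _).
    by rewrite (opt_normal b mu_min mu_gt0).
  have wvE (j : 'I_d) : rarr s1 5 j + r j = wv j 0.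
    rewrite rE // gj /wv; set g := A^T *m _ in gj *.
    have -> : (e - h *: g) j 0 = e0 j 0 + disp s1 j - h * g j 0.
      by rewrite /e /ee !mxE.
    by rewrite /disp gj; ring.
  have sumwv : \sum_(j < d) (rarr s1 5 j + r j) ^+ 2 = nsq wv.
    by apply: eq_bigr => j _; rewrite wvE.
  have vecwv : vec (fun j => rarr s1 5 j + r j) = wv.
    by apply/matrixP => j q; rewrite mxE wvE ord1.
  have := @sem_body R n d A b mu nzrows mu_min mu_gt0 P Ev T s1
    (fun s' w' => I s' (w' - 1)) r a (c + 1) rs1 a0 _.
  rewrite sumwv.
  have -> : \sum_(0 <= i < n) rdot i (fun j => rarr s1 5 j + r j) * rdot i (disp s1)
     = dotv (A *m wv) (A *m v).
    by rewrite big_mkord; apply: eq_bigr => i _; rewrite !rdotE vecwv.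
  have sumv : \sum_(j < d) disp s1 j ^+ 2 = nsq v.
    by apply: eq_bigr => j _; rewrite mxE.
  have -> : \sum_(0 <= i < n) (rdot i (disp s1) ^+ 2 + 2 * (rl2 i / kap)
      * \sum_(j < d) disp s1 j ^+ 2) = nsq (A *m v) + 2 * mu * nsq v.
    rewrite big_split /= sumv; congr (_ + _).
      by rewrite big_mkord; apply: eq_bigr => i _; rewrite rdotE.
    rewrite -mulr_suml -mulr_sumr -mulr_suml -fro_rows; congr (_ * _ * _).
    by rewrite /kap; field; rewrite !gt_eqF.
  apply=> s2 ag2 e13; split; first by apply: agree_trans ag ag2.
  have le2 : nsq (ee s2) <= \sum_(j < d) (rarr s2 5 j + r j) ^+ 2.
    rewrite /nsq; apply: ler_sum => j _; rewrite rE; last by rewrite (agreeRA ag2).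
    by rewrite /ee !mxE /disp e13.
  by have := ler_wpM2l a0 le2; lra.
- have sb := step_bound e0 v; rewrite -/(ee s1) -/e -/h -/wv -/E0 in sb.
  have {}sb := ler_wpM2l a0 sb.
  set X := nsq wv - _ + _ in sb *.
  apply: le_trans le.
  have q1 : (1 - p) * (a * X) <= (1 - p) *
    (a * (nsq e - h * nsq (A *m e) + 36 * h ^+ 2 * fro * E0)).
    by apply: ler_wpM2l => //; lra.
  have q2 : a * h = 2 * p * D by rewrite /a divfK // gt_eqF.
  have ne0 := nsq_ge0 e; have nA0 := nsq_ge0 (A *m e).
  have q3 : 0 <= p * a * nsq e by apply: mulr_ge0 => //; apply: mulr_ge0 => //; lra.
  have q4 : p * c = p * k0 + (2 + step_cost) + 36 * a * h ^+ 2 * fro * E0.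
    by rewrite /c; field; rewrite gt_eqF.
  (* [p <= 1 / 2]: the progress made when continuing covers the charge for stopping. *)
  have q5 : (1 - p) * (a * h) * nsq (A *m e) >= p * D * nsq (A *m e).
    by apply: ler_wpM2r => //; rewrite q2; have := mulr_ge0 (ltW p0) D0; nra.
  have q6 : 0 <= p * (36 * a * h ^+ 2 * fro * E0).
    apply: mulr_ge0 (ltW p0) _; apply: mulr_ge0 => //; apply: mulr_ge0 (ltW F0).
    by apply: mulr_ge0 (sqr_ge0 _); apply: mulr_ge0.
  have q7 : 0 <= p * step_cost by apply: mulr_ge0 => //; lra.
  set W := 36 * a * h ^+ 2 * fro * E0 in q1 q4 q6.
  have q8 : a * (nsq e - h * nsq (A *m e) + 36 * h ^+ 2 * fro * E0)
     = a * nsq e - a * h * nsq (A *m e) + W by rewrite /W; ring.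
  rewrite q8 in q1; clearbody X W; lra.
Qed.

Definition epoch_cost : R := 17 * (ptr n)%:R + 13 * n%:R + 15 * d%:R + 11
  + 2400 * kap * (2 + step_cost).

Lemma sem_epoch s (K : state R -> R -> Prop) D k0 : ready s -> 0 <= D -> 0 <= k0 ->
  (forall s', ready s' -> rreg s' 19 = rreg s 19 + rreg s 19 ->
     K s' (D * err (rarr s' 3) + k0)) ->
  sem P Ev T epoch s K (D / 2 * err (rarr s 3) + k0 + epoch_cost).
Proof.
move=> rs D0 k00 HK.
apply: sem_Sq; apply: sem_Blk => //; set s1 := run _ s.
have ag1 : agree [:: (1, 19)]%N s s1 by agree_blk.
have rs1 : ready s1 by apply: ready_agree ag1 rs.
have q1 : rreg s1 19 = rreg s 19 + rreg s 19 by [].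
have z1 : rarr s1 3 = rarr s 3 by [].
clearbody s1; apply: sem_Sq.
pose k2 : R := 10 * d%:R + 3.
apply: (@sem_le _ _ _ _ _ _ _ (D / 2 * err (rarr s 3) + (k0 + k2)
   + 2400 * kap * (2 + step_cost) + 1
   + (17 * (ptr n)%:R + 13 * n%:R + 5 * d%:R + 6))); last first.
  by rewrite /epoch_cost /k2 /=; lra.
apply: (det_gradient rs1) => s2 [ag2 g2 y2].
have rs2 : ready s2 by apply: ready_agree ag2 rs1.
apply: sem_Sq; apply: sem_Blk => //; rewrite addrK; apply: sem_Sq.
set s3 := run _ s2.
have ag3 : agree [:: (1, 13)]%N s2 s3 by agree_blk.
have rs3 : ready s3 by apply: ready_agree ag3 rs2.
have z3 : rarr s3 3 = rarr s 3 by rewrite (agreeRA ag3) // (agreeRA ag2).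
rewrite -z3; apply: sem_inner => //.
- by rewrite /k2 addr_ge0 // addr_ge0 // mulr_ge0.
- by rewrite /= (env_0 (ready_env rs2)) addr0.
- by move=> j hj; rewrite /= g2 // (agreeRA ag2).
move=> s4 ag4; have rs4 : ready s4 by apply: ready_agree ag4 rs3.
rewrite addrA; apply: (det_finish rs4) => s5 [ag5 z5].
have -> : err (fun j => rarr s4 3 j + disp s4 j) = err (rarr s5 3).
  rewrite /err; congr (nsq (_ *m (_ - _))); apply/matrixP => j q.
  by rewrite !mxE z5.
apply: HK; first by apply: ready_agree ag5 rs4.
by rewrite (agreeR ag5) // (agreeR ag4) // (agreeR ag3) // (agreeR ag2).
Qed.

Lemma epoch_cost_ge0 : 0 <= epoch_cost.
Proof.
have k1 := kap_gt0 mu_min mu_gt0; rewrite /epoch_cost.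
apply: addr_ge0; first by rewrite !addr_ge0 ?mulr_ge0.
apply: mulr_ge0; first by apply: mulr_ge0 (ltW k1).
rewrite addr_ge0 // addr_ge0 // sumr_ge0 // => i _.
apply: mulr_ge0; last by rewrite addr_ge0 ?mulr_ge0.
apply: divr_ge0; last exact: ltW (fro_gt0 mu_min mu_gt0).
by apply: sumr_ge0 => j _; apply: sqr_ge0.
Qed.

(** Register 19 doubles while the expected error is at least halved, so the charge, a multiple of
    their product, does not grow. The count [k] lives only in the analysis; the machine just
    compares the register with 1. *)
Lemma sem_epochs k s (K : state R -> R -> Prop) H : ready s -> 0 <= H ->
  0 <= rreg s 19 -> 1 <= rreg s 19 * 2 ^+ k ->
  (forall s', ready s' -> 1 <= rreg s' 19 -> K s' (H * rreg s' 19 * err (rarr s' 3))) ->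
  sem P Ev T (While (GR 19 20) epoch) s K
    (H * rreg s 19 * err (rarr s 3) + k%:R * (epoch_cost + 2) + 2).
Proof.
move=> rs H0 q0 hk HK.
have ec0 := epoch_cost_ge0.
(* The loop may end before [k] epochs; what remains of their charge is nonnegative. *)
have exit_loop s' m : ready s' -> 1 <= rreg s' 19 ->
    sem P Ev T (While (GR 19 20) epoch) s' K
      (H * rreg s' 19 * err (rarr s' 3) + m%:R * (epoch_cost + 2) + 2).
  move=> rs' hq; apply: (@sem_le _ _ _ _ _ _ _ (H * rreg s' 19 * err (rarr s' 3) + 2)).
    by apply: sem_While; rewrite /= (ready_1 rs') ltNge hq /= addrK; apply: HK.
  by rewrite lerD2r lerDl mulr_ge0 // addr_ge0.
elim: k s rs q0 hk => [|k IH] s rs q0 hk.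
  by apply: exit_loop => //; move: hk; rewrite expr0 mulr1.
case: (leP 1 (rreg s 19)) => hq; first exact: exit_loop.
apply: sem_While; rewrite /= (ready_1 rs) hq.
have -> : H * rreg s 19 * err (rarr s 3) + k.+1%:R * (epoch_cost + 2) + 2 - 1 =
  (H * (rreg s 19 + rreg s 19)) / 2 * err (rarr s 3)
  + (k%:R * (epoch_cost + 2) + 2 + 1) + epoch_cost.
  by rewrite -natr1; lra.
apply: sem_epoch => //.
- by apply: mulr_ge0 => //; apply: addr_ge0.
- by rewrite !addr_ge0 // mulr_ge0 // addr_ge0.
move=> s' rs' q'; apply: sem_le (IH _ rs' _ _) _.
- by rewrite q' addr_ge0.
- by apply: le_trans hk _; rewrite q' exprS; lra.
- by rewrite -q'; lra.
Qed.

End Epoch.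

(** * Running time *)

Definition main D := Sq (setup D) (While (GR 19 20) epoch).

Section Costs.
Variable R : realType.
Variables (n d : nat) (A : 'M[R]_(n, d)) (b : 'cV[R]_n) (mu : R).
Implicit Types s : state R.

Local Notation ptr := (ptr A).
Local Notation rlen := (rlen A).
Local Notation rl1 := (rl1 A).
Local Notation rl2 := (rl2 A).
Local Notation fro := (fro A).
Local Notation kap := (kap A mu).
Local Notation sbase := (sbase A).
Local Notation bsq := (bsq A mu).
Local Notation bsize := (bsize A mu).

Local Notation nblk := (nblk A mu).
Local Notation step_cost := (step_cost A mu).
Local Notation epoch_cost := (epoch_cost A mu).
Local Notation err := (err A b).
Hypothesis nzrows : forall i : 'I_n, row i A != 0.
Hypothesis mu_min : is_smallest_eigenvalue (A^T *m A) mu.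
Hypothesis mu_gt0 : 0 < mu.

Definition setup_cost : R := 5 * d%:R + 48 * (ptr n)%:R + 49 * n%:R + 27.

(** Markov's inequality as a charge: at exit it is [T / rho] times register 19 times the error,
    hence at least [T] when the error exceeds [rho]. Initially it is at most [T / D]. *)
Lemma main_bound D T k (x0 : 'cV[R]_d) (eps rho : R) : (0 < D)%N -> 0 < eps ->
  1 <= eps * eps / D%:R * 2 ^+ k -> 0 < rho -> eps ^+ 2 * err (vec_cells x0) <= rho ->
  T%:R - (T%:R / D%:R + k%:R * (epoch_cost + 2) + 2 + setup_cost)
  <= T%:R * halt_prob (compile 0 (main D)) (fun c => err (rarr c 3) <= rho) T
       (input_state A b x0 mu eps).
Proof.
move=> D0 e0 hk r0 hr; set Ev := fun c => _.
set W := _ + setup_cost.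
have D0' : 0 < D%:R :> R by rewrite ltr0n.
pose K s (w : R) := 0 <= w /\ (~ Ev s -> T%:R <= w).
have H0 : 0 <= T%:R / rho :> R by rewrite divr_ge0 // ltW.
have S : sem (compile 0 (main D)) Ev T (main D) (input_state A b x0 mu eps) K W.
  apply: sem_Sq.
  have ds : det (setup D) (input_state A b x0 mu eps) (fun s' => [/\ ready A b mu s',
      rreg s' 19 = eps * eps / D%:R &
      forall j, (j < d)%N -> rarr s' 3 j = vec_cells x0 j]) setup_cost.
    by apply: det_setup.
  rewrite /W; apply: ds => s [rs q z].
  have q0 : 0 <= rreg s 19 by rewrite q divr_ge0 // mulr_ge0 // ltW.
  rewrite -q in hk.
  apply: (sem_le (sem_epochs nzrows mu_min mu_gt0 rs H0 q0 hk _)).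
    move=> s' _ q'; split; first by apply: mulr_ge0 (nsq_ge0 _); apply: mulr_ge0 => //; lra.
    move=> /negP; rewrite -ltNge => lt.
    have h1 : T%:R <= T%:R / rho * err (rarr s' 3).
      by rewrite mulrAC ler_pdivlMr // ler_wpM2l // ltW.
    apply: le_trans h1 _; rewrite [X in _ <= X]mulrAC ler_peMr //.
    by rewrite mulr_ge0 // nsq_ge0.
  rewrite !lerD2r q.
  have -> : err (rarr s 3) = err (vec_cells x0).
    by rewrite /err; congr (nsq (_ *m (_ - _))); apply/matrixP => i j; rewrite !mxE z.
  have -> : T%:R / rho * (eps * eps / D%:R) * err (vec_cells x0)
     = T%:R / D%:R * (eps ^+ 2 * err (vec_cells x0) / rho).
    by field; rewrite !gt_eqF.
  by rewrite ler_piMr ?divr_ge0 // ler_pdivrMr // mul1r.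
have pl : placed (compile 0 (main D)) 0 (main D).
  by exists [::], [::]; rewrite cats0.
have [|_ h] := S 0%N T pl; last exact: h.
move=> t' s w' _ [w0 hw]; apply: bounded_halt => //.
Qed.

Definition budget : R := (nnz A)%:R + Num.sqrt (kappa A mu)
  * \sum_(i < n) (l2norm (row i A) ^+ 2 / mu) * Num.sqrt (numerical_sparsity A i).

Definition spars i : R := rl1 i ^+ 2 / rl2 i.

Definition sampling_budget : R :=
  Num.sqrt kap * \sum_(0 <= i < n) (rl2 i / mu) * Num.sqrt (spars i).

Lemma budgetE : budget = (ptr n)%:R + sampling_budget.
Proof.
rewrite /budget nnz_ptr /sampling_budget big_mkord; congr (_ + Num.sqrt _ * _).
  by rewrite /kappa l2norm_sq /kap fro_frob.
apply: eq_bigr => i _.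
have e2 : l2norm (row i A) ^+ 2 = rl2 i.
  by rewrite l2norm_sq /frob big_ord1 rl2_row; apply: eq_bigr => j _; rewrite mxE.
rewrite /numerical_sparsity e2 /spars; congr (_ * Num.sqrt (_ ^+ 2 / _)).
by rewrite /l1norm big_ord1 rl1_row; apply: eq_bigr => j _; rewrite mxE.
Qed.

Lemma spars_ge1 i : (i < n)%N -> 1 <= spars i.
Proof.
by move=> hi; rewrite /spars ler_pdivlMr ?rl2_gt0 // mul1r rl2_le.
Qed.

(** With [x = sqrt (kappa s_i)] the block size satisfies [N <= (B + 1) x]. The blocks have at most
    [2 N + B] slots in all, which is at most [5 x B] since [B] and [x] are at least 1. *)
Lemma nblk_le i : (i < n)%N -> (nblk i)%:R <= 5 * (Num.sqrt kap * Num.sqrt (spars i)).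
Proof.
move=> hi; have k1 := kap_ge1 mu_min mu_gt0; have s1 := spars_ge1 hi.
have k0 := kap_gt0 mu_min mu_gt0; have l0 := rl1_gt0 nzrows hi.
have l20 := rl2_gt0 nzrows hi.
rewrite -sqrtrM; last exact: ltW.
set x := Num.sqrt _.
have x2 : x ^+ 2 = kap * spars i by rewrite sqr_sqrtr // mulr_ge0; lra.
have x1 : 1 <= x by rewrite -sqrtr1 ler_wsqrtr //; nra.
set B : R := (bsize i)%:R.
have B1 : 1 <= B by rewrite ler1n bsize_gt0.
have hN : (rlen i)%:R <= (B + 1) * x.
  rewrite -ler_sqr ?nnegrE //; last by apply: mulr_ge0; lra.
  have := bsize_ge A mu i; rewrite -natr1 -/B => h.
  have -> : (rlen i)%:R ^+ 2 = bsq i * x ^+ 2.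
    by rewrite x2 /bsq /spars; field; rewrite !gt_eqF.
  by rewrite exprMn ler_wpM2r ?sqr_ge0.
have [_] := nblkP A mu i.
have L : (sbase i.+1 - sbase i <= 2 * rlen i)%N.
  rewrite {1}/sbase big_nat_recr //= addKn; exact: tau_sum_le.
move=> h; have {}h : (nblk i * bsize i <= 2 * rlen i + bsize i)%N by lia.
move: h; rewrite -(ler_nat R) natrD !natrM -/B => h.
have : (nblk i)%:R * B <= 5 * x * B by nra.
by rewrite ler_pM2r //; lra.
Qed.

(** [kappa] is the sum of [||a_i||^2 / mu], and both square roots are at least 1. This absorbs fixed
    costs per inner step, of which an epoch has order [kappa]. *)
Lemma kap_le : kap <= sampling_budget.
Proof.
have k1 := kap_ge1 mu_min mu_gt0.
have le : kap <= \sum_(0 <= i < n) (rl2 i / mu) * Num.sqrt (spars i).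
  rewrite /kap fro_rows mulr_suml; apply: ler_sum_nat => i hi.
  have s1 := spars_ge1 hi.
  have a2 : 1 <= Num.sqrt (spars i) by rewrite -sqrtr1 ler_wsqrtr.
  by rewrite ler_peMr //; apply: divr_ge0; apply: ltW => //; apply: rl2_gt0.
have a1 : 1 <= Num.sqrt kap by rewrite -sqrtr1 ler_wsqrtr.
have s0 := le_trans (ltW (kap_gt0 mu_min mu_gt0)) le.
apply: (le_trans le); rewrite /sampling_budget -[X in X <= _]mul1r.
exact: ler_wpM2r s0 _ _ a1.
Qed.

Lemma step_cost_le : kap * (2 + step_cost) <= 168 * sampling_budget.
Proof.
have k1 := kap_ge1 mu_min mu_gt0; have k0 := kap_gt0 mu_min mu_gt0.
have F0 := fro_gt0 mu_min mu_gt0.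
rewrite /step_cost.
have -> : kap * (2 + (6 + \sum_(0 <= i < n) rl2 i / fro * (29 * (nblk i)%:R + 15)))
  = 8 * kap + \sum_(0 <= i < n) rl2 i / mu * (29 * (nblk i)%:R + 15).
  have -> : \sum_(0 <= i < n) rl2 i / mu * (29 * (nblk i)%:R + 15)
     = kap * \sum_(0 <= i < n) rl2 i / fro * (29 * (nblk i)%:R + 15).
    rewrite mulr_sumr; apply: eq_bigr => i _; rewrite /kap; field.
    by rewrite !gt_eqF.
  by lra.
(* [29 * 5 + 15 = 160]; the other 8 of the claim comes from [kap_le]. *)
have : \sum_(0 <= i < n) rl2 i / mu * (29 * (nblk i)%:R + 15) <= 160 * sampling_budget.
  rewrite /sampling_budget !mulr_sumr; apply: ler_sum_nat => i hi.
  have l20 := rl2_gt0 nzrows hi; have := nblk_le hi; have s1 := spars_ge1 hi.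
  have x1 : 1 <= Num.sqrt kap * Num.sqrt (spars i).
    have a1 : 1 <= Num.sqrt kap by rewrite -sqrtr1 ler_wsqrtr.
    have a2 : 1 <= Num.sqrt (spars i) by rewrite -sqrtr1 ler_wsqrtr.
    by nra.
  move=> h.
  have c0 : 0 <= rl2 i / mu by apply: divr_ge0; apply: ltW.
  have -> : 160 * (Num.sqrt kap * (rl2 i / mu * Num.sqrt (spars i)))
    = rl2 i / mu * (160 * (Num.sqrt kap * Num.sqrt (spars i))) by ring.
  by apply: ler_wpM2l => //; lra.
by have := kap_le; lra.
Qed.

Lemma n_le_ptr : n%:R <= (ptr n)%:R :> R.
Proof.
rewrite -sum_rlen -[n in n%:R]subn0 -[(n - 0)%:R]mulr1 -sumr_nat_const.
by apply: ler_sum_nat => i hi; rewrite ler1n rlen_gt0.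
Qed.

Lemma budget_ge1 : 1 <= budget.
Proof.
rewrite budgetE; have := kap_le; have := kap_ge1 mu_min mu_gt0.
by have := ler0n R (ptr n); lra.
Qed.

Lemma setup_cost_le : setup_cost + 2 <= 200 * budget.
Proof.
rewrite budgetE /setup_cost; have := n_le_ptr; have := kap_le.
have := kap_ge mu_min mu_gt0; have := kap_ge1 mu_min mu_gt0.
by have := ler0n R (ptr n); lra.
Qed.

Lemma epoch_cost_le : epoch_cost + 2 <= 2400 * 169 * budget.
Proof.
rewrite budgetE /epoch_cost; have := n_le_ptr; have := kap_le.
have := kap_ge mu_min mu_gt0; have := kap_ge1 mu_min mu_gt0; have := step_cost_le.
set x := kap * (2 + step_cost).
have -> : 2400 * kap * (2 + step_cost) = 2400 * x by rewrite /x mulrA.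
by have := ler0n R (ptr n); lra.
Qed.

End Costs.

(** The number of epochs: the binary logarithm of [D / eps^2], rounded up. *)
Lemma doublings (R : realType) (D : nat) (eps : R) : (0 < D)%N -> 0 < eps < 1 ->
  exists2 k : nat, 1 <= eps * eps / D%:R * 2 ^+ k &
    k%:R <= (ln D%:R + 2 * ln (1 / eps)) / ln 2 + 1.
Proof.
move=> D0 /andP[e0 e1].
have D0' : 0 < D%:R :> R by rewrite ltr0n.
have l2 : 0 < ln 2 :> R by rewrite ln_gt0 // ltr1n.
have lD : 0 <= ln D%:R :> R by rewrite ln_ge0 // ler1n.
have le : 0 < ln (1 / eps) by rewrite ln_gt0 // ltr_pdivlMr // mul1r.
have lE : ln (1 / eps) = - ln eps by rewrite div1r lnV.
set x := _ / ln 2.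
have x0 : 0 < x by rewrite divr_gt0 //; lra.
exists (ceiln x); last exact: ltW (ceiln_lt x0).
have p2 : 0 < 2 ^+ ceiln x :> R by rewrite exprn_gt0.
have ee : 0 < eps * eps by rewrite mulr_gt0.
have eD : 0 < eps * eps / D%:R by rewrite divr_gt0.
suff : ln 1 <= ln (eps * eps / D%:R * 2 ^+ ceiln x).
  by rewrite ler_ln ?posrE // mulr_gt0.
rewrite ln1 lnM ?posrE // ln_div ?posrE // lnM ?posrE //.
rewrite lnXn // -[ln 2 *+ _]mulr_natr.
have : ln D%:R + 2 * ln (1 / eps) <= (ceiln x)%:R * ln 2.
  by rewrite -ler_pdivrMr // ceiln_ge.
by rewrite lE => {p2 eD ee x0}; lra.
Qed.

Lemma approx_of_err (R : realType) (n d : nat) (A : 'M[R]_(n, d)) (b : 'cV[R]_n)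
    (x0 : 'cV[R]_d) (mu eps : R) (c : state R) :
  is_smallest_eigenvalue (A^T *m A) mu -> 0 < mu -> 0 < eps ->
  err A b (rarr c 3) <= eps ^+ 2 * err A b (vec_cells x0) ->
  approx_solution A b x0 eps (output d c).
Proof.
move=> mu_min mu_gt0 e0 h; exists (opt A b); first exact: (opt_solution b mu_min mu_gt0).
rewrite !mnorm_gram.
have -> : output d c = vec d (rarr c 3) by [].
have -> : x0 = vec d (vec_cells x0).
  by apply/matrixP => i j; rewrite ord1 mxE /vec_cells (valK i).
rewrite -[X in X * _](gtr0_norm e0) -sqrtr_sqr -sqrtrM ?sqr_ge0 //.
exact: ler_wsqrtr.
Qed.

Theorem theorem3 (R : realType) (delta : R) (hdelta : 0 < delta < 1) :
  exists P : program,
    forall eps0 : R, 0 < eps0 < 1 ->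
    exists C : R,
    forall (n d : nat) (A : 'M[R]_(n, d)) (b : 'cV[R]_n) (x0 : 'cV[R]_d)
           (mu eps : R),
      (forall i : 'I_n, row i A != 0) ->
      is_smallest_eigenvalue (A^T *m A) mu ->
      0 < mu ->
      kappa A mu <= d%:R ^+ 2 ->
      0 < eps <= eps0 ->
      exists t : nat,
        t%:R <= C * (((nnz A)%:R
                      + Num.sqrt (kappa A mu)
                        * \sum_(i < n) (l2norm (row i A) ^+ 2 / mu)
                                       * Num.sqrt (numerical_sparsity A i))
                     * ln (1 / eps))
        /\ 1 - delta <= halt_prob P
             (fun c => approx_solution A b x0 eps (output d c))
             t (input_state A b x0 mu eps).
Proof.
have [d0 d1] := andP hdelta.
have dd : 0 < 2 / delta by rewrite divr_gt0.
(* Half of [delta] goes to inaccurate outputs, through [T / D <= T delta / 2]; the other half goes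
   to the time, through [T >= 2 W / delta]. *)
pose D := ceiln (2 / delta).
have D0 : (0 < D)%N by exact: ceiln_gt0.
exists (compile 0 (main D)) => eps0 /andP[f0 f1].
have L0 : 0 < ln (1 / eps0) by rewrite ln_gt0 // ltr_pdivlMr // mul1r.
have l2 : 0 < ln 2 :> R by rewrite ln_gt0 // ltr1n.
have lD : 0 <= ln D%:R :> R by rewrite ln_ge0 // ler1n.
set l0 := ln (1 / eps0) in L0 *.
pose q : R := 2400 * 169.
have q0 : 0 <= q by rewrite mulr_ge0.
(* Additive constants are absorbed by [1 <= ln (1 / eps) / l0], which holds as [eps <= eps0]. *)
pose kb := (2 + ln D%:R / l0) / ln 2 + 1 / l0.
exists (2 / delta * (kb * q + 200 / l0) + 1 / l0).
move=> n d A b x0 mu eps nzrows mu_min mu_gt0 _ /andP[e0 e1].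
have [|k hk kle] := @doublings R D eps D0; first by rewrite e0 (le_lt_trans e1).
set L := ln (1 / eps) in kle *.
have lL : l0 <= L.
  rewrite /l0 /L ler_ln ?posrE ?divr_gt0 // !div1r lef_pV2 //.
rewrite -/(budget A mu).
have B1 := budget_ge1 nzrows mu_min mu_gt0.
have sc := setup_cost_le nzrows mu_min mu_gt0.
have ec := epoch_cost_le nzrows mu_min mu_gt0; rewrite -/q in ec.
set Bd := budget A mu in B1 sc ec *.
pose W := k%:R * (epoch_cost A mu + 2) + 2 + setup_cost A.
have kb_le : k%:R <= kb * L.
  apply: le_trans kle _.
  have r1 : 1 <= L / l0 by rewrite ler_pdivlMr // mul1r.
  have -> : kb * L = (ln D%:R * (L / l0) + 2 * L) / ln 2 + L / l0.
    by rewrite /kb; field; rewrite !gt_eqF.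
  apply: lerD => //; rewrite ler_pM2r ?invr_gt0 // lerD2r.
  exact: ler_peMr.
have L_gt0 : 0 < L by apply: lt_le_trans lL.
have W_le : W <= (kb * q + 200 / l0) * (Bd * L).
  have r1 : 1 <= L / l0 by rewrite ler_pdivlMr // mul1r.
  have h1 : k%:R * (epoch_cost A mu + 2) <= kb * L * (q * Bd).
    apply: (@le_trans _ _ (k%:R * (q * Bd))); first exact: ler_wpM2l.
    by apply: ler_wpM2r => //; apply: mulr_ge0 => //; lra.
  have h2 : 200 * Bd <= 200 * Bd * (L / l0) by rewrite ler_peMr // mulr_ge0 //; lra.
  have -> : (kb * q + 200 / l0) * (Bd * L) = kb * L * (q * Bd) + 200 * Bd * (L / l0).
    by ring.
  by rewrite /W; lra.
have W0 : 0 < W.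
  have s0 : 0 <= setup_cost A by rewrite /setup_cost !addr_ge0 ?mulr_ge0.
  have ec0 := epoch_cost_ge0 mu_min mu_gt0.
  have := mulr_ge0 (ler0n R k) (addr_ge0 ec0 (ler0n R 2)).
  by rewrite /W; lra.
have x0_gt : 0 < 2 * W / delta by rewrite divr_gt0 // mulr_gt0.
pose T := ceiln (2 * W / delta).
have T1 : 2 * W / delta <= T%:R := ceiln_ge x0_gt.
have T2 : T%:R < 2 * W / delta + 1 := ceiln_lt x0_gt.
have T0 : 0 < T%:R :> R by apply: lt_le_trans T1.
exists T; split.
  have h1 : 2 * W / delta <= 2 / delta * ((kb * q + 200 / l0) * (Bd * L)).
    by rewrite mulrAC; apply: ler_wpM2l => //; apply: ltW.
  have h2 : 1 <= 1 / l0 * (Bd * L).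
    rewrite mulrC mulrA mulr1 ler_pdivlMr // mul1r; nra.
  apply: (le_trans (ltW T2)); rewrite mulrDl -mulrA; lra.
set Ev := fun c => _.
have D2 : 2 / delta <= D%:R := ceiln_ge dd.
have D0' : 0 < D%:R :> R by rewrite ltr0n.
have TD : T%:R / D%:R <= T%:R * delta / 2.
  rewrite ler_pdivrMr // -!mulrA ler_peMr //.
  by move: D2; rewrite ler_pdivrMr //; lra.
have TW : W <= T%:R * delta / 2.
  by move: T1; rewrite ler_pdivrMr //; lra.
have key rho : 0 < rho -> eps ^+ 2 * err A b (vec_cells x0) <= rho ->
    1 - delta <= halt_prob (compile 0 (main D)) (fun c => err A b (rarr c 3) <= rho) T
      (input_state A b x0 mu eps).
  move=> r0 hr; rewrite -(ler_pM2l T0).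
  apply: le_trans (main_bound nzrows mu_min mu_gt0 T D0 e0 hk r0 hr).
  by rewrite /W in TW; lra.
(* If [x0] is optimal the required tolerance is 0, where [key] does not apply; [halt_prob_gap] gives
   a positive one that is as strict for this run. *)
have [z|nz] := leP (err A b (vec_cells x0)) 0.
  have [rho r0 hr] := halt_prob_gap (compile 0 (main D))
    (fun c => err A b (rarr c 3)) T (input_state A b x0 mu eps).
  have z0 : err A b (vec_cells x0) = 0 by apply: le_anti; rewrite z nsq_ge0.
  apply: le_trans (key rho r0 _) _; first by rewrite z0 mulr0 ltW.
  apply: le_trans hr _; apply: halt_prob_mono => c h.
  by apply: approx_of_err mu_min mu_gt0 e0 _; rewrite z0 mulr0.
apply: le_trans (key _ _ (lexx _)) _; first by rewrite mulr_gt0 // exprn_gt0.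
by apply: halt_prob_mono => c h; apply: approx_of_err mu_min mu_gt0 e0 h.
Qed.
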